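(* Let $n\ge 1$, $\alpha\in(0,1)$, $u_0\in BUC(\mathbb{R}^n)$, and let $F:\mathbb{R}^n\times[0,\infty)\times\mathbb{R}^n\times\mathbb{S}^n\to\mathbb{R}$ be continuous and degenerate elliptic, with $$M_R:=\sup\{|F(x,t,p,X)|:\ (x,t)\in\mathbb{R}^n\times[0,\infty),\ |p|,|X|\le R\}<\infty\quad\text{for every } R>0.$$ Consider the Cauchy problem $$\partial_t^\alpha u+F(x,t,Du,D^2u)=0\ \text{ for } x\in\mathbb{R}^n,\ t>0,\qquad (\mathrm{E})$$ $$u(x,0)=u_0(x)\ \text{ for } x\in\mathbb{R}^n,\qquad (\mathrm{I})$$ and, for $\lambda>0$, $t>0$ and $g\in BUC(\mathbb{R}^n)$, the elliptic equation $$\lambda u(x)+F(x,t,Du(x),D^2u(x))=g(x)\quad\text{in }\mathbb{R}^n.\qquad (\mathrm{Ell})$$ Assume: (H1) For every $\lambda>0$, every $g\in BUC(\mathbb{R}^n)$ and every $t>0$, there exists a viscosity solution $u\in BUC(\mathbb{R}^n)$ of (Ell). Moreover, if $u,v\in BUC(\mathbb{R}^n)$ are, respectively, a viscosity subsolution and a viscosity supersolution of (Ell) (with the same fixed $\lambda$, $t$, $g$), then $u\le v$ in $\mathbb{R}^n$. (H2) If $u\in USC(\mathbb{R}^n\times[0,\infty))$ and $v\in LSC(\mathbb{R}^n\times[0,\infty))$ are, respectively, a viscosity subsolution and a viscosity supersolution of (E), both bounded in $\mathbb{R}^n\times[0,T)$ for every $T>0$, and $u(\cdot,0)\le v(\cdot,0)$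 in $\mathbb{R}^n$, then $u\le v$ in $\mathbb{R}^n\times[0,\infty)$. For each $h>0$ let $u_0^h\in BUC(\mathbb{R}^n)$ be such that $\sup_{\mathbb{R}^n}|u_0^h-u_0|\to0$ as $h\to0$, and let $u^h:\mathbb{R}^n\times[0,\infty)\to\mathbb{R}$ be the function produced by the discrete scheme with initial datum $u_0^h$ (defined in the context). Then $u^h\to u$ locally uniformly in $\mathbb{R}^n\times[0,\infty)$ as $h\to0$, where $u$ is the unique viscosity solution of (E)–(I).
   Context: Notation. $\mathbb{S}^n$ is the space of real symmetric $n\times n$ matrices with its usual order; $BUC(\mathbb{R}^n)$ is the space of bounded uniformly continuous functions on $\mathbb{R}^n$; $USC$/$LSC$ denote upper/lower semicontinuous real-valued functions. $Du$, $D^2u$ are the spatial gradient and Hessian. $F$ is degenerate elliptic if $F(x,t,p,X_1)\le F(x,t,p,X_2)$ for all $x\in\mathbb{R}^n$, $t\ge0$, $p\in\mathbb{R}^n$ and $X_1,X_2\in\mathbb{S}^n$ with $X_1\ge X_2$. Caputo's derivative is $$\partial_t^\alpha u(x,t):=\frac1{\Gamma(1-\alpha)}\int_0^t(t-s)^{-\alpha}\partial_su(x,s)\,ds,$$ where $\Gamma$ is the Gamma function. Viscosity solutions of (E). For $T>0$, a function $u\in USC(\mathbb{R}^n\times[0,T))$ (resp. $u\in LSC(\mathbb{R}^n\times[0,T))$) is a viscosity subsolution (resp. supersolution) of (E) if for every $\phi\in C^2(\mathbb{R}^n\times[0,T))$ one has $$\partial_t^\alpha\phi(x_0,t_0)+F(x_0,t_0,D\phi(x_0,t_0),D^2\phi(x_0,t_0))\le0\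 (\text{resp. }\ge0)$$ whenever $u-\phi$ attains a local maximum (resp. local minimum) at $(x_0,t_0)\in\mathbb{R}^n\times(0,T)$. A function $u\in C(\mathbb{R}^n\times[0,T))$ is a viscosity solution of (E) if it is both a viscosity subsolution and a viscosity supersolution. A function on $\mathbb{R}^n\times[0,\infty)$ is a sub-/supersolution/solution of (E) if its restriction to $\mathbb{R}^n\times[0,T)$ is one for every $T>0$. A viscosity solution of (E)–(I) is a viscosity solution $u\in C(\mathbb{R}^n\times[0,\infty))$ of (E) with $u(\cdot,0)=u_0$. Viscosity sub-/supersolutions of elliptic equations are understood in the standard sense. Discrete scheme. Let $f(r):=r^{1-\alpha}-(r-1)^{1-\alpha}$ for $r\ge1$; for $m\in\mathbb{N}=\{1,2,\dots\}$ let $C_{m,0}:=f(m)$ and $C_{m,k}:=f(m-k)-f(m-(k-1))$ for $k=1,\dots,m-1$. Fix $h>0$. Set $U^h(\cdot,0):=u_0^h$ and, inductively for $m\ge1$, let $U^h(\cdot,mh)\in BUC(\mathbb{R}^n)$ be the unique viscosity solution in $BUC(\mathbb{R}^n)$ (it exists by (H1)) of $$\frac{1}{\Gamma(2-\alpha)h^\alpha}\Big\{u(x)-\sum_{k=0}^{m-1}C_{m,k}U^h(x,kh)\Big\}+F(x,mh,Du,D^2u)=0\quad\text{in }\mathbb{R}^n.$$ Define $u^h(x,t):=U^h(x,mh)$ for $x\in\mathbb{R}^n$, $t\in[mh,(m+1)h)$, $m\in\mathbb{N}\cup\{0\}$.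
   Formalization: In the definition of viscosity sub-/supersolution of (E), ''local maximum/minimum'' is taken near x_0 but over all past times in [0,t_0], since a purely local one admits no solutions; u is unique among solutions bounded on R^n×[0,T) for every T. *)

(* Defs.v *)
From HB Require Import structures.
From mathcomp Require Import all_boot all_order all_algebra.
From mathcomp Require Import all_classical all_reals all_analysis.
Set Implicit Arguments.
Unset Strict Implicit.
Unset Printing Implicit Defensive.
Import Order.TTheory GRing.Theory Num.Theory.
Import numFieldNormedType.Exports.
Local Open Scope classical_set_scope.
Local Open Scope ring_scope.

Section FunctionSpaces.
Context {R : realType}.

Definition BUC {V : normedModType R} (f : V -> R) : Prop :=
  bounded_fun f /\ unif_continuous f.

Definition lsc_on {V : topologicalType} (A : set V) (f : V -> R) : Prop :=
  lower_semicontinuous ((fun z => (f z)%:E) : subspace A -> \bar R).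

Definition usc_on {V : topologicalType} (A : set V) (f : V -> R) : Prop :=
  lsc_on A (fun z => - f z).

Definition continuously_extends {V : topologicalType} (A : set V)
    (g : V -> R) : Prop :=
  exists2 k : V -> R, {within A, continuous k} & forall z, A° z -> g z = k z.

(* C^2 up to the part of the boundary that lies in A: the derivatives of order
   at most 2 exist in the interior of A and extend continuously to A. On a
   finite-dimensional V this is the usual notion defined by partial derivatives
   along a basis. *)
Definition C2_on {V : normedModType R} (A : set V) (f : V -> R) : Prop :=
  [/\ {within A, continuous f},
      forall v, (forall z, A° z -> derivable f z v) /\
        continuously_extends A ('D_v f)
    & forall v w, (forall z, A° z -> derivable ('D_v f) z w) /\
        continuously_extends A ('D_w ('D_v f))].

Definition Gamma (a : R) : R :=
  \int[lebesgue_measure]_(t in `]0%R, +oo[) (t `^ (a - 1) * expR (- t)).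

End FunctionSpaces.

Section Elliptic.
Context {R : realType} {n : nat}.
Implicit Types (x p : 'rV[R]_n) (X : 'M[R]_n) (f u : 'rV[R]_n -> R).

Definition symmetric X : Prop := X^T = X.

Definition psd X : Prop := forall v : 'rV[R]_n, 0 <= (v *m X *m v^T) ord0 ord0.

Definition grad f x : 'rV[R]_n := \row_i 'D_(delta_mx ord0 i) f x.

Definition hess f x : 'M[R]_n :=
  \matrix_(i, j) 'D_(delta_mx ord0 j) ('D_(delta_mx ord0 i) f) x.

(* Viscosity sub- and supersolutions of G(x, u, Du, D^2u) = 0 in R^n. *)
Definition ell_subsolution (G : 'rV[R]_n -> R -> 'rV[R]_n -> 'M[R]_n -> R) u
    : Prop :=
  usc_on setT u /\
  forall (phi : 'rV[R]_n -> R) x0, C2_on setT phi ->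
    (\forall x \near x0, u x - phi x <= u x0 - phi x0) ->
    G x0 (u x0) (grad phi x0) (hess phi x0) <= 0.

Definition ell_supersolution (G : 'rV[R]_n -> R -> 'rV[R]_n -> 'M[R]_n -> R) u
    : Prop :=
  lsc_on setT u /\
  forall (phi : 'rV[R]_n -> R) x0, C2_on setT phi ->
    (\forall x \near x0, u x0 - phi x0 <= u x - phi x) ->
    0 <= G x0 (u x0) (grad phi x0) (hess phi x0).

Definition ell_solution (G : 'rV[R]_n -> R -> 'rV[R]_n -> 'M[R]_n -> R) u
    : Prop :=
  {within setT, continuous u} /\ ell_subsolution G u /\ ell_supersolution G u.

End Elliptic.

Section CauchyProblem.
Context {R : realType} {n : nat}.
Implicit Types (x p : 'rV[R]_n) (t : R) (X Y : 'M[R]_n).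
Implicit Types (F : 'rV[R]_n -> R -> 'rV[R]_n -> 'M[R]_n -> R).
Implicit Types (u phi : 'rV[R]_n * R -> R).

(* F is only meaningful for t >= 0 and symmetric X; its values elsewhere are
   left unconstrained and never used. *)
Definition F_continuous F : Prop :=
  {within [set z : 'rV[R]_n * R * 'rV[R]_n * 'M[R]_n |
             0 <= z.1.1.2 /\ symmetric z.2],
    continuous (fun z => F z.1.1.1 z.1.1.2 z.1.2 z.2)}.

Definition degenerate_elliptic F : Prop :=
  forall x t p X Y, 0 <= t -> symmetric X -> symmetric Y ->
    psd (X - Y) -> F x t p X <= F x t p Y.

Definition F_locally_bounded F : Prop :=
  forall r : R, 0 < r ->
    has_ubound [set y | exists x t p X,
      [/\ 0 <= t, symmetric X, `|p| <= r, `|X| <= r & y = `|F x t p X|]].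

(* lambda u + F(x, t, Du, D^2u) - g(x), at a fixed time t *)
Definition Ell F (lambda t : R) (g : 'rV[R]_n -> R)
    : 'rV[R]_n -> R -> 'rV[R]_n -> 'M[R]_n -> R :=
  fun x r p X => lambda * r + F x t p X - g x.

Definition strip (T : R) : set ('rV[R]_n * R) := [set z | 0 <= z.2 < T].

Definition spacetime : set ('rV[R]_n * R) := [set z | 0 <= z.2].

Definition caputo (alpha : R) phi x t : R :=
  (Gamma (1 - alpha))^-1 *
  \int[lebesgue_measure]_(s in `]0%R, t[)
    ((t - s) `^ (- alpha) * (fun r => phi (x, r))^`()%classic s).

(* The neighbourhood is local in space and towards the future, but contains the
   whole past {x0} x [0, t0]: the Caputo derivative of the test function depends
   on that past. If the comparison were imposed near (x0, t0) only, the test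
   function could be changed freely at earlier times, its Caputo derivative
   could be given arbitrary values, and no function touched by a test function
   would be a sub- or supersolution. *)
Definition local_max (T : R) u x0 (t0 : R) : Prop :=
  exists2 r : R, 0 < r & forall x t, `|x - x0| < r -> 0 <= t < T ->
    t < t0 + r -> u (x, t) <= u (x0, t0).

Definition local_min (T : R) u x0 (t0 : R) : Prop :=
  local_max T (fun z => - u z) x0 t0.

Definition subsolution_on (alpha : R) F (T : R) u : Prop :=
  usc_on (strip T) u /\
  forall phi x0 t0, C2_on (strip T) phi -> 0 < t0 < T ->
    local_max T (fun z => u z - phi z) x0 t0 ->
    caputo alpha phi x0 t0 +
      F x0 t0 (grad (fun y => phi (y, t0)) x0)
              (hess (fun y => phi (y, t0)) x0) <= 0.

Definition supersolution_on (alpha : R) F (T : R) u : Prop :=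
  lsc_on (strip T) u /\
  forall phi x0 t0, C2_on (strip T) phi -> 0 < t0 < T ->
    local_min T (fun z => u z - phi z) x0 t0 ->
    0 <= caputo alpha phi x0 t0 +
      F x0 t0 (grad (fun y => phi (y, t0)) x0)
              (hess (fun y => phi (y, t0)) x0).

Definition subsolution (alpha : R) F u : Prop :=
  forall T : R, 0 < T -> subsolution_on alpha F T u.

Definition supersolution (alpha : R) F u : Prop :=
  forall T : R, 0 < T -> supersolution_on alpha F T u.

Definition cauchy_solution (alpha : R) F (u0 : 'rV[R]_n -> R) u : Prop :=
  [/\ {within spacetime, continuous u}, subsolution alpha F u,
      supersolution alpha F u & forall x, u (x, 0) = u0 x].

Definition bounded_on_strips u : Prop :=
  forall T : R, 0 < T -> [bounded u z | z in strip T].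

Definition elliptic_wellposed F : Prop :=
  forall (lambda t : R) (g : 'rV[R]_n -> R), 0 < lambda -> 0 < t -> BUC g ->
    (exists2 u : 'rV[R]_n -> R, BUC u & ell_solution (Ell F lambda t g) u) /\
    (forall u v : 'rV[R]_n -> R, BUC u -> BUC v ->
       ell_subsolution (Ell F lambda t g) u ->
       ell_supersolution (Ell F lambda t g) v ->
       forall x, u x <= v x).

Definition parabolic_comparison (alpha : R) F : Prop :=
  forall u v, usc_on spacetime u -> lsc_on spacetime v ->
    subsolution alpha F u -> supersolution alpha F v ->
    bounded_on_strips u -> bounded_on_strips v ->
    (forall x, u (x, 0) <= v (x, 0)) ->
    forall x t, 0 <= t -> u (x, t) <= v (x, t).

End CauchyProblem.

Section Scheme.
Context {R : realType} {n : nat}.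

Definition scheme_f (alpha r : R) : R :=
  r `^ (1 - alpha) - (r - 1) `^ (1 - alpha).

Definition scheme_C (alpha : R) (m k : nat) : R :=
  if k == 0 then scheme_f alpha m%:R
  else scheme_f alpha (m%:R - k%:R) - scheme_f alpha (m%:R - (k%:R - 1)).

(* U m stands for U^h(., m h). *)
Definition is_scheme (alpha : R)
    (F : 'rV[R]_n -> R -> 'rV[R]_n -> 'M[R]_n -> R)
    (h : R) (u0h : 'rV[R]_n -> R) (U : nat -> 'rV[R]_n -> R) : Prop :=
  U 0 = u0h /\
  forall m : nat, (0 < m)%N ->
    BUC (U m) /\
    ell_solution
      (fun x r p X =>
         (Gamma (2 - alpha) * h `^ alpha)^-1 *
           (r - \sum_(0 <= k < m) scheme_C alpha m k * U k x)
         + F x (m%:R * h) p X)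
      (U m).

Definition scheme_interp (h : R) (U : nat -> 'rV[R]_n -> R)
    : 'rV[R]_n * R -> R :=
  fun z => U (Num.truncn (z.2 / h)) z.1.

End Scheme.

(* Main.v *)
(** Half-relaxed limits (Barles-Perthame). The weights C_{m,k} are nonnegative
    and sum to 1, so at a maximum point over x and over the time grid of
    u^h - phi the discrete fractional derivative of u^h dominates that of phi;
    as h -> 0 this makes the upper relaxed limit of u^h a viscosity subsolution,
    and the lower one a supersolution by changing the sign of u and F. Summation
    by parts turns the discrete derivative into a convolution of increments
    against f, which tends to Caputo's derivative by dominated convergence. The
    function t^alpha has discrete derivative bounded below uniformly in h, so
    A + c theta(x - a) + C t^alpha, with theta smooth and bounded, bounds u^h
    from above: this gives local boundedness and the correct initial values.
    (H2) then makes both relaxed limits coincide, which is locally uniform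
    convergence. *)

Require Import Defs.
From HB Require Import structures.
From mathcomp Require Import all_boot all_order all_algebra.
From mathcomp Require Import zify ring lra.
From mathcomp Require Import all_classical all_reals all_analysis.
From mathcomp Require Import measurable_realfun.
Set Implicit Arguments.
Unset Strict Implicit.
Unset Printing Implicit Defensive.
Import Order.TTheory GRing.Theory Num.Theory.
Import numFieldNormedType.Exports.
Local Open Scope classical_set_scope.
Local Open Scope ring_scope.

(** * Power kernels and the Gamma function *)

(** Caputo's derivative sees the whole past, so comparing u^h with a test function near (x0, t0) is
    not enough: maxima are taken over all grid times from 0 on, and the penalty d (theta(x - x0) +
    (t - t0)^2) localises them. Its discrete derivative is at most a constant times d, uniformly in
    h, so d and h go to 0 along one sequence, and the convergence to Caputo's derivative is used for
    phi itself. Space is not compact and F is bounded for bounded (p, X) only. Hence theta is built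
    from s^2/(1 + s^2): its derivatives are bounded, a large multiple of it dominates a bounded
    function away from the centre, and suprema over R^n that are not attained become maxima at an
    arbitrarily small cost. F is controlled on symmetric matrices only, while test functions are
    described by directional derivatives, whence Schwarz's theorem. Their time derivative lives in
    the interior of the strip and reaches t = 0 through a continuous extension; the bound this gives
    near t = 0 is what dominates the singular integral. *)

Lemma continuous_powR {R : realType} (p x : R) : 0 < x ->
  {for x, continuous (fun s : R => s `^ p)}.
Proof.
move=> x0; apply/differentiable_continuous/derivable1_diffP.
have ? := is_derive1_powR p x0.
exact: ex_derive.
Qed.

Lemma integral_powR_pos {R : realType} (c a b : R) : 0 < c -> 0 < a -> a < b ->
  (\int[lebesgue_measure]_(s in `[a, b]) (s `^ (c - 1))%:E
   = (c^-1 * (b `^ c - a `^ c))%:E)%E.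
Proof.
move=> c0 a0 ab.
have dF (x : R) : 0 < x ->
   is_derive x 1 (fun s : R => c^-1 * s `^ c) (x `^ (c - 1)).
  move=> x0.
  have d0 := is_derive1_powR c x0.
  have d1 : is_derive x 1 (c^-1 *: (fun s : R => s `^ c))
      (c^-1 *: (c * x `^ (c - 1))) by exact: is_deriveZ.
  apply: is_derive_eq d1 _.
  by rewrite /GRing.scale/= mulrA mulVf ?gt_eqF// mul1r.
rewrite (@continuous_FTC2 _ (fun s : R => s `^ (c - 1)) (fun s : R => c^-1 * s `^ c)) //.
- by rewrite -EFinB mulrBr.
- apply/continuous_in_subspaceT => x /[!inE]/= /[!in_itv]/= /andP[ax xb].
  by apply: continuous_powR; exact: lt_le_trans ax.
- split.
  + move=> x /[!in_itv]/= /andP[ax xb].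
    by have [] := dF x (lt_trans a0 ax).
  + apply: cvg_at_right_filter; apply: cvgMr; exact: continuous_powR.
  + apply: cvg_at_left_filter; apply: cvgMr; apply: continuous_powR.
    exact: lt_trans ab.
- move=> x /[!in_itv]/= /andP[ax xb].
  have d := dF x (lt_trans a0 ax).
  by rewrite derive1E; exact: derive_val.
Qed.

Lemma integral_powR0 {R : realType} (c b : R) : 0 < c -> 0 < b ->
  (\int[lebesgue_measure]_(s in `]0%R, b]) (s `^ (c - 1))%:E
   = (c^-1 * b `^ c)%:E)%E.
Proof.
move=> c0 b0.
(* With [n.+2] the left end stays strictly below [b], as [integral_powR_pos] requires. *)
pose I (n : nat) : set R := `[b / n.+2%:R, b]%classic.
have Ib : `]0%R, b]%classic = \bigcup_i I i.
  apply/seteqP; split=> x /=.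
    rewrite in_itv/= => /andP[x0 xb].
    exists (Num.truncn (b / x)) => //=; rewrite /I/= in_itv/= xb andbT.
    rewrite ler_pdivrMr// mulrC -ler_pdivrMr//.
    by apply: ltW; apply: lt_trans (truncnS_gt _) _; rewrite ltr_nat.
  move=> [i _]; rewrite /I/= in_itv/= => /andP[bx xb]; rewrite in_itv/= xb andbT.
  by apply: lt_le_trans bx; rewrite divr_gt0.
have cv1 : (\int[lebesgue_measure]_(s in I i) (s `^ (c - 1))%:E)%E @[i --> \oo]
    --> (\int[lebesgue_measure]_(s in `]0%R, b]) (s `^ (c - 1))%:E)%E.
  rewrite Ib; apply: ge0_nondecreasing_set_cvg_integral.
  - move=> i j ij; rewrite subsetEset => x; rewrite /I/= !in_itv/= => /andP[bx ->].
    rewrite andbT; apply: le_trans bx; rewrite ler_wpM2l ?(ltW b0)//.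
    by rewrite lef_pV2 ?posrE// ler_nat.
  - by move=> i; exact: measurable_itv.
  - move=> i; apply/measurable_EFinP/measurable_funTS; exact: measurable_powR.
  - by move=> i x _; rewrite lee_fin powR_ge0.
apply: (cvg_unique _ cv1) => //.
have -> : (fun i => \int[lebesgue_measure]_(s in I i) (s `^ (c - 1))%:E)%E
    = EFin \o (fun i : nat => c^-1 * (b `^ c - (b / i.+2%:R) `^ c)).
  apply/funext => i /=; rewrite integral_powR_pos//.
    by rewrite divr_gt0.
  by rewrite ltr_pdivrMr// ltr_pMr// ltr1n.
apply: cvg_EFin; first by near=> n.
rewrite -[X in _ --> X](_ : c^-1 * (b `^ c - 0) = _); last by rewrite subr0.
apply: cvgMr; apply: cvgB; first exact: cvg_cst.
have /cvg_at_rightP/(_ (fun i : nat => b / i.+2%:R)) := powR_cvg0 c0; apply; split.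
  by move=> i; rewrite divr_gt0.
rewrite -[X in _ --> X](mulr0 b); apply: cvgMr.
have := @cvg_harmonic R; rewrite -(cvg_shiftS (@harmonic R)) => hh; exact: hh.

Unshelve. all: by end_near. Qed.

Lemma set_itv0y_bigcup {R : realType} :
  `]0%R, +oo[%classic = \bigcup_i (`[(i.+1%:R : R)^-1, i.+1%:R])%classic.
Proof.
apply/seteqP; split=> x /=.
  rewrite in_itv/= andbT => x0.
  exists (maxn (Num.truncn x) (Num.truncn x^-1)) => //=; rewrite in_itv/=; apply/andP; split.
    rewrite invf_ple ?posrE//; apply: ltW; apply: lt_le_trans (truncnS_gt _) _.
    by rewrite ler_nat ltnS leq_maxr.
  apply: ltW; apply: lt_le_trans (truncnS_gt _) _.
  by rewrite ler_nat ltnS leq_maxl.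
by move=> [i _]; rewrite /= !in_itv/= andbT => /andP[+ _]; apply: lt_le_trans; rewrite invr_gt0.
Qed.

Definition gamma_integrand {R : realType} (a t : R) : R := t `^ (a - 1) * expR (- t).

Lemma measurable_gamma_integrand {R : realType} (a : R) (A : set R) :
  measurable_fun A (gamma_integrand a).
Proof.
apply: measurable_funTS; apply: measurable_funM; first exact: measurable_powR.
by apply: measurableT_comp => //; exact: oppr_measurable.
Qed.

Lemma continuous_gamma_integrand {R : realType} (a x : R) : 0 < x ->
  {for x, continuous (gamma_integrand a)}.
Proof.
move=> x0; apply: cvgM; first exact: continuous_powR.
by apply: continuous_comp; [exact: opp_continuous | exact: continuous_expR].
Qed.

Lemma gamma_integrand_ge0 {R : realType} (a t : R) : 0 <= gamma_integrand a t.
Proof. by rewrite mulr_ge0// ?powR_ge0// expR_ge0. Qed.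

Lemma gamma_integral_cvg {R : realType} (a : R) :
  (\int[lebesgue_measure]_(t in `[((i.+1%:R)^-1)%R, (i.+1%:R)%R]) (gamma_integrand a t)%:E)%E
    @[i --> \oo] -->
  (\int[lebesgue_measure]_(t in `]0%R, +oo[) (gamma_integrand a t)%:E)%E.
Proof.
rewrite set_itv0y_bigcup; apply: ge0_nondecreasing_set_cvg_integral.
- move=> i j ij; rewrite subsetEset => x; rewrite /= !in_itv/= => /andP[ix xi].
  apply/andP; split; last by apply: le_trans xi _; rewrite ler_nat ltnS.
  by apply: le_trans ix; rewrite lef_pV2 ?posrE// ler_nat ltnS.
- by move=> i; exact: measurable_itv.
- move=> i; apply/measurable_EFinP; exact: measurable_gamma_integrand.
- by move=> i x _; rewrite lee_fin gamma_integrand_ge0.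
Qed.

(** For these exponents t^(a - 1) <= 1 + t, and half of the exponential absorbs 1 + t because 1 +
    t/2 <= e^(t/2). The majorant is independent of [a] and has an explicit primitive. *)
Lemma gamma_integrand_le {R : realType} (a t : R) : 1 <= a <= 2 -> 0 <= t ->
  gamma_integrand a t <= 2 * expR (- (2^-1 * t)).
Proof.
move=> /andP[a1 a2] t0.
have p1 : (1 : R) `^ (a - 1) = 1 by rewrite powR1.
have h1 : t `^ (a - 1) <= 1 + t.
  have [t1|t1] := leP t 1.
    rewrite (@le_trans _ _ 1) ?lerDl//.
    by rewrite -[leRHS]p1; apply: ge0_ler_powR; rewrite ?nnegrE// subr_ge0.
  rewrite (@le_trans _ _ t) ?lerDr//.
  by rewrite -[leRHS]powRr1//; apply: ler_powR; [exact: ltW|lra].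
apply: (@le_trans _ _ ((1 + t) * expR (- t))).
  by rewrite /gamma_integrand ler_wpM2r// expR_ge0.
have -> : expR (- t) = expR (- (2^-1 * t)) * expR (- (2^-1 * t)).
  by rewrite -expRD; congr expR; field.
rewrite mulrA ler_wpM2r ?expR_ge0// expRN ler_pdivrMr ?expR_gt0//.
have := expR_ge1Dx (2^-1 * t); lra.
Qed.

(** [Gamma] is the [fine] part of an extended integral, so an infinite integral would count as 0.
    Positivity thus has two halves: the mass on [1, 2] and the finiteness given by the exponential
    majorant. *)
Lemma Gamma_gt0 {R : realType} (a : R) : 1 <= a <= 2 -> 0 < Gamma a.
Proof.
move=> a12; have p1 : (1 : R) `^ (a - 1) = 1 by rewrite powR1.
rewrite /Gamma /Rintegral fine_gt0//; apply/andP; split.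
  have pos : (0 < (2^-1 * expR (- 2))%:E :> \bar R)%E.
    by rewrite lte_fin mulr_gt0// ?expR_gt0.
  apply: (lt_le_trans pos).
  apply: (@le_trans _ _ (\int[lebesgue_measure]_(t in `[1%R, 2%R]) (gamma_integrand a t)%:E)%E).
    apply: (@le_trans _ _ (\int[lebesgue_measure]_(t in `[1%R, 2%R]) ((2^-1 * expR (- 2)))%:E)%E).
      have e1 : lebesgue_measure (`[1%R, 2%R]%classic : set R) = 1%:E.
        by rewrite lebesgue_measure_itv/= lte_fin ltr1n -EFinB; congr EFin; ring.
      by rewrite integral_cst /= ?e1 ?mule1 ?lee_fin.
    apply: ge0_le_integral => /=.
    - exact: measurable_itv.
    - by move=> x _; rewrite lee_fin mulr_ge0// expR_ge0.
    - exact: measurable_cst.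
    - by apply/measurable_EFinP; exact: measurable_gamma_integrand.
    - move=> x; rewrite in_itv/= => /andP[x1 x2]; rewrite lee_fin ler_pM// ?expR_ge0 ?invr_ge0//.
        rewrite (@le_trans _ _ 1)//; first lra.
        have x0 : 0 <= x by lra.
        by rewrite -[leLHS]p1; apply: ge0_ler_powR; rewrite ?nnegrE// subr_ge0; case/andP: a12.
      by rewrite ler_expR lerN2.
  apply: ge0_subset_integral => //=.
  - by apply/measurable_EFinP; exact: measurable_gamma_integrand.
  - by move=> x _; rewrite lee_fin gamma_integrand_ge0.
  - by move=> x; rewrite /= !in_itv/= andbT => /andP[+ _]; apply: lt_le_trans.
apply: (@le_lt_trans _ _ (\int[lebesgue_measure]_(t in `[0%R, +oo[) (2 * expR (- (2^-1 * t)))%:E)%E).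
  apply: (@le_trans _ _ (\int[lebesgue_measure]_(t in `[0%R, +oo[) (gamma_integrand a t)%:E)%E).
    apply: ge0_subset_integral => //=.
    - by apply/measurable_EFinP; exact: measurable_gamma_integrand.
    - by move=> x _; rewrite lee_fin gamma_integrand_ge0.
    - by move=> x; rewrite /= !in_itv/= !andbT; apply: ltW.
  apply: ge0_le_integral => //=.
  - by move=> x _; rewrite lee_fin gamma_integrand_ge0.
  - by apply/measurable_EFinP; exact: measurable_gamma_integrand.
  - apply/measurable_EFinP; apply: measurable_funM => //.
    apply: measurableT_comp => //; apply: measurable_funTS.
    by apply: measurableT_comp; [exact: oppr_measurable|exact: mulrl_measurable].
  - by move=> x; rewrite in_itv/= andbT => x0; rewrite lee_fin gamma_integrand_le.
pose G (t : R) : R := - 4 * expR (- (2^-1 * t)).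
have dG (x : R) : is_derive x 1 G (2 * expR (- (2^-1 * x))).
  rewrite /G; apply: is_derive_eq; rewrite /GRing.scale/=; by field.
suff -> : (\int[lebesgue_measure]_(t in `[0%R, +oo[) (2 * expR (- (2^-1 * t)))%:E = 0%:E - (G 0)%:E)%E.
  by rewrite -EFinB ltry.
apply: ge0_continuous_FTC2y.
- by move=> x _; rewrite mulr_ge0// expR_ge0.
- apply: continuous_subspaceT => x; apply: cvgMr.
  apply: continuous_comp; last exact: continuous_expR.
  by apply: cvgN; apply: cvgMr; exact: cvg_id.
- rewrite -(mulr0 (- 4)); apply: cvgMr.
  apply: (@cvg_comp _ _ _ (fun x => 2^-1 * x) (fun x => expR (- x)) _ +oo%R).
    exact: gt0_cvgMry.
  exact: cvgr_expR.
- by move=> x _; exact: ex_derive.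
- apply: cvg_at_right_filter; apply/differentiable_continuous/derivable1_diffP.
  exact: ex_derive.
- by move=> x _; rewrite derive1E; exact: derive_val.
Unshelve. all: by end_near. Qed.

Lemma gamma_integrand_cvgy {R : realType} (a : R) : 1 <= a <= 2 ->
  gamma_integrand a t @[t --> +oo] --> 0.
Proof.
move=> a12; apply: (@squeeze_cvgr _ _ _ _ (cst 0) (fun t => 2 * expR (- (2^-1 * t)))).
- near=> t; rewrite gamma_integrand_ge0 gamma_integrand_le//.
- exact: cvg_cst.
- rewrite -(mulr0 2); apply: cvgMr.
  apply: (@cvg_comp _ _ _ (fun x => 2^-1 * x) (fun x => expR (- x)) _ +oo%R).
    exact: gt0_cvgMry.
  exact: cvgr_expR.
Unshelve. all: by end_near. Qed.

Lemma gamma_integrand_cvg0 {R : realType} (a : R) : 1 < a ->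
  gamma_integrand a t @[t --> 0^'+] --> 0.
Proof.
move=> a12; apply: (@squeeze_cvgr _ _ _ _ (cst 0) (fun t => t `^ (a - 1))).
- near=> t; rewrite gamma_integrand_ge0 ler_piMr ?powR_ge0//.
  by rewrite -expR0 ler_expR oppr_le0.
- exact: cvg_cst.
- by apply: powR_cvg0; rewrite subr_gt0.
Unshelve. all: by end_near. Qed.

Lemma integrable_gamma_integrand {R : realType} (a b c : R) : 0 < b ->
  lebesgue_measure.-integrable `[b, c] (EFin \o gamma_integrand a).
Proof.
move=> b0; apply: continuous_compact_integrable; first exact: segment_compact.
apply/continuous_in_subspaceT => x /[!inE]/= /[!in_itv]/= /andP[bx _].
by apply: continuous_gamma_integrand; exact: lt_le_trans bx.
Qed.

Lemma is_derive_gamma_integrandS {R : realType} (a x : R) : 0 < x ->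
  is_derive x 1 (gamma_integrand (a + 1))
    (a * gamma_integrand a x - gamma_integrand (a + 1) x).
Proof.
move=> x0.
have d1 := is_derive1_powR a x0.
have -> : gamma_integrand (a + 1) = (fun t : R => t `^ a) * (fun t => expR (- t)).
  by apply/funext => t; rewrite /gamma_integrand addrK.
apply: is_derive_eq.
rewrite /GRing.scale/= /gamma_integrand/= ?addrK.
rewrite -[((@powR R)^~ a * _) x]/(x `^ a * expR (- x)); ring.
Qed.

Lemma gamma_integral_parts {R : realType} (a b c : R) : 0 < b -> b < c ->
  (\int[lebesgue_measure]_(t in `[b, c]) (gamma_integrand (a + 1) t)%:E
   = a%:E * \int[lebesgue_measure]_(t in `[b, c]) (gamma_integrand a t)%:E
     - (gamma_integrand (a + 1) c - gamma_integrand (a + 1) b)%:E)%E.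
Proof.
move=> b0 bc.
have I1 := integrable_gamma_integrand a c b0.
have I2 := integrable_gamma_integrand (a + 1) c b0.
have E : (\int[lebesgue_measure]_(t in `[b, c])
   (a * gamma_integrand a t - gamma_integrand (a + 1) t)%:E =
   (gamma_integrand (a + 1) c)%:E - (gamma_integrand (a + 1) b)%:E)%E.
  apply: continuous_FTC2 => //.
  - apply/continuous_in_subspaceT => x /[!inE]/= /[!in_itv]/= /andP[bx _].
    apply: cvgB; last by apply: continuous_gamma_integrand; exact: lt_le_trans bx.
    by apply: cvgMr; apply: continuous_gamma_integrand; exact: lt_le_trans bx.
  - split.
    + move=> x /[!in_itv]/= /andP[ax xb].
      by have [] := is_derive_gamma_integrandS a (lt_trans b0 ax).
    + by apply: cvg_at_right_filter; exact: continuous_gamma_integrand.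
    + apply: cvg_at_left_filter; apply: continuous_gamma_integrand.
      exact: lt_trans bc.
  - move=> x /[!in_itv]/= /andP[ax xb].
    have d := is_derive_gamma_integrandS a (lt_trans b0 ax).
    by rewrite derive1E; exact: derive_val.
rewrite EFinB -E; under [X in _ = (_ - X)%E]eq_integral do rewrite EFinB EFinM.
have I1' : lebesgue_measure.-integrable `[b, c]
    (fun x => a%:E * (EFin \o gamma_integrand a) x)%E.
  by apply: integrableZl => //; exact: measurable_itv.
have F1 := integrable_fin_num _ I1.
have F2 := integrable_fin_num _ I2.
rewrite integralB//.
rewrite integralZl//.
move: (F1 (measurable_itv _)) (F2 (measurable_itv _)).
rewrite /comp; case: (X in X \is a _ -> _) => // p _; case: (X in X \is a _ -> _) => // q _.
by rewrite -!EFinM -!EFinB; congr EFin; ring.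
Qed.

(** Integration by parts on [1/(i + 1), i + 1], with boundary terms vanishing at both ends. This
    links the factor 1/Gamma(2 - alpha) of the scheme to the factor 1/Gamma(1 - alpha) of Caputo's
    derivative. *)
Lemma GammaS {R : realType} (a : R) : 0 < a <= 1 ->
  Gamma (a + 1) = a * Gamma a.
Proof.
move=> /andP[a0 a1].
have a12 : 1 <= a + 1 <= 2 by lra.
have c1 := @gamma_integral_cvg R (a + 1).
have c2 := @gamma_integral_cvg R a.
have G1 : gamma_integrand (a + 1) i.+1%:R @[i --> \oo] --> 0.
  apply: (@cvg_comp _ _ _ (fun i : nat => i.+1%:R) (gamma_integrand (a + 1)) _ +oo%R).
    by have := @cvgr_idn R; rewrite -(cvg_shiftS (fun n => n%:R : R)).
  exact: gamma_integrand_cvgy.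
have G2 : gamma_integrand (a + 1) (i.+1%:R)^-1 @[i --> \oo] --> 0.
  have a11 : 1 < a + 1 by lra.
  have /cvg_at_rightP/(_ (@harmonic R)) := gamma_integrand_cvg0 a11; apply; split.
    by move=> i; exact: harmonic_gt0.
  exact: cvg_harmonic.
have c3 : (a%:E * (\int[lebesgue_measure]_(t in `[((i.+1%:R)^-1)%R, (i.+1%:R)%R]) (gamma_integrand a t)%:E)
    - (gamma_integrand (a + 1) i.+1%:R - gamma_integrand (a + 1) (i.+1%:R)^-1)%:E)%E
    @[i --> \oo] -->
  (a%:E * (\int[lebesgue_measure]_(t in `]0%R, +oo[) (gamma_integrand a t)%:E) - 0%:E)%E.
  apply: cvgeB.
  - by rewrite fin_num_adde_defl.
  - by apply: cvgeZl.
  - apply: cvg_EFin; first by near=> i.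
    by rewrite -[X in _ --> X]subr0; apply: cvgB.
have c4 : (\int[lebesgue_measure]_(t in `[((i.+1%:R)^-1)%R, (i.+1%:R)%R]) (gamma_integrand (a + 1) t)%:E)%E
    @[i --> \oo] -->
  (a%:E * (\int[lebesgue_measure]_(t in `]0%R, +oo[) (gamma_integrand a t)%:E) - 0%:E)%E.
  apply: cvg_trans c3; apply: near_eq_cvg; near=> i.
  have i0 : (0 < i)%N by near: i; exact: nbhs_infty_gt.
  have i1 : (i.+1%:R : R)^-1 < i.+1%:R.
    by rewrite (@lt_trans _ _ 1)// ?invf_lt1// ltr1n.
  apply/esym; apply: gamma_integral_parts i1.
  by rewrite invr_gt0.
have := cvg_unique _ c1 c4; rewrite sube0 => E.
rewrite /Gamma /Rintegral E.
(* The identity holds whether or not the integral for [a] is finite: an infinite value makes both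
   sides 0 under [fine]. *)
case: (X in fine (_ * X)%E) => [r| |] /=.
- by [].
- by rewrite gt0_muley ?lte_fin// mulr0.
- by rewrite gt0_muleNy ?lte_fin// mulr0.
Unshelve. all: by end_near. Qed.

(** * Weights of the scheme *)

Section SchemeWeights.
Context {R : realType}.
Implicit Types (alpha : R) (v : nat -> R).

Lemma scheme_f1 alpha : alpha < 1 -> scheme_f alpha 1 = 1.
Proof.
move=> a1; rewrite /scheme_f subrr powR1 powR0 ?subr0//.
by rewrite subr_eq0 gt_eqF.
Qed.

Lemma scheme_fS alpha (i : nat) :
  scheme_f alpha i.+1%:R = i.+1%:R `^ (1 - alpha) - i%:R `^ (1 - alpha).
Proof. by rewrite /scheme_f -[X in (X - 1)%R]natr1 addrK. Qed.

Lemma sum_scheme_f alpha (m : nat) : alpha < 1 ->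
  \sum_(0 <= i < m) scheme_f alpha i.+1%:R = m%:R `^ (1 - alpha).
Proof.
move=> a1; under eq_bigr do rewrite scheme_fS.
rewrite telescope_sumr// powR0 ?subr0// subr_eq0 gt_eqF//.
Qed.

Lemma powRN_le (p x y : R) : 0 <= p -> 0 < x -> x <= y -> y `^ (- p) <= x `^ (- p).
Proof.
move=> p0 x0 xy; have y0 := lt_le_trans x0 xy.
rewrite !powRN lef_pV2 ?posrE ?powR_gt0//.
by apply: ge0_ler_powR => //; rewrite nnegrE ltW.
Qed.

Lemma powR_MVT (c x y : R) : 0 < x -> x < y ->
  exists2 z, x < z < y & y `^ c - x `^ c = c * z `^ (c - 1) * (y - x).
Proof.
move=> x0 xy.
have [||z zxy ->] := @MVT R (fun s => s `^ c) (fun z => c * z `^ (c - 1)) x y xy.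
- move=> z; rewrite in_itv/= => /andP[xz _].
  by apply: is_derive1_powR; exact: lt_trans xz.
- apply/continuous_in_subspaceT => z /[!inE]/= /[!in_itv]/= /andP[xz _].
  by apply: continuous_powR; exact: lt_le_trans xz.
by exists z.
Qed.

(** Mean value theorem on [i, i + 1], the intermediate point lying below i + 1; the interval that
    starts at 0 is computed by hand. With [scheme_f_le] this interlaces the values of f with those
    of (1 - alpha) r^(-alpha), which yields monotonicity and sign of the weights. *)
Lemma scheme_f_ge alpha (i : nat) : 0 < alpha < 1 ->
  (1 - alpha) * i.+1%:R `^ (- alpha) <= scheme_f alpha i.+1%:R.
Proof.
move=> /andP[a0 a1]; rewrite scheme_fS; case: i => [|i].
  by rewrite !powR1 powR0 ?subr0 ?mulr1; [lra|rewrite subr_eq0 gt_eqF].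
have [||z /andP[iz zi] ->] := @powR_MVT (1 - alpha) i.+1%:R i.+2%:R => //.
  by rewrite ltr_nat.
have -> : i.+2%:R - i.+1%:R = 1 :> R by rewrite -[i.+2%:R]natr1 addrAC subrr add0r.
rewrite mulr1.
rewrite ler_wpM2l ?subr_ge0 ?(ltW a1)//.
have -> : 1 - alpha - 1 = - alpha by ring.
by apply: powRN_le; rewrite ?(ltW a0) ?(ltW zi)// (lt_trans _ iz).
Qed.

Lemma scheme_f_le alpha (i : nat) : 0 < alpha < 1 ->
  scheme_f alpha i.+2%:R <= (1 - alpha) * i.+1%:R `^ (- alpha).
Proof.
move=> /andP[a0 a1]; rewrite scheme_fS.
have [||z /andP[iz zi] ->] := @powR_MVT (1 - alpha) i.+1%:R i.+2%:R => //.
  by rewrite ltr_nat.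
have -> : i.+2%:R - i.+1%:R = 1 :> R by rewrite -[i.+2%:R]natr1 addrAC subrr add0r.
rewrite mulr1.
rewrite ler_wpM2l ?subr_ge0 ?(ltW a1)//.
have -> : 1 - alpha - 1 = - alpha by ring.
by apply: powRN_le; rewrite ?(ltW a0) ?(ltW iz).
Qed.

Lemma scheme_f_decr alpha (i : nat) : 0 < alpha < 1 ->
  scheme_f alpha i.+2%:R <= scheme_f alpha i.+1%:R.
Proof. by move=> a01; apply: le_trans (scheme_f_le _ a01) (scheme_f_ge _ a01). Qed.

Lemma scheme_f_ge0 alpha (i : nat) : 0 < alpha < 1 -> 0 <= scheme_f alpha i.+1%:R.
Proof.
move=> a01; apply: le_trans (scheme_f_ge _ a01).
by case/andP: a01 => ? ?; rewrite mulr_ge0 ?powR_ge0// subr_ge0 ltW.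
Qed.

Lemma scheme_f_mono alpha (i j : nat) : 0 < alpha < 1 -> (i <= j)%N ->
  scheme_f alpha j.+1%:R <= scheme_f alpha i.+1%:R.
Proof.
move=> a01; apply: (@homo_leq _ (fun i => scheme_f alpha i.+1%:R) (fun x y => y <= x)) => //.
- by move=> x y z xy yz; exact: le_trans yz xy.
- by move=> k; exact: scheme_f_decr.
Qed.

Lemma scheme_C0 alpha (m : nat) : scheme_C alpha m 0 = scheme_f alpha m%:R.
Proof. by []. Qed.

Lemma scheme_CS alpha (m k : nat) : (k < m)%N ->
  scheme_C alpha m.+1 k.+1
  = scheme_f alpha (m - k.+1).+1%:R - scheme_f alpha (m - k).+1%:R.
Proof.
move=> km; rewrite /scheme_C/=; congr (scheme_f _ _ - scheme_f _ _).
- by rewrite -natrB; [rewrite subSS subnSK|exact: ltnW].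
- by rewrite -[k.+1%:R]natr1 addrK -natrB ?subSn// ltnW// ltnW.
Qed.

Lemma scheme_C_ge0 alpha (m k : nat) : 0 < alpha < 1 -> (k < m)%N ->
  0 <= scheme_C alpha m k.
Proof.
case: m => [//|m] a01; case: k => [_|k km]; first exact: scheme_f_ge0.
rewrite scheme_CS// subr_ge0; apply: scheme_f_mono => //.
by rewrite leq_sub2l.
Qed.

(* Summation by parts: the scheme is the convolution of the weights f(i + 1)
   with the time increments. *)
Lemma scheme_abel alpha (m : nat) v : alpha < 1 -> (0 < m)%N ->
  v m - \sum_(0 <= k < m) scheme_C alpha m k * v k
  = \sum_(0 <= j < m) scheme_f alpha (m.-1 - j).+1%:R * (v j.+1 - v j).
Proof.
case: m => [//|m] a1 _ /=; rewrite !big_mkord.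
under [RHS]eq_bigr do rewrite mulrBr.
rewrite sumrB [X in _ = X - _]big_ord_recr/= subnn scheme_f1// mul1r.
rewrite [X in _ = _ - X]big_ord_recl [X in _ - X = _]big_ord_recl/= scheme_C0 subn0.
have -> : \sum_(i < m) scheme_C alpha m.+1 (bump 0 i) * v (bump 0 i)
   = \sum_(i < m) scheme_f alpha (m - i.+1).+1%:R * v i.+1
   - \sum_(i < m) scheme_f alpha (m - i).+1%:R * v i.+1.
  rewrite -sumrB; apply: eq_bigr => i _; rewrite -mulrBl /bump leq0n add1n.
  by rewrite scheme_CS.
rewrite /bump; under [X in _ = _ - (_ + X)]eq_bigr do rewrite leq0n add1n.
by ring.
Qed.

Lemma sum_scheme_C alpha (m : nat) : alpha < 1 -> (0 < m)%N ->
  \sum_(0 <= k < m) scheme_C alpha m k = 1.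
Proof.
move=> a1 m0; have := @scheme_abel alpha m (fun=> 1) a1 m0.
rewrite [RHS]big1 => [|i _]; last by rewrite subrr mulr0.
move/eqP; rewrite subr_eq0 => /eqP ->.
by apply: eq_bigr => i _; rewrite mulr1.
Qed.

Lemma scheme_op_le alpha (m : nat) v w : 0 < alpha < 1 -> (0 < m)%N ->
  (forall k, (k < m)%N -> v m - v k <= w m - w k) ->
  v m - \sum_(0 <= k < m) scheme_C alpha m k * v k
  <= w m - \sum_(0 <= k < m) scheme_C alpha m k * w k.
Proof.
move=> a01 m0 vw; have a1 : alpha < 1 by case/andP: a01.
have E u : u m - \sum_(0 <= k < m) scheme_C alpha m k * u k
    = \sum_(0 <= k < m) scheme_C alpha m k * (u m - u k).
  under [RHS]eq_bigr do rewrite mulrBr.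
  by rewrite sumrB -mulr_suml sum_scheme_C// mul1r.
rewrite !E !big_nat; apply: ler_sum => k /andP[_ km].
by rewrite ler_wpM2l ?vw// scheme_C_ge0.
Qed.

(** After summation by parts every weight is at least the smallest one, f(m), and t^alpha has
    nonnegative increments; so the sum is at least f(m) (m h)^alpha. The bound f(m) >= (1 - alpha)
    m^(-alpha) cancels the power of m. *)
Lemma scheme_op_powR alpha (h : R) (m : nat) : 0 < alpha < 1 -> 0 < h -> (0 < m)%N ->
  (1 - alpha) * h `^ alpha <= (m%:R * h) `^ alpha
    - \sum_(0 <= k < m) scheme_C alpha m k * (k%:R * h) `^ alpha.
Proof.
move=> a01 h0 m0; have /andP[a0 a1] := a01.
rewrite (@scheme_abel alpha m (fun k => (k%:R * h) `^ alpha))//.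
apply: (@le_trans _ _ (\sum_(0 <= j < m) scheme_f alpha m%:R *
   ((j.+1%:R * h) `^ alpha - (j%:R * h) `^ alpha))).
  rewrite -mulr_sumr telescope_sumr// mul0r powR0 ?gt_eqF// subr0.
  rewrite powRM ?ler0n ?(ltW h0)// [leRHS]mulrA ler_wpM2r ?powR_ge0//.
  case: m m0 => // m _; apply: le_trans (ler_wpM2r _ (scheme_f_ge _ a01)).
    rewrite -mulrA -powRD ?addNr ?powRr0 ?mulr1//.
    by rewrite pnatr_eq0 implybT.
  exact: powR_ge0.
rewrite !big_nat; apply: ler_sum => j /andP[_ jm].
rewrite ler_wpM2r//.
  rewrite subr_ge0; apply: ge0_ler_powR; rewrite ?nnegrE ?mulr_ge0 ?(ltW h0) ?(ltW a0)//.
  by rewrite ler_wpM2r ?(ltW h0)// ler_nat.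
case: m m0 jm => // m _ jm; apply: scheme_f_mono => //.
by rewrite leq_subr.
Qed.

(** The weights f(1), ..., f(m) telescope to m^(1 - alpha). With [L] proportional to h and the
    scheme's factor h^(-alpha), the bound becomes a multiple of (m h)^(1 - alpha), hence uniform in
    h on bounded times. *)
Lemma scheme_op_lip alpha (L : R) (m : nat) v : 0 < alpha < 1 -> (0 < m)%N ->
  (forall k, (k < m)%N -> `|v k.+1 - v k| <= L) ->
  `|v m - \sum_(0 <= k < m) scheme_C alpha m k * v k| <= L * m%:R `^ (1 - alpha).
Proof.
move=> a01 m0 vL; have /andP[a0 a1] := a01.
rewrite scheme_abel// (le_trans (ler_norm_sum _ _ _))//.
rewrite -(sum_scheme_f m a1) mulr_sumr [leRHS]big_nat_rev/= add0n.
rewrite [leLHS]big_nat [leRHS]big_nat; apply: ler_sum => j /andP[_ jm].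
rewrite normrM ger0_norm ?scheme_f_ge0// mulrC.
have -> : (m.-1 - j = m - j.+1)%N by rewrite -subn1 -subnDA add1n.
by rewrite ler_wpM2r ?vL// scheme_f_ge0.
Qed.

End SchemeWeights.

(** * Relaxed limits *)

Section Semicontinuity.
Context {R : realType} {T : topologicalType} (A : set T).

Lemma lsc_onP (f : T -> R) : lsc_on A f <->
  forall z, A z -> forall e, 0 < e -> \forall z' \near within A (nbhs z), f z - e < f z'.
Proof.
split=> [lf z Az e e0|lf z a].
  have [|V zV Vf] := lf z (f z - e); first by rewrite lte_fin ltrBlDr ltrDl.
  move: zV; case: (nbhs_subspaceP A z) => // _; apply: filterS => x /Vf.
  by rewrite lte_fin.
rewrite lte_fin => az; exists [set x | a < f x]; last by move=> y /=; rewrite lte_fin.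
(* Points outside [A] are isolated in [subspace A], so semicontinuity says nothing there. *)
case: (nbhs_subspaceP A z) => [Az|nAz]; last by move=> y /= ->.
have := lf z Az (f z - a); rewrite subr_gt0 => /(_ az); apply: filterS => x.
by rewrite opprB addrC subrK.
Qed.

Lemma usc_onP (f : T -> R) : usc_on A f <->
  forall z, A z -> forall e, 0 < e -> \forall z' \near within A (nbhs z), f z' < f z + e.
Proof.
split=> [/lsc_onP lf z Az e e0|lf].
  by apply: filterS (lf z Az e e0) => x; rewrite -opprD ltrN2.
apply/lsc_onP => z Az e e0; apply: filterS (lf z Az e e0) => x.
by rewrite -opprD ltrN2.
Qed.

Lemma continuous_usc_lsc (f : T -> R) : usc_on A f -> lsc_on A f ->
  {within A, continuous f}.
Proof.
move=> /usc_onP uf /lsc_onP lf; apply/subspace_continuousP => z Az.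
apply/cvgrPdist_lt => e e0; near=> x.
have h1 : f x < f z + e by near: x; exact: uf.
have h2 : f z - e < f x by near: x; exact: lf.
by rewrite distrC ltr_distl h2 h1.
Unshelve. all: by end_near. Qed.

Lemma continuous_usc (f : T -> R) : {within A, continuous f} -> usc_on A f.
Proof.
move=> /subspace_continuousP cf; apply/usc_onP => z Az e e0.
have /cvgrPdist_lt/(_ e e0) := cf z Az; apply: filterS => x.
by rewrite distrC ltr_distl => /andP[_].
Qed.

Lemma continuous_lsc (f : T -> R) : {within A, continuous f} -> lsc_on A f.
Proof.
move=> /subspace_continuousP cf; apply/lsc_onP => z Az e e0.
have /cvgrPdist_lt/(_ e e0) := cf z Az; apply: filterS => x.
by rewrite distrC ltr_distl => /andP[].
Qed.

End Semicontinuity.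

Lemma usc_on_subset {R : realType} {T : topologicalType} (A B : set T) (f : T -> R) :
  B `<=` A -> usc_on A f -> usc_on B f.
Proof.
move=> BA /usc_onP uf; apply/usc_onP => z Bz e e0.
have := uf z (BA _ Bz) e e0; rewrite !near_withinE; apply: filterS => x h /BA.
exact: h.
Qed.

Section RelaxedLimit.
Context {R : realType} {I : Type} (F : set_system I) {FF : ProperFilter F}.
Context {T : topologicalType} (A : set T).
Implicit Types (u : I -> T -> R).

Definition locally_eventually (z : T) : set_system (I * T) :=
  filter_prod F (within A (nbhs z)).

(** The limsup along the product filter, taken jointly in the index and in the point. The lower
    limit is encoded as the opposite of the upper limit of [- u]. Since [inf] has a default value on
    unbounded sets, this is meaningful under [eventually_locally_bounded]. *)
Definition relaxed_limit u (z : T) : R :=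
  inf [set a | \forall p \near locally_eventually z, u p.1 p.2 <= a].

Definition eventually_locally_bounded u :=
  forall z, A z -> exists B, \forall p \near locally_eventually z, `|u p.1 p.2| <= B.

Lemma locally_eventually_proper z : A z -> ProperFilter (locally_eventually z).
Proof.
move=> Az; apply: filter_prod_proper; apply: within_nbhs_proper.
exact: subset_closure.
Qed.

Instance locally_eventually_filter z : Filter (locally_eventually z).
Proof. exact: filter_prod_filter. Qed.

Lemma locally_eventuallyS z (P Q : I * T -> Prop) : (forall p, P p -> Q p) ->
  (\forall p \near locally_eventually z, P p) -> \forall p \near locally_eventually z, Q p.
Proof. exact: filterS. Qed.

Section bounded.
Variables (u : I -> T -> R) (hb : eventually_locally_bounded u).

Let S z := [set a | \forall p \near locally_eventually z, u p.1 p.2 <= a].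

Lemma relaxed_limit_has_inf z : A z -> has_inf (S z).
Proof.
move=> Az; have [B HB] := hb Az; split.
  by exists B; rewrite /S/=; near=> p; rewrite (le_trans (ler_norm _))//; near: p.
exists (- B) => a Sa; have ? := locally_eventually_proper Az.
have [p [/= pa pB]] := filter_ex (filterI Sa HB).
by rewrite (le_trans _ pa)// lerNl (le_trans _ pB)// -normrN ler_norm.
Unshelve. all: by end_near. Qed.

Lemma relaxed_limit_near z e : A z -> 0 < e ->
  \forall p \near locally_eventually z, u p.1 p.2 <= relaxed_limit u z + e.
Proof.
move=> Az e0; have [a Sa ale] := inf_adherent e0 (relaxed_limit_has_inf Az).
by apply: filterS Sa => p /le_trans; apply; exact: ltW.
Qed.

Lemma relaxed_limit_le z b : A z ->
  (\forall p \near locally_eventually z, u p.1 p.2 <= b) -> relaxed_limit u z <= b.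
Proof.
by move=> Az Hb; apply: ge_inf => //; have [] := relaxed_limit_has_inf Az.
Qed.

Lemma relaxed_limit_freq z e (P : I * T -> Prop) : A z -> 0 < e ->
  (\forall p \near locally_eventually z, P p) ->
  exists p, P p /\ relaxed_limit u z - e < u p.1 p.2.
Proof.
move=> Az e0 HP; apply: contrapT => nex.
suff : relaxed_limit u z <= relaxed_limit u z - e.
  by rewrite lerDl oppr_ge0 leNgt e0.
apply: relaxed_limit_le => //; apply: filterS HP => p Pp.
by rewrite leNgt; apply/negP => lt; apply: nex; exists p.
Qed.

Lemma relaxed_limit_usc : usc_on A (relaxed_limit u).
Proof.
apply/usc_onP => z Az e e0; have e20 : 0 < e / 2 by rewrite divr_gt0.
have [[/= P Q] [FP wQ] PQ] := relaxed_limit_near Az e20.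
(* The eventual bound found at [z] is also an eventual bound at each point of this interior, with
   the same indices [P]. *)
have : nbhs z (interior [set x | A x -> Q x]) by exact: nbhs_interior.
apply: filterS => x ix Ax; apply: (@le_lt_trans _ _ (relaxed_limit u z + e / 2)).
  by apply: relaxed_limit_le => //; exists (P, Q).
by rewrite ltrD2l ltr_pdivrMr// ltr_pMr// ltr1n.
Qed.

End bounded.

Lemma eventually_locally_boundedN u : eventually_locally_bounded u ->
  eventually_locally_bounded (fun i z => - u i z).
Proof.
move=> hb z Az; have [B HB] := hb z Az; exists B.
by apply: filterS HB => p; rewrite normrN.
Qed.

Lemma relaxed_limit_lower_le u z : eventually_locally_bounded u -> A z ->
  - relaxed_limit (fun i x => - u i x) z <= relaxed_limit u z.
Proof.
move=> hb Az; have hbN := eventually_locally_boundedN hb.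
apply/ler_addgt0Pr => e e0; have e20 : 0 < e / 2 by rewrite divr_gt0.
have ? := locally_eventually_proper Az.
have [p [h1 h2]] := filter_ex (filterI (relaxed_limit_near hb Az e20)
  (relaxed_limit_near hbN Az e20)).
lra.
Qed.

Lemma relaxed_limit_abs_le u z B :
  eventually_locally_bounded u -> A z ->
  (\forall p \near locally_eventually z, `|u p.1 p.2| <= B) ->
  `|relaxed_limit u z| <= B.
Proof.
move=> hb Az HB; have hbN := eventually_locally_boundedN hb.
have h1 := relaxed_limit_lower_le hb Az.
have h2 : relaxed_limit u z <= B.
  by apply: (relaxed_limit_le hb Az); apply: filterS HB => p; exact: le_trans (ler_norm _).
have h3 : relaxed_limit (fun i x => - u i x) z <= B.
  apply: (relaxed_limit_le hbN Az); apply: filterS HB => p; rewrite -normrN.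
  exact: le_trans (ler_norm _).
by rewrite ler_norml h2 andbT; lra.
Qed.

(** Where both limits agree, [u i] is squeezed to within e/4 of their common value at [z] on a
    neighbourhood of [z]; semicontinuity of both limits moves the centre from [z] to the
    neighbouring point for another e/4. Compactness makes the range of indices independent of
    [z]. *)
Lemma relaxed_limit_uniform u (K : set T) :
  eventually_locally_bounded u -> compact K -> K `<=` A ->
  (forall z, A z -> relaxed_limit u z <= - relaxed_limit (fun i x => - u i x) z) ->
  forall e, 0 < e ->
  \forall i \near F, forall z, K z -> `|u i z - relaxed_limit u z| < e.
Proof.
move=> hb cK KA ule e e0; have hbN := eventually_locally_boundedN hb.
move/compact_near_coveringP/near_covering_withinP : cK; apply => z Kz.
have Az := KA _ Kz.
have e40 : 0 < e / 4 by rewrite divr_gt0.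
have [[/= P1 Q1] [FP1 wQ1] PQ1] := relaxed_limit_near hb Az e40.
have [[/= P2 Q2] [FP2 wQ2] PQ2] := relaxed_limit_near hbN Az e40.
have uu := (usc_onP _ _).1 (relaxed_limit_usc hb) z Az _ e40.
have ll := (usc_onP _ _).1 (relaxed_limit_usc hbN) z Az _ e40.
exists ((fun x => (A x -> Q1 x) /\ (A x -> Q2 x) /\
   (A x -> relaxed_limit u x < relaxed_limit u z + e / 4) /\
   (A x -> relaxed_limit (fun i x => - u i x) x <
     relaxed_limit (fun i x => - u i x) z + e / 4)), P1 `&` P2) => /=.
  by split; [do 3 apply: filterI => // | exact: filterI].
move=> [x i] /= [[q1 [q2 [q3 q4]]] [p1 p2]] Kx; have Ax := KA _ Kx.
have /= h1 := PQ1 (i, x) (conj p1 (q1 Ax)).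
have /= h2 := PQ2 (i, x) (conj p2 (q2 Ax)).
have h3 := q3 Ax; have h4 := q4 Ax.
have h5 := ule _ Az; have h6 := ule _ Ax.
have h7 := relaxed_limit_lower_le hb Az; have h8 := relaxed_limit_lower_le hb Ax.
by rewrite ltr_norml; apply/andP; split; lra.
Qed.

End RelaxedLimit.

(** * The penalty function *)

Lemma mx_norm_le {R : realType} (m n : nat) (x : 'M[R]_(m, n)) (r : R) : 0 <= r ->
  (forall i j, `|x i j| <= r) -> `|x| <= r.
Proof.
move=> r0 xr; by rewrite /Num.norm/= mx_normrE; apply/bigmax_leP; split.
Qed.

Lemma continuous_sum_fun {R : realType} {V : normedModType R} (n : nat)
    (f : 'I_n -> V -> R) :
  (forall i, continuous (f i)) -> continuous (fun x => \sum_(i < n) f i x).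
Proof. by move=> fc x; apply: cvg_big => [|i _]; [exact: add_continuous|exact: fc]. Qed.

Lemma continuousB_fun {R : realType} {V : topologicalType} (f g : V -> R) :
  continuous f -> continuous g -> continuous (fun x => f x - g x).
Proof. by move=> fc gc x; apply: cvgB; [exact: fc|exact: gc]. Qed.

Lemma continuousMr_fun {R : realType} {V : normedModType R} (c : R) (f : V -> R) :
  continuous f -> continuous (fun x => c * f x).
Proof. by move=> fc x; apply: cvgMr; exact: fc. Qed.

Lemma C2_onTP {R : realType} {V : normedModType R} (f : V -> R) : C2_on setT f <->
  [/\ continuous f,
   forall v, (forall z, derivable f z v) /\ continuous ('D_v f) &
   forall v w, (forall z, derivable ('D_v f) z w) /\ continuous ('D_w ('D_v f))].
Proof.
have CT (g : V -> R) : continuously_extends setT g <-> continuous g.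
  split=> [[k ck gk] | cg].
    suff -> : g = k by exact/(@continuous_subspace_setT V R k).
    by apply/funext => z; apply: gk; rewrite interiorT.
  by exists g => //; exact: continuous_subspaceT.
split=> [[cf d1 d2]|[cf d1 d2]]; split.
- exact/(@continuous_subspace_setT V R f).
- move=> v; have [h1 /CT h2] := d1 v; split=> // z; apply: h1.
  by rewrite interiorT.
- move=> v w; have [h1 /CT h2] := d2 v w; split=> // z; apply: h1.
  by rewrite interiorT.
- exact: continuous_subspaceT.
- by move=> v; have [h1 h2] := d1 v; split=> //; exact/CT.
- by move=> v w; have [h1 h2] := d2 v w; split=> //; exact/CT.
Qed.

Section linear.
Context {R : realType} {V : normedModType R} (f g : V -> R) (c : R).
Hypotheses (cf : C2_on setT f) (cg : C2_on setT g).

Let fgE : (fun x => f x + c * g x) = f + c *: g. Proof. by []. Qed.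

Lemma derive_lin v : 'D_v (fun x => f x + c * g x) = (fun x => 'D_v f x + c * 'D_v g x).
Proof.
move: cf cg => /C2_onTP[_ df _] /C2_onTP[_ dg _].
apply/funext => x; have [dfx _] := df v; have [dgx _] := dg v.
by rewrite fgE deriveD ?deriveZ//; exact: derivableZ.
Qed.

Lemma derive2_lin v w : 'D_w ('D_v (fun x => f x + c * g x)) =
  (fun x => 'D_w ('D_v f) x + c * 'D_w ('D_v g) x).
Proof.
rewrite derive_lin; move: cf cg => /C2_onTP[_ _ df] /C2_onTP[_ _ dg].
apply/funext => x; have [dfx _] := df v w; have [dgx _] := dg v w.
rewrite -[X in 'D_w X x]/('D_v f + c *: 'D_v g).
by rewrite deriveD ?deriveZ//; exact: derivableZ.
Qed.

(** The form f + c g serves twice: for perturbation by a multiple of the penalty, and with f = 0, c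
    = -1 for the change of sign. *)
Lemma C2_lin : C2_on setT (fun x => f x + c * g x).
Proof.
move: (cf) (cg) => /C2_onTP[f0 f1 f2] /C2_onTP[g0 g1 g2].
apply/C2_onTP; split.
- by move=> x; apply: cvgD; [exact: f0|apply: cvgMr; exact: g0].
- move=> v; have [? f1v] := f1 v; have [? g1v] := g1 v; split.
    by move=> z; rewrite fgE; apply: derivableD => //; exact: derivableZ.
  by rewrite derive_lin => x; apply: cvgD; [exact: f1v|apply: cvgMr; exact: g1v].
- move=> v w; have [? f1v] := f2 v w; have [? g1v] := g2 v w; split.
    move=> z; rewrite derive_lin -[X in derivable X]/('D_v f + c *: 'D_v g).
    by apply: derivableD => //; exact: derivableZ.
  by rewrite derive2_lin => x; apply: cvgD; [exact: f1v|apply: cvgMr; exact: g1v].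
Qed.

End linear.

Lemma C2_cst {R : realType} {V : normedModType R} (c : R) : C2_on setT (fun _ : V => c).
Proof.
have D1 v : 'D_v (fun _ : V => c) = (fun=> 0) by apply/funext => x; exact: derive_cst.
apply/C2_onTP; split; first exact: cst_continuous.
  by move=> v; rewrite D1; split; [move=> z; exact: derivable_cst|exact: cst_continuous].
move=> v w; rewrite D1; split; first by move=> z; exact: derivable_cst.
have -> : 'D_w (fun _ : V => 0 : R) = (fun=> 0) by apply/funext => x; exact: derive_cst.
exact: cst_continuous.
Qed.

Section Penalty.
Context {R : realType} {n : nat}.
Implicit Types (a x v w : 'rV[R]_n) (s : R).

(** This is s^2/(1 + s^2): it vanishes only at 0 and grows with |s| like a square near 0, but it is
    bounded with bounded derivatives, so its multiples keep gradients and Hessians in a ball on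
    which F is bounded. *)
Definition bump_fun s : R := 1 - (1 + s ^+ 2)^-1.
Definition bump_d1 s : R := 2 * s * (1 + s ^+ 2) ^- 2.
Definition bump_d2 s : R := (2 - 6 * s ^+ 2) * (1 + s ^+ 2) ^- 3.

Let den s : 0 < 1 + s ^+ 2 :> R.
Proof. by rewrite ltr_pwDl// sqr_ge0. Qed.

Lemma is_derive_inv {V : normedModType R} (f : V -> R) (x v : V) (df : R) :
  f x != 0 -> is_derive x v f df ->
  is_derive x v (fun y => (f y)^-1) (- (f x) ^- 2 *: df).
Proof.
move=> fx0 dfx; apply: DeriveDef; first exact: derivableV.
by rewrite deriveV// derive_val.
Qed.

Section chain.
Context {V : normedModType R} (x v : V) (c : V -> R) (dc : R).
Hypothesis dcx : is_derive x v c dc.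

Lemma is_derive_bump : is_derive x v (fun y => bump_fun (c y)) (dc * bump_d1 (c x)).
Proof.
have c0 : (fun y => 1 + c y ^+ 2) x != 0 by rewrite /= gt_eqF// den.
have d1 : is_derive x v (fun y => 1 + c y ^+ 2) (2 * c x * dc).
  apply: is_derive_eq (is_deriveD (is_derive_cst (1 : R) x v) (@is_deriveX _ _ c 2 x v dc dcx)) _.
  by rewrite /GRing.scale/=; ring.
have d2 := @is_derive_inv V (fun y => 1 + c y ^+ 2) x v _ c0 d1.
have d3 := is_deriveB (is_derive_cst (1 : R) x v) d2.
apply: is_derive_eq d3 _; rewrite /GRing.scale/= /bump_d1.
by ring.
Qed.

Lemma is_derive_bump_d1 : is_derive x v (fun y => bump_d1 (c y)) (dc * bump_d2 (c x)).
Proof.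
have c0 : (fun y => (1 + c y ^+ 2) ^+ 2) x != 0 by rewrite /= expf_neq0// gt_eqF// den.
have d1 : is_derive x v (fun y => (1 + c y ^+ 2) ^+ 2) (4 * c x * (1 + c x ^+ 2) * dc).
  have d0 := is_deriveD (is_derive_cst (1 : R) x v) (@is_deriveX _ _ c 2 x v dc dcx).
  apply: is_derive_eq (@is_deriveX _ _ _ 2 x v _ d0) _; rewrite /GRing.scale/=.
  by rewrite -[(cst 1 + c ^+ 2) x]/(1 + c x ^+ 2); ring.
have d2 := @is_derive_inv V (fun y => (1 + c y ^+ 2) ^+ 2) x v _ c0 d1.
have d3 : is_derive x v (fun y => 2 * c y) (2 * dc).
  exact: (is_deriveZ 2 dcx).
have d4 := is_deriveM d3 d2.
apply: is_derive_eq d4 _; rewrite /GRing.scale/= /bump_d2.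
have := den (c x) => /gt_eqF/negbT ?.
by field.
Qed.

End chain.

Lemma bump_ge0 s : 0 <= bump_fun s.
Proof. by rewrite subr_ge0 invf_le1// lerDl sqr_ge0. Qed.

Lemma bump0 : bump_fun 0 = 0.
Proof. by rewrite /bump_fun expr0n addr0 invr1 subrr. Qed.

Lemma bump_ge s r : 0 <= r -> r <= `|s| -> bump_fun r <= bump_fun s.
Proof.
move=> r0 rs; rewrite lerD2l lerN2 lef_pV2 ?posrE// lerD2l -[s ^+ 2]real_normK ?num_real//.
by rewrite lerXn2r ?nnegrE ?normr_ge0.
Qed.

Lemma bump_d1_bound s : `|bump_d1 s| <= 6.
Proof.
rewrite /bump_d1 normrM normfV (ger0_norm (exprn_ge0 2 (ltW (den s)))).
rewrite ler_pdivrMr ?exprn_gt0// ler_norml; have h := sqr_ge0 s.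
by apply/andP; split; nra.
Qed.

(** The constant comes from |2 - 6 s^2| <= 6 (1 + s^2). The same value, far from sharp, is used for
    the first derivative, so that a single radius 6 c controls gradient and Hessian of c times the
    penalty. *)
Lemma bump_d2_bound s : `|bump_d2 s| <= 6.
Proof.
rewrite /bump_d2 normrM normfV (ger0_norm (exprn_ge0 3 (ltW (den s)))).
rewrite ler_pdivrMr ?exprn_gt0//; have h := sqr_ge0 s.
apply: (@le_trans _ _ (6 * (1 + s ^+ 2))).
  by rewrite ler_norml; apply/andP; split; lra.
rewrite ler_wpM2l//; set q := s ^+ 2 in h *; nra.
Qed.

Lemma continuous_bump_d1 : continuous bump_d1.
Proof.
move=> s; apply/differentiable_continuous/derivable1_diffP.
exact: (@ex_derive _ _ _ _ _ _ _ (@is_derive_bump_d1 _ s 1 id 1 _)).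
Qed.

Lemma continuous_bump : continuous bump_fun.
Proof.
move=> s; apply/differentiable_continuous/derivable1_diffP.
exact: (@ex_derive _ _ _ _ _ _ _ (@is_derive_bump _ s 1 id 1 _)).
Qed.

Lemma continuous_bump_d2 : continuous bump_d2.
Proof.
move=> s; apply: cvgM.
  by apply: cvgB; [exact: cvg_cst|apply: cvgMr; exact: exprn_continuous].
apply: cvgV; first by rewrite expf_neq0// gt_eqF.
apply: (@continuous_comp _ _ _ (fun s : R => 1 + s ^+ 2) (fun s : R => s ^+ 3)); last exact: exprn_continuous.
by apply: cvgD; [exact: cvg_cst|exact: exprn_continuous].
Qed.

Lemma is_derive_coord a x v (i : 'I_n) :
  is_derive x v (fun y : 'rV[R]_n => (y - a) ord0 i) (v ord0 i).
Proof.
have E : (fun h : R => h^-1 *: (((fun y : 'rV[R]_n => (y - a) ord0 i) \o shift x) (h *: v)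
    - (x - a) ord0 i)) @ 0^' --> v ord0 i.
  apply: cvg_near_cst; near=> h; rewrite /= !mxE addrAC.
  have -> : h * v ord0 i + x ord0 i - (x ord0 i - a ord0 i) - a ord0 i = h * v ord0 i by ring.
  rewrite /GRing.scale/= mulrA mulVf ?mul1r//.
  by near: h; exact: nbhs_dnbhs_neq.
split; first by apply/cvg_ex; exists (v ord0 i).
exact: cvg_lim E.
Unshelve. all: by end_near. Qed.

(** A sum over coordinates, because the norm of row vectors is the maximum norm and is not smooth.
    The Hessian is diagonal, and with maximum norms the derivative bounds do not depend on [n]. *)
Definition penalty a x : R := \sum_(i < n) bump_fun ((x - a) ord0 i).

Lemma penalty_ge0 a x : 0 <= penalty a x.
Proof. by apply: sumr_ge0 => i _; exact: bump_ge0. Qed.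

Lemma penalty0 a : penalty a a = 0.
Proof. by rewrite /penalty big1// => i _; rewrite subrr mxE bump0. Qed.

Lemma penalty_ge a x r : 0 < r -> r <= `|x - a| -> bump_fun r <= penalty a x.
Proof.
move=> r0 rx.
have [i ri] : exists i, r <= `|(x - a) ord0 i|.
  apply: contrapT => nex; have : `|x - a| < r.
    rewrite /Num.norm/= mx_normrE; apply: bigmax_lt => // -[i j] _ /=.
    by rewrite ltNge; apply/negP => le; apply: nex; exists j; rewrite ord1 in le.
  by rewrite ltNge rx.
rewrite /penalty (bigD1 i)//= ler_wpDr// ?bump_ge ?(ltW r0)//.
by apply: sumr_ge0 => j _; exact: bump_ge0.
Qed.

Lemma is_derive_penalty a x v :
  is_derive x v (penalty a) (\sum_(i < n) v ord0 i * bump_d1 ((x - a) ord0 i)).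
Proof.
have -> : penalty a = \sum_(i < n) (fun y : 'rV[R]_n => bump_fun ((y - a) ord0 i)).
  by apply/funext => y; rewrite fct_sumE.
apply: is_derive_sum => i; apply: is_derive_bump; exact: is_derive_coord.
Qed.

Lemma derive_penalty a v : 'D_v (penalty a) =
  fun x => \sum_(i < n) v ord0 i * bump_d1 ((x - a) ord0 i).
Proof.
by apply/funext => x; have d := is_derive_penalty a x v; exact: derive_val.
Qed.

Lemma is_derive2_penalty a x v w : is_derive x w ('D_v (penalty a))
  (\sum_(i < n) v ord0 i * (w ord0 i * bump_d2 ((x - a) ord0 i))).
Proof.
rewrite derive_penalty.
have -> : (fun x => \sum_(i < n) v ord0 i * bump_d1 ((x - a) ord0 i)) =
   \sum_(i < n) (v ord0 i \*: (fun y : 'rV[R]_n => bump_d1 ((y - a) ord0 i))).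
  by apply/funext => y; rewrite fct_sumE.
apply: is_derive_sum => i; apply: is_deriveZ.
by apply: is_derive_bump_d1; exact: is_derive_coord.
Qed.

Lemma derive2_penalty a v w : 'D_w ('D_v (penalty a)) =
  fun x => \sum_(i < n) v ord0 i * (w ord0 i * bump_d2 ((x - a) ord0 i)).
Proof.
by apply/funext => x; have d := is_derive2_penalty a x v w; exact: derive_val.
Qed.

Lemma continuous_coordB a (i : 'I_n) : continuous (fun x : 'rV[R]_n => (x - a) ord0 i).
Proof.
move=> x.
have h1 : {for x, continuous (fun y : 'rV[R]_n => y - a)}.
  apply: (@cvgD R 'rV[R]_n 'rV[R]_n (nbhs x) _ id (cst (- a))); first exact: cvg_id.
  exact: cvg_cst.
exact: continuous_comp h1 (@coord_continuous R 1 n ord0 i (x - a)).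
Qed.

Lemma continuous_penalty a : continuous (penalty a).
Proof.
apply: continuous_sum_fun => i x.
apply: continuous_comp; [exact: continuous_coordB|exact: continuous_bump].
Qed.

Lemma grad_penalty_bound a x : `|grad (penalty a) x| <= 6.
Proof.
apply: mx_norm_le => // i j; rewrite mxE (congr1 (fun f => f x) (derive_penalty a _)) (bigD1 j)//= big1 => [|k kj].
  by rewrite mxE !eqxx mul1r addr0 bump_d1_bound.
by rewrite mxE (negbTE kj) andbF mul0r.
Qed.

Lemma hess_penaltyE a x i j :
  hess (penalty a) x i j = (i == j)%:R * bump_d2 ((x - a) ord0 i).
Proof.
rewrite mxE (congr1 (fun f => f x) (derive2_penalty a _ _)) (bigD1 i)//= big1 => [|k ki].
  by rewrite !mxE !eqxx mul1r addr0.
by rewrite mxE (negbTE ki) andbF mul0r.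
Qed.

Lemma hess_penalty_bound a x : `|hess (penalty a) x| <= 6.
Proof.
apply: mx_norm_le => // i j; rewrite hess_penaltyE.
by case: eqP => _; rewrite ?mul1r ?mul0r ?normr0// bump_d2_bound.
Qed.

Lemma hess_penalty_sym a x : Defs.symmetric (hess (penalty a) x).
Proof.
apply/matrixP => i j; rewrite mxE !hess_penaltyE eq_sym.
by case: eqP => [->|_] //; rewrite !mul0r.
Qed.

Lemma C2_penalty a : C2_on setT (penalty a).
Proof.
apply/C2_onTP; split; first exact: continuous_penalty.
- move=> v; split; first by move=> z; have d := is_derive_penalty a z v; exact: ex_derive.
  rewrite derive_penalty; apply: continuous_sum_fun => i; apply: continuousMr_fun => x.
  apply: continuous_comp; [exact: continuous_coordB|exact: continuous_bump_d1].
- move=> v w; split; first by move=> z; have d := is_derive2_penalty a z v w; exact: ex_derive.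
  rewrite derive2_penalty; apply: continuous_sum_fun => i.
  do 2 apply: continuousMr_fun; move=> x.
  apply: continuous_comp; [exact: continuous_coordB|exact: continuous_bump_d2].
Qed.

Section linear.
Variables (f g : 'rV[R]_n -> R) (c : R).
Hypotheses (cf : C2_on setT f) (cg : C2_on setT g).

Lemma grad_lin x : grad (fun x => f x + c * g x) x = grad f x + c *: grad g x.
Proof. by apply/rowP => i; rewrite !mxE (congr1 (fun h => h x) (derive_lin c cf cg _)). Qed.

Lemma hess_lin x : hess (fun x => f x + c * g x) x = hess f x + c *: hess g x.
Proof. by apply/matrixP => i j; rewrite !mxE (congr1 (fun h => h x) (derive2_lin c cf cg _ _)). Qed.

End linear.

Lemma grad_cst (c : R) x : grad (fun _ : 'rV[R]_n => c) x = 0.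
Proof. by apply/rowP => i; rewrite !mxE derive_cst. Qed.

Lemma hess_cst (c : R) x : hess (fun _ : 'rV[R]_n => c) x = 0.
Proof.
apply/matrixP => i j; rewrite !mxE.
have -> : 'D_(delta_mx ord0 i) (fun _ : 'rV[R]_n => c) = (fun=> 0).
  by apply/funext => y; exact: derive_cst.
exact: derive_cst.
Qed.

End Penalty.

(** * Schwarz theorem and slices of test functions *)

Lemma dist_half_le {R : realType} (a b q e : R) :
  `|a - q| < e / 2 -> `|b - q| < e / 2 -> `|a - b| <= e.
Proof.
move=> h1 h2; apply: le_trans (ler_distD q _ _) _.
by rewrite [X in _ + X]distrC (splitr e) ltW// ltrD.
Qed.

Section Line.
Context {R : realType} {V : normedModType R}.
Implicit Types (f : V -> R) (x v w : V).

Lemma is_derive_line f x v (s : R) : derivable f (s *: v + x) v ->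
  is_derive s (1 : R) (fun r : R => f (r *: v + x)) ('D_v f (s *: v + x)).
Proof.
move=> df.
have E : (fun h : R => h^-1 *: (((fun r : R => f (r *: v + x)) \o shift s) (h *: (1 : R))
    - f (s *: v + x))) =
  (fun h : R => h^-1 *: ((f \o shift (s *: v + x)) (h *: v) - f (s *: v + x))).
  apply/funext => h /=; congr (_ *: (f _ - _)).
  by rewrite [h *: 1]mulr1 scalerDl addrA.
by split; [rewrite /derivable E | rewrite /derive E].
Qed.

Lemma MVT_line f x v (h : R) : 0 < h ->
  (forall s, 0 <= s <= h -> derivable f (s *: v + x) v) ->
  exists2 s, 0 < s < h & f (h *: v + x) - f x = h * 'D_v f (s *: v + x).
Proof.
move=> h0 df.
have [||s sh E] := @MVT R (fun r => f (r *: v + x)) (fun r => 'D_v f (r *: v + x)) 0 h h0.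
- move=> s; rewrite in_itv/= => /andP[s0 sh]; apply: is_derive_line; apply: df.
  by rewrite !ltW.
- apply/continuous_in_subspaceT => s /[!inE]/= /[!in_itv]/= sh.
  apply/differentiable_continuous/derivable1_diffP.
  have d := is_derive_line (df s sh); exact: ex_derive.
exists s; first by move: sh; rewrite in_itv.
by move: E; rewrite scale0r add0r subr0 => ->; rewrite mulrC.
Qed.

(* Both iterated derivatives are limits of the same second-order difference
   quotient. *)
Lemma second_difference f x v w (h : R) : 0 < h ->
  (forall s t, 0 <= s <= h -> 0 <= t <= h ->
     derivable f (s *: v + (t *: w + x)) v /\
     derivable ('D_v f) (t *: w + (s *: v + x)) w) ->
  exists s t, [/\ 0 < s < h, 0 < t < h &
    f (h *: v + (h *: w + x)) - f (h *: v + x) - f (h *: w + x) + f x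
    = h ^+ 2 * 'D_w ('D_v f) (t *: w + (s *: v + x))].
Proof.
move=> h0 df; have hh : 0 <= h <= h by rewrite (ltW h0) /=.
have h00 : 0 <= (0 : R) <= h by rewrite lexx /= (ltW h0).
pose g := (fun y => f (h *: w + y)) - f.
have shiftE y : (fun k : R => k^-1 *: (((fun y => f (h *: w + y)) \o shift y) (k *: v) - f (h *: w + y)))
   = (fun k : R => k^-1 *: ((f \o shift (h *: w + y)) (k *: v) - f (h *: w + y))).
  by apply/funext => k /=; rewrite addrCA.
have d1 s : 0 <= s <= h -> derivable (fun y => f (h *: w + y)) (s *: v + x) v.
  move=> sh; rewrite /derivable shiftE; have [+ _] := df s h sh hh.
  by rewrite addrCA.
have d2 s : 0 <= s <= h -> derivable f (s *: v + x) v.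
  by move=> sh; have [+ _] := df s 0 sh h00; rewrite scale0r add0r.
have dg s : 0 <= s <= h -> derivable g (s *: v + x) v.
  by move=> sh; exact: derivableB (d1 s sh) (d2 s sh).
have [s sh Es] := MVT_line h0 dg.
have sh' : 0 <= s <= h by case/andP: sh => /ltW -> /ltW ->.
have [t th Et] := MVT_line h0 (fun t th => proj2 (df s t sh' th)).
exists s, t; split=> //.
have -> : h ^+ 2 * 'D_w ('D_v f) (t *: w + (s *: v + x)) = h * 'D_v g (s *: v + x).
  rewrite /g deriveB; [|exact: d1|exact: d2].
  rewrite [X in _ = h * (X - _)]/derive shiftE -/(derive _ _ _) Et.
  by rewrite expr2 mulrA.
rewrite -Es /g -[((fun y => f (h *: w + y)) - f) _]/(f (h *: w + (h *: v + x)) - f (h *: v + x)).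
rewrite -[((fun y => f (h *: w + y)) - f) x]/(f (h *: w + x) - f x).
rewrite (addrCA (h *: v)); ring.
Qed.

(** The second difference taken in either order equates the two mixed derivatives at two possibly
    different points near [x]; continuity of both at [x] removes the discrepancy. *)
Lemma derive_commute f x v w (O : set V) : open O -> O x ->
  (forall z, O z -> derivable f z v) -> (forall z, O z -> derivable f z w) ->
  (forall z, O z -> derivable ('D_v f) z w) -> (forall z, O z -> derivable ('D_w f) z v) ->
  {for x, continuous ('D_w ('D_v f))} -> {for x, continuous ('D_v ('D_w f))} ->
  'D_w ('D_v f) x = 'D_v ('D_w f) x.
Proof.
move=> oO Ox dv dw dvw dwv cvw cwv; apply/eqP; rewrite -subr_eq0 -normr_eq0.
rewrite eq_le normr_ge0 andbT; apply/ler_addgt0Pr => e e0; rewrite add0r.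
have e20 : 0 < e / 2 by rewrite divr_gt0.
have : \forall z \near x, O z /\ (`|'D_w ('D_v f) x - 'D_w ('D_v f) z| < e / 2 /\
   `|'D_v ('D_w f) x - 'D_v ('D_w f) z| < e / 2).
  apply: filterI; first exact: open_nbhs_nbhs.
  apply: filterI.
    by move/cvgrPdist_lt : cvw => /(_ _ e20).
  by move/cvgrPdist_lt : cwv => /(_ _ e20).
move=> /nbhs_normP[r /= r0 H].
(* With this [h] the whole parallelogram spanned by h v and h w at [x] stays within distance [r] of
   [x]; the summand 1 keeps the denominator positive. *)
pose h := r / (1 + `|v| + `|w|) / 2.
have N0 : 0 < 1 + `|v| + `|w| by rewrite -addrA ltr_pwDl// addr_ge0.
have h0 : 0 < h by rewrite !divr_gt0.
have near s t a b : 0 <= s <= h -> 0 <= t <= h ->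
   `|a| + `|b| <= 1 + `|v| + `|w| -> `|x - (s *: a + (t *: b + x))| < r.
  move=> /andP[s0 sh] /andP[t0 th] ab.
  have -> : x - (s *: a + (t *: b + x)) = - (s *: a + t *: b).
    by rewrite addrA opprD addrCA subrr addr0.
  rewrite normrN (le_lt_trans (ler_normD _ _))// !normrZ !ger0_norm//.
  apply: (@le_lt_trans _ _ (h * (1 + `|v| + `|w|))).
    apply: le_trans (ler_wpM2l (ltW h0) ab); rewrite mulrDr lerD// ler_wpM2r//.
  by rewrite /h mulrAC divfK ?gt_eqF// ltr_pdivrMr// ltr_pMr// ltr1n.
have avw : `|v| + `|w| <= 1 + `|v| + `|w| by rewrite -addrA lerDr.
have awv : `|w| + `|v| <= 1 + `|v| + `|w| by rewrite addrC.
have A1 s t : 0 <= s <= h -> 0 <= t <= h -> derivable f (s *: v + (t *: w + x)) v /\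
     derivable ('D_v f) (t *: w + (s *: v + x)) w.
  move=> sh th; split.
    by apply: dv; have [] := H _ (near s t v w sh th avw).
  by apply: dvw; have [] := H _ (near t s w v th sh awv).
have A2 s t : 0 <= s <= h -> 0 <= t <= h -> derivable f (s *: w + (t *: v + x)) w /\
     derivable ('D_w f) (t *: v + (s *: w + x)) v.
  move=> sh th; split.
    by apply: dw; have [] := H _ (near s t w v sh th awv).
  by apply: dwv; have [] := H _ (near t s v w th sh avw).
have [s1 [t1 [s1h t1h E1]]] := second_difference h0 A1.
have [s2 [t2 [s2h t2h E2]]] := second_difference h0 A2.
have E : 'D_w ('D_v f) (t1 *: w + (s1 *: v + x)) = 'D_v ('D_w f) (t2 *: v + (s2 *: w + x)).
  apply: (@mulfI _ (h ^+ 2)); first by rewrite expf_neq0// gt_eqF.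
  apply: etrans (esym E1) (etrans _ E2).
  by rewrite (addrCA (h *: w)); congr (_ + f x); exact: addrAC.
have oc (s : R) : 0 < s < h -> 0 <= s <= h by move=> /andP[/ltW -> /ltW ->].
have [_ [H1 _]] := H _ (near _ _ _ _ (oc _ t1h) (oc _ s1h) awv).
have [_ [_ H2]] := H _ (near _ _ _ _ (oc _ t2h) (oc _ s2h) avw).
have {}H1 := eq_ind _ (fun r => `|'D_w ('D_v f) x - r| < e / 2) H1 _ E.
exact: dist_half_le H1 H2.
Qed.

End Line.

Lemma continuous_pairr {U W : topologicalType} (x : U) : continuous (fun t : W => (x, t)).
Proof. by move=> t; apply: cvg_pair => /=; [exact: cvg_cst|exact: cvg_id]. Qed.

Lemma cvg_pair_seq {U W : topologicalType} (xs : nat -> U) (ts : nat -> W) (x : U) (t : W) :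
  xs k @[k --> \oo] --> x -> ts k @[k --> \oo] --> t ->
  (xs k, ts k) @[k --> \oo] --> (x, t).
Proof. by move=> h1 h2; exact: cvg_pair. Qed.

Lemma continuous_pairl {U W : topologicalType} (t : W) : continuous (fun y : U => (y, t)).
Proof. by move=> y; apply: cvg_pair => /=; [exact: cvg_id|exact: cvg_cst]. Qed.

Lemma continuously_extends_at {R : realType} {V : topologicalType} (A : set V) (g : V -> R) z :
  continuously_extends A g -> A° z -> {for z, continuous g}.
Proof.
move=> [k /subspace_continuousP ck gk] Az.
have kz := ck z (interior_subset Az); rewrite within_interior// in kz.
have gkz := gk z Az; rewrite /prop_for/continuous_at gkz; apply: cvg_trans kz.
apply: near_eq_cvg; have : nbhs z A° by exact: nbhs_interior.
by apply: filterS => y Ay; rewrite gk.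
Qed.

Section Slices.
Context {R : realType} {n : nat}.
Implicit Types (x v w : 'rV[R]_n) (t s T : R) (phi : 'rV[R]_n * R -> R).

Lemma strip_interior T x t : 0 < t < T -> (strip T : set ('rV[R]_n * R))° (x, t).
Proof.
move=> tT; apply: (@interiorS _ (snd @^-1` `]0, T[%classic)).
  by move=> z /=; rewrite in_itv/= /strip/= => /andP[/ltW -> ->].
have /interior_id -> : open (snd @^-1` `]0, T[%classic : set ('rV[R]_n * R)); last first.
  by rewrite /= in_itv.
by apply: open_comp; [move=> z _; exact: cvg_snd|exact: interval_open].
Qed.

Lemma slice_quotient phi x t v :
  (fun h : R => h^-1 *: (((fun y => phi (y, t)) \o shift x) (h *: v) - phi (x, t)))
  = (fun h : R => h^-1 *: ((phi \o shift (x, t)) (h *: (v, 0)) - phi (x, t))).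
Proof.
apply/funext => h /=; congr (_ *: (phi _ - _)).
by rewrite -[RHS]/(h *: v + x, h *: (0 : R) + t) scaler0 add0r.
Qed.

Lemma derive_slice phi x t v : 'D_v (fun y => phi (y, t)) x = 'D_(v, 0) phi (x, t).
Proof. by rewrite /derive slice_quotient. Qed.

Lemma derive2_slice phi x t v w :
  'D_w ('D_v (fun y => phi (y, t))) x = 'D_(w, 0) ('D_(v, 0) phi) (x, t).
Proof.
have -> : 'D_v (fun y => phi (y, t)) = (fun y => 'D_(v, 0) phi (y, t)).
  by apply/funext => y; exact: derive_slice.
exact: (derive_slice ('D_(v, 0) phi)).
Qed.

Lemma derivable_slice phi x t v :
  derivable (fun y => phi (y, t)) x v <-> derivable phi (x, t) (v, 0).
Proof. by rewrite /derivable slice_quotient. Qed.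

Lemma time_quotient phi x s :
  (fun h : R => h^-1 *: (((fun r => phi (x, r)) \o shift s) (h *: (1 : R)) - phi (x, s)))
  = (fun h : R => h^-1 *: ((phi \o shift (x, s)) (h *: (0, 1)) - phi (x, s))).
Proof.
apply/funext => h /=; congr (_ *: (phi _ - _)).
by rewrite -[RHS]/(h *: (0 : 'rV[R]_n) + x, h *: (1 : R) + s) scaler0 add0r.
Qed.

Lemma derive1_time phi x s : (fun r => phi (x, r))^`()%classic s = 'D_(0, 1) phi (x, s).
Proof. by rewrite derive1E /derive time_quotient. Qed.

Lemma derivable_time phi x s :
  derivable (fun r => phi (x, r)) s 1 <-> derivable phi (x, s) (0, 1).
Proof. by rewrite /derivable time_quotient. Qed.

Section C2strip.
Variables (T : R) (phi : 'rV[R]_n * R -> R).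
Hypothesis cphi : C2_on (strip T) phi.

Lemma C2_slice t : 0 < t < T -> C2_on setT (fun y => phi (y, t)).
Proof.
move=> tT; have int x := @strip_interior T x t tT.
case: cphi => p0 p1 p2; apply/C2_onTP.
have D1 v : 'D_v (fun y => phi (y, t)) = (fun y => 'D_(v, 0) phi (y, t)).
  by apply/funext => y; exact: derive_slice.
have D2 v w : 'D_w ('D_v (fun y => phi (y, t))) = (fun y => 'D_(w, 0) ('D_(v, 0) phi) (y, t)).
  by apply/funext => y; rewrite D1 (derive_slice ('D_(v, 0) phi)).
split.
- move=> y; have cp : {for (y, t), continuous phi}.
    apply: (@continuously_extends_at _ _ (strip T)) => //.
    by exists phi.
  by apply: (@continuous_comp _ _ _ (fun y => (y, t)) phi); [exact: continuous_pairl|].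
- move=> v; have [h1 h2] := p1 (v, 0); split.
    by move=> z; apply/derivable_slice; exact: h1.
  rewrite D1 => y; have cp := continuously_extends_at h2 (int y).
  apply: (@continuous_comp _ _ _ (fun y => (y, t)) ('D_(v, 0) phi)) => //.
  exact: continuous_pairl.
- move=> v w; have [h1 h2] := p2 (v, 0) (w, 0); split.
    by move=> z; rewrite D1; apply/(derivable_slice ('D_(v, 0) phi)); exact: h1.
  rewrite D2 => y; have cp := continuously_extends_at h2 (int y).
  apply: (@continuous_comp _ _ _ (fun y => (y, t)) ('D_(w, 0) ('D_(v, 0) phi))) => //.
  exact: continuous_pairl.
Qed.

Lemma grad_slice t x i :
  grad (fun y => phi (y, t)) x ord0 i = 'D_(delta_mx ord0 i, 0) phi (x, t).
Proof. by rewrite mxE derive_slice. Qed.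

Lemma hess_slice t x i j : hess (fun y => phi (y, t)) x i j =
  'D_(delta_mx ord0 j, 0) ('D_(delta_mx ord0 i, 0) phi) (x, t).
Proof.
by rewrite mxE; exact: derive2_slice. Qed.

(** Continuity and bounds of F are available on symmetric matrices only, whereas [C2_on] speaks of
    one iterated directional derivative at a time. *)
Lemma hess_sym (f : 'rV[R]_n -> R) x : C2_on setT f -> Defs.symmetric (hess f x).
Proof.
move=> /C2_onTP[f0 f1 f2]; apply/matrixP => i j; rewrite !mxE.
apply: (@derive_commute _ _ _ _ _ _ setT) => //.
- exact: openT.
- by move=> z _; have [] := f1 (delta_mx ord0 j).
- by move=> z _; have [] := f1 (delta_mx ord0 i).
- by move=> z _; have [] := f2 (delta_mx ord0 j) (delta_mx ord0 i).
- by move=> z _; have [] := f2 (delta_mx ord0 i) (delta_mx ord0 j).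
- by have [_] := f2 (delta_mx ord0 j) (delta_mx ord0 i); apply.
- by have [_] := f2 (delta_mx ord0 i) (delta_mx ord0 j); apply.
Qed.

Section sequences.
Variables (x0 : 'rV[R]_n) (t0 : R) (xs : nat -> 'rV[R]_n) (ts : nat -> R).
Hypotheses (t0T : 0 < t0 < T) (xsx : xs k @[k --> \oo] --> x0) (tst : ts k @[k --> \oo] --> t0).

Lemma cvg_deriv (v : 'rV[R]_n * R) : 'D_v phi (xs k, ts k) @[k --> \oo] --> 'D_v phi (x0, t0).
Proof.
case: cphi => _ p1 _; have [_ h2] := p1 v.
have c := continuously_extends_at h2 (strip_interior x0 t0T).
apply: (@cvg_comp _ _ _ (fun k => (xs k, ts k)) ('D_v phi) _ (nbhs (x0, t0))) => //.
exact: cvg_pair_seq xsx tst.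
Qed.

Lemma cvg_deriv2 (v w : 'rV[R]_n * R) :
  'D_w ('D_v phi) (xs k, ts k) @[k --> \oo] --> 'D_w ('D_v phi) (x0, t0).
Proof.
case: cphi => _ _ p2; have [_ h2] := p2 v w.
have c := continuously_extends_at h2 (strip_interior x0 t0T).
apply: (@cvg_comp _ _ _ (fun k => (xs k, ts k)) ('D_w ('D_v phi)) _ (nbhs (x0, t0))) => //.
exact: cvg_pair_seq xsx tst.
Qed.

Lemma cvg_mx (p q : nat) (M : nat -> 'M[R]_(p, q)) (N : 'M[R]_(p, q)) :
  (forall i j, M k i j @[k --> \oo] --> N i j) -> M k @[k --> \oo] --> N.
Proof.
move=> MN; apply/cvgrPdist_le => e e0.
have H : \forall k \near \oo, forall i j, `|N i j - M k i j| <= e.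
  apply: filter_forall => i; apply: filter_forall => j.
  by have /cvgrPdist_le/(_ e e0) := MN i j.
near=> k; apply: mx_norm_le => [|i j]; first exact: ltW.
by rewrite !mxE; move: i j; near: k.
Unshelve. all: by end_near. Qed.

Lemma cvg_grad : grad (fun y => phi (y, ts k)) (xs k) @[k --> \oo] -->
  grad (fun y => phi (y, t0)) x0.
Proof.
apply: cvg_mx => i j; rewrite ord1; under eq_fun do rewrite grad_slice.
rewrite grad_slice; exact: cvg_deriv.
Qed.

Lemma cvg_hess : hess (fun y => phi (y, ts k)) (xs k) @[k --> \oo] -->
  hess (fun y => phi (y, t0)) x0.
Proof.
apply: cvg_mx => i j; under eq_fun do rewrite hess_slice.
rewrite hess_slice; exact: cvg_deriv2.
Qed.

End sequences.
End C2strip.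
End Slices.

(** * Convergence of the discrete to Caputo's derivative *)

Section Reflection.
Context {R : realType}.

Lemma measurable_reflection (c : R) :
  measurable_fun [set: measurableTypeR R] (fun s : measurableTypeR R => c - s : measurableTypeR R).
Proof. by apply: measurable_funB => //; exact: measurable_id. Qed.

(** Lebesgue measure is determined by the half-open intervals, and the preimage of ]a, b] under the
    reflection is [c - b, c - a[, which has the same length. *)
Lemma lebesgue_measure_reflection (c : R) (A : set (measurableTypeR R)) :
  measurable A ->
  lebesgue_measure A = pushforward lebesgue_measure
    (fun s : measurableTypeR R => c - s : measurableTypeR R) A.
Proof.
move=> mA.
apply: (lebesgue_measure_unique (mu := pushforward lebesgue_measure _)) mA.
  exact: measurable_reflection.
move=> mr _ [[a b] ab <-].
have E : (fun s : R => c - s) @^-1` `]a, b] = `[c - b, c - a[%classic.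
  by apply/seteqP; split=> s /=; rewrite !in_itv/=; lra.
suff : lebesgue_measure (`]a, b]%classic : set R) = lebesgue_measure (`[c - b, c - a[%classic : set R).
  by rewrite -E.
rewrite !lebesgue_measure_itv/= !lte_fin ltrD2l ltrN2.
by case: ifP => // _; rewrite -!EFinB; congr EFin; ring.
Qed.

(** The substitution moves the singularity of Caputo's kernel from the end time to 0, where it stays
    fixed while the end time of the scheme varies. *)
Lemma integral_reflection (c : R) (f : R -> R) :
  measurable_fun setT f ->
  lebesgue_measure.-integrable setT (fun s => (f (c - s))%:E) ->
  (\int[lebesgue_measure]_s (f s)%:E = \int[lebesgue_measure]_s (f (c - s))%:E)%E.
Proof.
move=> mf intf.
rewrite (@eq_measure_integral _ _ _ _ (pushforward lebesgue_measure
    (fun s : measurableTypeR R => c - s : measurableTypeR R))).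
- exact: measurable_reflection.
- move=> mr; rewrite integral_pushforward//.
  exact/measurable_EFinP.
- by move=> mr A mA _; exact: lebesgue_measure_reflection.
Qed.

End Reflection.

Section FractionalLimit.
Context {R : realType}.
Variables (c T t0 L : R) (W : R -> R) (q : nat -> R -> R).
Hypotheses (c0 : 0 < c) (t00 : 0 < t0) (t0T : t0 < T).
Hypothesis cW : forall s, 0 < s < t0 -> {for s, continuous W}.
Hypothesis mq : forall k, measurable_fun setT (q k).
Hypothesis qL : forall k s, 0 < s <= T -> `|q k s| <= L.
Hypothesis qW : forall s, 0 < s < t0 -> q k s @[k --> \oo] --> W (t0 - s).
Hypothesis q0 : forall s, t0 < s <= T -> q k s @[k --> \oo] --> (0 : R).

Let H : R -> R := (fun s => (t0 - s) `^ (c - 1) * W s) \_ `]0, t0[.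

Let mH : measurable_fun setT H.
Proof.
apply/(measurable_restrictT _ _).1 => //.
apply: measurable_funM.
  apply: (@measurableT_comp _ _ _ _ _ _ (fun s => s `^ (c - 1))); first exact: measurable_powR.
  by apply: measurable_funB => //; exact: measurable_id.
apply: open_continuous_measurable_fun; first exact: interval_open.
by move=> s /[!inE]/= /[!in_itv]/= s01; exact: cW.
Qed.

Let HrE s : H (t0 - s) = if 0 < s < t0 then s `^ (c - 1) * W (t0 - s) else 0.
Proof.
rewrite /H patchE mem_setE in_itv/= subr_gt0 andbC.
have -> : (t0 - s < t0) = (0 < s) by rewrite gtrBl.
by case: ifP => // _; rewrite opprB addrC subrK.
Qed.

Let mHr : measurable_fun setT (fun s : R => H (t0 - s)).
Proof.
apply: (@measurableT_comp _ _ _ _ _ _ H) => //.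
by apply: measurable_funB => //; exact: measurable_id.
Qed.

Let integrable_kernel : lebesgue_measure.-integrable `]0, T]
  (fun s : R => (L * s `^ (c - 1))%:E).
Proof.
have T0 : 0 < T by exact: lt_trans t0T.
have : lebesgue_measure.-integrable `]0, T] (EFin \o (fun s : R => s `^ (c - 1))).
  apply/integrableP; split.
    by apply/measurable_EFinP/measurable_funTS; exact: measurable_powR.
  under eq_integral do rewrite /= ger0_norm ?powR_ge0//.
  by rewrite integral_powR0// ltry.
by move=> h; apply: (integrableZl _ L h); exact: measurable_itv.
Qed.

(** With time counted backwards, neither the kernel nor the domain depends on [k]; the varying end
    time is hidden in [q k], which tends to 0 beyond [t0]. Dominated convergence applies with
    majorant L s^(c - 1), integrable at 0 since c > 0. *)
Lemma fractional_limit :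
  \int[lebesgue_measure]_(s in `]0, T]) (s `^ (c - 1) * q k s) @[k --> \oo] -->
  \int[lebesgue_measure]_(s in `]0, t0[) ((t0 - s) `^ (c - 1) * W s).
Proof.
have [|||||iH _ cvgH] := @dominated_convergence _ _ R lebesgue_measure `]0, T]%classic
  (measurable_itv _) (fun k s => (s `^ (c - 1) * q k s)%:E) (fun s : R => (H (t0 - s))%:E)
  (fun s => (L * s `^ (c - 1))%:E).
- move=> k; apply/measurable_EFinP; apply: measurable_funM.
    by apply: measurable_funTS; exact: measurable_powR.
  by apply: measurable_funTS; exact: mq.
- by apply/measurable_EFinP; apply: measurable_funTS; exact: mHr.
(* Nothing is known about the limit of [q k] at [t0], where the past ends; a single point is
   negligible. *)
- exists [set t0]; split => //; first exact: lebesgue_measure_set1.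
  move=> s /=; apply: contra_notP => st0; rewrite in_itv/= => /andP[s0 sT].
  apply: cvg_EFin; first by near=> k.
  rewrite HrE s0/=; case: ltP => st.
    by apply: cvgMr; apply: qW; rewrite s0.
  have {}st : t0 < s by rewrite lt_neqAle st andbT; apply/eqP => /esym.
  by rewrite -(mulr0 (s `^ (c - 1))); apply: cvgMr; apply: q0; rewrite st.
- exact: integrable_kernel.
- apply: aeW => s k; rewrite /= in_itv/= => s0T.
  rewrite lee_fin normrM ger0_norm ?powR_ge0// [leLHS]mulrC.
  by rewrite ler_wpM2r ?powR_ge0// qL.
have supp : (fun s : R => (H (t0 - s))%:E) \_ `]0, T] = (fun s : R => (H (t0 - s))%:E).
  apply/funext => s; rewrite patchE mem_setE in_itv/= HrE.
  case: (ltP 0 s) => s0 //=; case: ltP => st /=; last by case: ifP.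
  by rewrite (ltW (lt_trans st t0T)).
have iHT : lebesgue_measure.-integrable setT (fun s : R => (H (t0 - s))%:E).
  have := (integrable_restrict lebesgue_measure (measurable_itv `]0, T]) measurableT
    (fun s : R => (H (t0 - s))%:E)).1.
  by rewrite setTI supp; apply.
have E : (\int[lebesgue_measure]_(s in `]0%R, T]) (H (t0 - s))%:E
   = \int[lebesgue_measure]_(s in `]0%R, t0[) ((t0 - s) `^ (c - 1) * W s)%:E)%E.
  rewrite integral_mkcond supp -integral_reflection// /H.
  rewrite [RHS]integral_mkcond; congr integral; apply/funext => s.
  by rewrite !patchE; case: ifP.
have /fineK F : (\int[lebesgue_measure]_(s in `]0%R, T]) (H (t0 - s))%:E \is a fin_num)%E.
  by apply: integrable_fin_num => //; exact: measurable_itv.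
rewrite E in F; apply: fine_cvg; rewrite /Rintegral F -E.
exact: cvgH.
Unshelve. all: by end_near. Qed.

End FractionalLimit.

(** * The discrete derivative as an exact fractional integral of a step function *)

Section StepFunction.
Context {R : realType}.
Implicit Types (c h T s : R) (v : nat -> R).

Lemma integral_powR_oc c (a b : R) : 0 < c -> 0 <= a -> a < b ->
  (\int[lebesgue_measure]_(s in `]a, b]) (s `^ (c - 1))%:E
   = (c^-1 * (b `^ c - a `^ c))%:E)%E.
Proof.
move=> c0; rewrite le_eqVlt => /predU1P[<- b0|a0 ab].
  by rewrite integral_powR0// powR0 ?gt_eqF// subr0.
rewrite integral_itv_obnd_cbnd ?integral_powR_pos//.
by apply/measurable_EFinP/measurable_funTS; exact: measurable_powR.
Qed.

Definition cell h (i : nat) : set R := `]i%:R * h, i.+1%:R * h]%classic.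

(* The increments are listed backwards in time, so that the kernel is
   [s^(-alpha)] in the time [s] elapsed before [m h]. *)
Definition increments_step h (m : nat) v s : R :=
  \sum_(i < m) h^-1 * (v (m - i)%N - v (m - i.+1)%N) * \1_(cell h i) s.

Lemma measurable_increments_step h m v : measurable_fun setT (increments_step h m v).
Proof.
apply: measurable_sum => i; apply: measurable_funM => //.
by apply: measurable_indic; exact: measurable_itv.
Qed.

Let kernel_cell c h T (m i : nat) : 0 < c -> 0 < h -> m%:R * h <= T -> (i < m)%N ->
  (\int[lebesgue_measure]_(s in `]0%R, T]) (s `^ (c - 1) * \1_(cell h i) s)%:E
  = (c^-1 * ((i.+1%:R * h) `^ c - (i%:R * h) `^ c))%:E)%E.
Proof.
move=> c0 h0 mT im.
have -> : (\int[lebesgue_measure]_(s in `]0%R, T]) (s `^ (c - 1) * \1_(cell h i) s)%:E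
   = \int[lebesgue_measure]_(s in `]0%R, T] `&` cell h i) (s `^ (c - 1))%:E)%E.
  rewrite integral_mkcondr; apply: eq_integral => s _.
  rewrite patchE indicE; case: ifP => _; first by rewrite mulr1.
  by rewrite mulr0.
rewrite (_ : _ `&` _ = `]i%:R * h, i.+1%:R * h]%classic).
  apply: integral_powR_oc => //; first by rewrite mulr_ge0// ltW.
  by rewrite ltr_pM2r// ltr_nat.
rewrite /cell; apply/seteqP; split=> s /=; first by case.
rewrite !in_itv/= => /andP[h1 h2]; split; last by rewrite h1.
rewrite (le_lt_trans _ h1) ?mulr_ge0 ?(ltW h0)//= (le_trans h2)// (le_trans _ mT)//.
by rewrite ler_pM2r// ler_nat.
Qed.

Let integrable_kernel_cell c h T (m i : nat) : 0 < c -> 0 < h -> m%:R * h <= T -> (i < m)%N ->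
  lebesgue_measure.-integrable `]0, T] (fun s : R => (s `^ (c - 1) * \1_(cell h i) s)%:E).
Proof.
move=> c0 h0 mT im; apply/integrableP; split.
  apply/measurable_EFinP; apply: measurable_funM.
    by apply: measurable_funTS; exact: measurable_powR.
  by apply: measurable_indic; exact: measurable_itv.
under eq_integral do rewrite /= ger0_norm ?mulr_ge0 ?powR_ge0//.
by rewrite (kernel_cell c0 h0 mT im) ltry.
Qed.

Lemma integral_increments_step c h T (m : nat) v : 0 < c -> 0 < h -> m%:R * h <= T ->
  \int[lebesgue_measure]_(s in `]0, T]) (s `^ (c - 1) * increments_step h m v s)
  = c^-1 * h^-1 * \sum_(i < m) ((i.+1%:R * h) `^ c - (i%:R * h) `^ c)
      * (v (m - i)%N - v (m - i.+1)%N).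
Proof.
move=> c0 h0 mT; pose a i := h^-1 * (v (m - i)%N - v (m - i.+1)%N).
rewrite /Rintegral.
have -> : (\int[lebesgue_measure]_(s in `]0%R, T]) (s `^ (c - 1) * increments_step h m v s)%:E
  = \int[lebesgue_measure]_(s in `]0%R, T])
      (\sum_(i < m) (a i)%:E * (s `^ (c - 1) * \1_(cell h i) s)%:E))%E.
  apply: eq_integral => s _; rewrite /increments_step mulr_sumr -sumEFin.
  by apply: eq_bigr => i _; rewrite -EFinM /a; congr EFin; ring.
rewrite integral_sum; last 2 first.
- exact: measurable_itv.
- move=> i; apply: integrableZl; first exact: measurable_itv.
  exact: (integrable_kernel_cell c0 h0 mT (ltn_ord i)).
under eq_bigr => i _.
  rewrite integralZl; last 2 first.
  - exact: measurable_itv.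
  - exact: (integrable_kernel_cell c0 h0 mT (ltn_ord i)).
  rewrite (kernel_cell c0 h0 mT (ltn_ord i)) -EFinM.
  over.
rewrite sumEFin /= mulr_sumr; apply: eq_bigr => i _; rewrite /a; ring.
Qed.

(** An identity, not an approximation: the integral of s^(-alpha) over the cell number i is f(i + 1)
    h^(1 - alpha)/(1 - alpha), which explains the weights of the scheme, and Gamma(2 - alpha) = (1 -
    alpha) Gamma(1 - alpha). The step function vanishes past m h, so any horizon [T] beyond it may
    be used. *)
Lemma scheme_op_integral alpha h T (m : nat) v :
  0 < alpha < 1 -> 0 < h -> (0 < m)%N -> m%:R * h <= T ->
  (Gamma (2 - alpha) * h `^ alpha)^-1 *
     (v m - \sum_(0 <= k < m) scheme_C alpha m k * v k)
  = (Gamma (1 - alpha))^-1 *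
    \int[lebesgue_measure]_(s in `]0, T])
       (s `^ (1 - alpha - 1) * increments_step h m v s).
Proof.
move=> a01 h0 m0 mT; have /andP[a0 a1] := a01.
have c0 : 0 < 1 - alpha by rewrite subr_gt0.
rewrite integral_increments_step// scheme_abel// big_nat_rev/= add0n big_mkord.
have -> : Gamma (2 - alpha) = (1 - alpha) * Gamma (1 - alpha).
  have -> : 2 - alpha = 1 - alpha + 1 by ring.
  by rewrite GammaS// c0/= lerBlDr lerDl ltW.
rewrite !invfM !mulr_sumr; apply: eq_bigr => i _.
have im := ltn_ord i.
have -> : (m.-1 - (m - i.+1) = i)%N by lia.
have -> : ((m - i.+1).+1 = m - i)%N by lia.
rewrite !powRM ?ler0n ?(ltW h0)// -mulrBl -scheme_fS.
(* The factor h^(-1) belongs to the difference quotient and h^(1 - alpha) to the integral of the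
   kernel over a cell. *)
have -> : (h `^ alpha)^-1 = h^-1 * h `^ (1 - alpha).
  rewrite powRB ?(gt_eqF h0) ?implybT// powRr1 ?ltW// mulrA mulVf ?gt_eqF// mul1r//.
ring.
Qed.

End StepFunction.

Lemma within_continuous_preim {S T U : topologicalType} (A : set T) (B : set S)
    (f : T -> U) (g : S -> T) : {within A, continuous f} -> continuous g ->
  (forall y, B y -> A (g y)) -> {within B, continuous (f \o g)}.
Proof.
move=> /subspace_continuousP cf cg BA; apply/subspace_continuousP => y By P fP.
have := cf _ (BA _ By) P fP; rewrite /fmap/= => h.
have : nbhs y (g @^-1` [set x | A x -> P (f x)]) by apply: cg; exact: h.
by apply: filterS => z /= hz Bz; apply: hz; exact: BA.
Qed.

Lemma closed_ball_rV_compact {R : realType} {n : nat} (x0 : 'rV[R]_n) (r : R) :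
  compact [set x : 'rV[R]_n | `|x - x0| <= r].
Proof.
apply: bounded_closed_compact.
  exists (r + `|x0|); split; first exact: num_real.
  move=> M rM x /= xr; apply: ltW; apply: le_lt_trans rM.
  by rewrite -[x in leLHS](subrK x0) (le_trans (ler_normD _ _))// lerD2r.
have -> : [set x : 'rV[R]_n | `|x - x0| <= r] = closed_ball_ Num.norm x0 r.
  by apply/seteqP; split=> x; rewrite /closed_ball_/= distrC.
exact: closed_closed_ball_.
Qed.

Lemma compact_rV_time {R : realType} {n : nat} (x0 : 'rV[R]_n) (r a b : R) :
  compact [set z : 'rV[R]_n * R | `|z.1 - x0| <= r /\ a <= z.2 <= b].
Proof.
have -> : [set z : 'rV[R]_n * R | `|z.1 - x0| <= r /\ a <= z.2 <= b] =
    [set x : 'rV[R]_n | `|x - x0| <= r] `*` `[a, b].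
  by apply/seteqP; split=> z /=; rewrite in_itv.
by apply: compact_setX; [exact: closed_ball_rV_compact|exact: segment_compact].
Qed.

Section StepValues.
Context {R : realType}.
Implicit Types (h s : R) (v : nat -> R).

Lemma increments_step_val h m v s : 0 < h -> 0 < s -> s <= m%:R * h ->
  exists i, [/\ (i < m)%N, i%:R * h < s, s <= i.+1%:R * h &
    increments_step h m v s = h^-1 * (v (m - i)%N - v (m - i.+1)%N)].
Proof.
move=> h0 s0 sm.
have ex : exists i, s <= i.+1%:R * h.
  by exists m; rewrite (le_trans sm)// ler_pM2r// ler_nat.
case: (ex_minnP ex) => i si imin.
have ih : i%:R * h < s.
  case: i si imin => [|i] si imin; first by rewrite mul0r.
  by rewrite ltNge; apply/negP => /imin; rewrite ltnn.
have im : (i < m)%N by rewrite -(ltr_nat R) -(ltr_pM2r h0) (lt_le_trans ih).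
exists i; split=> //.
rewrite /increments_step (bigD1 (Ordinal im))//= big1 => [|j ji].
  rewrite addr0 indicE mem_set ?mulr1//.
  by rewrite /cell/= in_itv/= ih.
rewrite indicE memNset ?mulr0//; rewrite /cell/= in_itv/= => /andP[jh sj].
have ij : i != j by apply: contra ji => /eqP ij; apply/eqP/val_inj.
have : (i < j.+1)%N by rewrite -(ltr_nat R) -(ltr_pM2r h0) (lt_le_trans ih).
have : (j < i.+1)%N by rewrite -(ltr_nat R) -(ltr_pM2r h0) (lt_le_trans jh).
by move: ij; lia.
Qed.

Lemma increments_step_out h m v s : 0 < h -> m%:R * h < s -> increments_step h m v s = 0.
Proof.
move=> h0 ms; rewrite /increments_step big1// => i _.
rewrite indicE memNset ?mulr0// /cell/= in_itv/= => /andP[_ si].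
have : m%:R * h < m%:R * h; last by rewrite ltxx.
rewrite (lt_le_trans ms)// (le_trans si)// ler_pM2r// ler_nat.
exact: ltn_ord.
Qed.
End StepValues.

(** * Consistency of the scheme on test functions *)

Section Consistency.
Context {R : realType} {n : nat}.
Variables (alpha T t0 t1 : R) (phi : 'rV[R]_n * R -> R) (x0 : 'rV[R]_n).
Hypotheses (a01 : 0 < alpha < 1) (t00 : 0 < t0) (t01 : t0 < t1) (t1T : t1 < T).
Hypothesis cphi : C2_on (strip T) phi.

Let D : 'rV[R]_n * R -> R := 'D_(0, 1) phi.

(** The maximum is taken for the continuous extension [k] on a compact set that includes time 0,
    which bounds the derivative up to the initial time. The horizon [t1 < T] is there because the
    strip is open at [T]. *)
Lemma time_derivative_bound : exists L, forall x s,
  `|x - x0| <= 1 -> 0 < s <= t1 -> `|D (x, s)| <= L.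
Proof.
case: cphi => _ /(_ (0, 1))[_ [k ck Dk]] _.
pose K := [set z : 'rV[R]_n * R | `|z.1 - x0| <= 1 /\ 0 <= z.2 <= t1].
have KT : K `<=` strip T by move=> z [_ /andP[z0 z1]]; rewrite /strip/= z0 (le_lt_trans z1).
have ckK : {within K, continuous (fun z => `|k z|)}.
  apply/subspace_continuousP => z Kz.
  move: ck => /subspace_continuousP/(_ z (KT _ Kz)) ck.
  apply: cvg_norm; apply: cvg_trans ck; apply: cvg_app; exact: within_subset KT.
have K0 : K !=set0.
  by exists (x0, 0); split => /=; rewrite ?subrr ?normr0// lexx ltW// (lt_trans t00).
have [z _ zmax] := compact_EVT_max K0 (@compact_rV_time _ _ x0 1 0 t1) ckK.
exists `|k z| => x s xx0 /andP[s0 s1].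
rewrite /D (Dk (x, s)); last by apply: strip_interior; rewrite s0 (le_lt_trans s1).
apply: zmax; rewrite inE; split => //=.
by rewrite ltW.
Qed.

Lemma MVT_time x (a b : R) : 0 <= a -> a < b -> b <= t1 ->
  exists2 s, a < s < b & phi (x, b) - phi (x, a) = D (x, s) * (b - a).
Proof.
move=> a0 ab bt1; case: cphi => p0 /(_ (0, 1))[d1 _] _.
have [||s sab E] := @MVT R (fun r => phi (x, r)) (fun r => D (x, r)) a b ab.
- move=> r; rewrite in_itv/= => /andP[ar rb].
  have rT : 0 < r < T by rewrite (le_lt_trans a0)// (lt_trans rb)// (le_lt_trans bt1).
  apply: DeriveDef; first by apply/derivable_time; apply: d1; exact: strip_interior.
  by rewrite -derive1E derive1_time.
- apply: (within_continuous_preim (g := fun r => (x, r)) p0).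
    exact: continuous_pairr.
  move=> r /=; rewrite in_itv/= /strip/= => /andP[ar rb].
  by rewrite (le_trans a0)// (le_lt_trans rb)// (le_lt_trans bt1).
by exists s => //; move: sab; rewrite in_itv.
Qed.

(** The mean value theorem on one cell: the difference quotient is the time derivative at a time of
    that cell, hence within one step of the reversed time m h - s. This supplies both the domination
    and the pointwise limit. *)
Lemma increments_step_derivative x h m s : 0 < h -> m%:R * h <= t1 ->
  0 < s -> s <= m%:R * h ->
  exists r, [/\ 0 < r <= t1, `|r - (m%:R * h - s)| <= h &
    increments_step h m (fun j => phi (x, j%:R * h)) s = D (x, r)].
Proof.
move=> h0 mt1 s0 sm.
have [i [im ih si ->]] := increments_step_val (fun j => phi (x, j%:R * h)) h0 s0 sm.
have E1 : (m - i)%:R = m%:R - i%:R :> R by rewrite natrB// ltnW.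
have E2 : (m - i.+1)%:R = m%:R - i%:R - 1 :> R by rewrite natrB// -natr1; ring.
have i0 : 0 <= i%:R * h by rewrite mulr_ge0 ?(ltW h0)//.
have im' : i%:R + 1 <= m%:R :> R by rewrite natr1 ler_nat.
have Dh : (m - i)%:R * h - (m - i.+1)%:R * h = h by rewrite E1 E2; ring.
have [||| r /andP[r1 r2] E] := @MVT_time x ((m - i.+1)%:R * h) ((m - i)%:R * h).
- by rewrite mulr_ge0 ?(ltW h0)//.
- by rewrite -subr_gt0 Dh.
- by rewrite E1 mulrBl (le_trans _ mt1)// lerBlDr lerDl//.
exists r; split.
- apply/andP; split; first by apply: le_lt_trans r1; rewrite mulr_ge0 ?(ltW h0)//.
  rewrite (le_trans (ltW r2))// E1 mulrBl (le_trans _ mt1)// lerBlDr lerDl//.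
- move: r1 r2 ih si; rewrite E1 E2 -natr1 !mulrBl !mulrDl !mul1r => r1 r2 ih si.
  by rewrite ler_norml; apply/andP; split; lra.
- by rewrite E Dh mulrC mulfK// gt_eqF.
Qed.

Variables (hs : nat -> R) (xs : nat -> 'rV[R]_n) (ms : nat -> nat).
Hypotheses (hs0 : forall k, 0 < hs k) (ms0 : forall k, (0 < ms k)%N).
Hypotheses (hsc : hs k @[k --> \oo] --> 0) (xsc : xs k @[k --> \oo] --> x0).
Hypothesis msc : (ms k)%:R * hs k @[k --> \oo] --> t0.
Hypotheses (xs1 : forall k, `|xs k - x0| <= 1) (mst1 : forall k, (ms k)%:R * hs k <= t1).

Let q k := increments_step (hs k) (ms k) (fun j => phi (xs k, j%:R * hs k)).

Lemma scheme_op_cvg :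
  (Gamma (2 - alpha) * hs k `^ alpha)^-1 *
     (phi (xs k, (ms k)%:R * hs k) -
        \sum_(0 <= j < ms k) scheme_C alpha (ms k) j * phi (xs k, j%:R * hs k))
  @[k --> \oo] --> caputo alpha phi x0 t0.
Proof.
have [L HL] := time_derivative_bound.
have L0 : 0 <= L.
  by apply: le_trans (HL x0 t1 _ _); rewrite ?normr_ge0 ?subrr ?normr0// lexx (lt_trans t00).
have c0 : 0 < 1 - alpha by case/andP: a01 => _ ?; rewrite subr_gt0.
under eq_fun do rewrite (@scheme_op_integral _ alpha (hs _) t1 (ms _) (fun j => phi (xs _, j%:R * hs _)))//.
rewrite /caputo; apply: cvgMr.
have -> : \int[lebesgue_measure]_(s in `]0, t0[) ((t0 - s) `^ (- alpha) * (fun r => phi (x0, r))^`()%classic s)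
  = \int[lebesgue_measure]_(s in `]0, t0[) ((t0 - s) `^ (1 - alpha - 1) * D (x0, s)).
  apply: eq_Rintegral => s _; rewrite derive1_time; congr (_ `^ _ * _); ring.
have cD s : 0 < s < t0 -> {for (x0, s), continuous D}.
  move=> /andP[s0 st]; case: cphi => _ /(_ (0, 1))[_ ext] _.
  apply: continuously_extends_at ext _; apply: strip_interior.
  by rewrite s0 (lt_trans st)// (lt_trans t01).
apply: (@fractional_limit R (1 - alpha) t1 t0 L (fun s => D (x0, s)) q) => //.
- move=> s st; have cs := cD s st.
  apply: (@continuous_comp _ _ _ (fun r => (x0, r)) D) => //.
  exact: continuous_pairr.
- by move=> k; exact: measurable_increments_step.
- move=> k s /andP[s0 st]; have [sm|sm] := leP s ((ms k)%:R * hs k).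
    have [r [r01 _ E]] := increments_step_derivative (xs k) (hs0 k) (mst1 k) s0 sm.
    rewrite /q E.
    exact: HL.
  by rewrite /q increments_step_out ?normr0.
- move=> s /andP[s0 st]; apply/cvgrPdist_lt => e e0.
  have st' : 0 < t0 - s < t0 by rewrite subr_gt0 st gtrBl.
  have /cvgrPdist_lt/(_ e e0) := cD _ st'.
  move=> /nbhs_normP[d /= d0 Hd].
  have d20 : 0 < d / 2 by rewrite divr_gt0.
  near=> k.
  have hk : hs k < d / 2.
    have : `|0 - hs k| < d / 2 by near: k; move/cvgrPdist_lt : hsc; apply.
    by rewrite sub0r normrN gtr0_norm.
  (* The bound t0 - s puts [s] before the end time of the scheme; the two halves of [d] pay for the
     shift of the end time and for the length of a step. *)
  have tk : `|t0 - (ms k)%:R * hs k| < Num.min (d / 2) (t0 - s).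
    by near: k; move/cvgrPdist_lt : msc; apply; rewrite lt_min d20 subr_gt0.
  have xk : `|x0 - xs k| < d by near: k; move/cvgrPdist_lt : xsc; apply.
  move: tk; rewrite lt_min => /andP[tk1 tk2].
  have sm : s <= (ms k)%:R * hs k.
    by move: tk2; rewrite ltr_norml => /andP[_]; lra.
  have [r [r01 rs E]] := increments_step_derivative (xs k) (hs0 k) (mst1 k) s0 sm.
  rewrite /q E.
  apply: Hd; rewrite /= /ball_/=.
  rewrite prod_normE/= gt_max xk/=.
  move: rs tk1; rewrite ler_norml ltr_norml => /andP[u1 u2] /andP[u3 u4].
  by rewrite ltr_norml; apply/andP; split; lra.
- move=> s /andP[ts st]; apply: cvg_near_cst; near=> k.
  apply: increments_step_out => //.
  have : `|t0 - (ms k)%:R * hs k| < s - t0.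
    by near: k; move/cvgrPdist_lt : msc; apply; rewrite subr_gt0.
  by rewrite ltr_norml => /andP[]; lra.
Unshelve. all: by end_near. Qed.

End Consistency.

(** * Barriers *)

Section Barrier.
Context {R : realType} {n : nat}.
Implicit Types (alpha h c A C r M : R) (a x : 'rV[R]_n).
Implicit Types (F : 'rV[R]_n -> R -> 'rV[R]_n -> 'M[R]_n -> R).
Implicit Types (U : nat -> 'rV[R]_n -> R).

Definition scheme_eqn alpha F h U (m : nat) :
    'rV[R]_n -> R -> 'rV[R]_n -> 'M[R]_n -> R := fun x s p X =>
  (Gamma (2 - alpha) * h `^ alpha)^-1 *
    (s - \sum_(0 <= k < m) scheme_C alpha m k * U k x) + F x (m%:R * h) p X.

(** The half of [is_scheme] that an upper estimate uses. It holds for [U] with F and, after the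
    change of sign, for [- U] with [oppF F], so one argument serves both relaxed limits. *)
Definition subscheme alpha F h U : Prop := forall m,
  continuous (U m) /\ ((0 < m)%N -> ell_subsolution (scheme_eqn alpha F h U m) (U m)).

Definition F_bound F r M : Prop := forall x t p X,
  0 <= t -> Defs.symmetric X -> `|p| <= r -> `|X| <= r -> `|F x t p X| <= M.

Lemma F_boundP F r : F_locally_bounded F -> 0 < r -> exists2 M, 0 <= M & F_bound F r M.
Proof.
move=> /(_ r) FB r0; have [M HM] := FB r0; exists `|M| => // x t p X t0 sX pr Xr.
by apply: le_trans (ler_norm M); apply: HM; exists x, t, p, X.
Qed.

Lemma symmetricZ c (X : 'M[R]_n) : Defs.symmetric X -> Defs.symmetric (c *: X).
Proof. by rewrite /Defs.symmetric linearZ /= => ->. Qed.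

Lemma symmetricD (X Y : 'M[R]_n) :
  Defs.symmetric X -> Defs.symmetric Y -> Defs.symmetric (X + Y).
Proof. by rewrite /Defs.symmetric linearD /= => -> ->. Qed.

Lemma bump1 : bump_fun (1 : R) = 2^-1.
Proof. by rewrite /bump_fun expr1n; field. Qed.

(** Outside the unit ball around [a] the penalty term is at least c times [bump_fun] 1, that is c/2,
    and outweighs the gain of [w] over [w a]; so the maximum over the compact ball is global. *)
Lemma ell_penalty_max (G : 'rV[R]_n -> R -> 'rV[R]_n -> 'M[R]_n -> R) (w : 'rV[R]_n -> R) a c :
  0 < c -> continuous w -> ell_subsolution G w ->
  (forall x, 1 <= `|x - a| -> w x - w a < c / 2) ->
  exists2 x1, G x1 (w x1) (c *: grad (penalty a) x1) (c *: hess (penalty a) x1) <= 0 &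
    forall x, w x - c * penalty a x <= w x1 - c * penalty a x1.
Proof.
move=> c0 cw [_ sw] wc.
pose K := [set x : 'rV[R]_n | `|x - a| <= 1].
have aK : K a by rewrite /K/= subrr normr0.
have cf : {within K, continuous (fun x => w x - c * penalty a x)}.
  apply: continuous_subspaceT; apply: continuousB_fun => //.
  by apply: continuousMr_fun; exact: continuous_penalty.
have [x1 _ x1max] := compact_EVT_max (ex_intro _ a aK) (@closed_ball_rV_compact _ _ a 1) cf.
have glob x : w x - c * penalty a x <= w x1 - c * penalty a x1.
  have [xK|xK] := leP `|x - a| 1; first by apply: x1max; rewrite inE.
  apply: (@le_trans _ _ (w a - c * penalty a a)); last by apply: x1max; rewrite inE.
  rewrite penalty0 mulr0 subr0.
  have h1 := wc x (ltW xK).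
  have h2 : c / 2 <= c * penalty a x.
    by rewrite ler_wpM2l ?(ltW c0)// -bump1 penalty_ge// ltW.
  lra.
exists x1 => //.
have C0 : C2_on setT (fun _ : 'rV[R]_n => 0 : R) by exact: C2_cst.
have := sw (fun x => 0 + c * penalty a x) x1 (C2_lin c C0 (C2_penalty a)).
rewrite (grad_lin c C0 (C2_penalty a)) (hess_lin c C0 (C2_penalty a)).
rewrite grad_cst hess_cst !add0r; apply.
by near=> x; rewrite !add0r.
Unshelve. all: by end_near. Qed.

Section step.
Variables (alpha : R) (F : 'rV[R]_n -> R -> 'rV[R]_n -> 'M[R]_n -> R).
Variables (h r M C : R) (U : nat -> 'rV[R]_n -> R).
Hypotheses (a01 : 0 < alpha < 1) (h0 : 0 < h) (FM : F_bound F r M) (subU : subscheme alpha F h U).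
Hypotheses (C0 : 0 <= C) (MC : Gamma (2 - alpha) * M <= C * (1 - alpha)).

Let G0 : 0 < Gamma (2 - alpha).
Proof. by apply: Gamma_gt0; case/andP: a01 => ? ?; apply/andP; split; lra. Qed.

(** At the maximum point of [U m] minus the penalty the equation bounds the discrete derivative by
    [M], since 6 c <= r keeps the test gradient and Hessian in the ball of [F_bound]. The discrete
    derivative of C t^alpha compensates [M] by the choice [MC], and the global maximum carries the
    estimate to every point. *)
Lemma barrier_step A a c m : 0 < c -> 6 * c <= r -> (0 < m)%N ->
  (forall x, 1 <= `|x - a| -> U m x - U m a < c / 2) ->
  (forall k x, (k < m)%N -> U k x <= A + c * penalty a x + C * (k%:R * h) `^ alpha) ->
  forall x, U m x <= A + c * penalty a x + C * (m%:R * h) `^ alpha.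
Proof.
move=> c0 cr m0 Uc IH.
have [cU /(_ m0) sU] := subU m.
have [x1 + x1max] := ell_penalty_max c0 cU sU Uc.
rewrite /scheme_eqn; set S := \sum_(_ <= _ < _) _; set Fv := F _ _ _ _ => ineq.
have ha0 : 0 < h `^ alpha by rewrite powR_gt0.
have Fb : `|Fv| <= M.
  apply: FM; rewrite ?mulr_ge0 ?(ltW h0)//.
  - by apply: symmetricZ; exact: hess_penalty_sym.
  - by rewrite normrZ gtr0_norm// (le_trans _ cr)// mulrC ler_wpM2r ?(ltW c0)// grad_penalty_bound.
  - by rewrite normrZ gtr0_norm// (le_trans _ cr)// mulrC ler_wpM2r ?(ltW c0)// hess_penalty_bound.
have SI : S <= A + c * penalty a x1 +
    C * \sum_(0 <= k < m) scheme_C alpha m k * (k%:R * h) `^ alpha.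
  have -> : A + c * penalty a x1 =
      \sum_(0 <= k < m) scheme_C alpha m k * (A + c * penalty a x1).
    by rewrite -mulr_suml sum_scheme_C ?mul1r//; case/andP: a01.
  rewrite mulr_sumr -big_split /S 2!big_nat /=; apply: ler_sum => k km.
  rewrite (mulrCA C) -mulrDr ler_wpM2l ?scheme_C_ge0//.
  exact: IH.
have Cb : C * \sum_(0 <= k < m) scheme_C alpha m k * (k%:R * h) `^ alpha
   <= C * (m%:R * h) `^ alpha - C * ((1 - alpha) * h `^ alpha).
  rewrite -mulrBr ler_wpM2l//; have := scheme_op_powR a01 h0 m0; lra.
have Ux1 : U m x1 - S <= C * ((1 - alpha) * h `^ alpha).
  have : (Gamma (2 - alpha) * h `^ alpha)^-1 * (U m x1 - S) <= M.
    by move: Fb; rewrite ler_norml => /andP[Fb _]; lra.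
  rewrite ler_pdivrMl ?mulr_gt0// => /le_trans; apply.
  rewrite mulrA mulrAC ler_wpM2r ?(ltW ha0)//.
move=> x; have := x1max x; lra.
Qed.

Hypothesis bU : forall m, exists B, forall x, `|U m x| <= B.

(** The supremum of [U m] need not be attained, so the penalty is centred at a point within c/2 of
    it and the barrier is evaluated at that centre. Taking c <= 1 keeps the radius 6, hence [M] and
    [C], fixed while the error e goes to 0. *)
Lemma barrier_cst A : 6 <= r -> (forall x, U 0 x <= A) ->
  forall m x, U m x <= A + C * (m%:R * h) `^ alpha.
Proof.
move=> r6 U0; elim/ltn_ind => m IH; have [->|m0] := posnP m.
  by move=> x; rewrite (le_trans (U0 x))// lerDl mulr_ge0// powR_ge0.
move=> x; apply/ler_addgt0Pr => e e0.
pose c := Num.min e 1; have c0 : 0 < c by rewrite lt_min e0 ltr01.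
have [B HB] := bU m.
have hs : has_sup (range (U m)).
  split; first by exists (U m 0); exists 0.
  by exists B => _ [y _ <-]; rewrite (le_trans (ler_norm _)).
have c20 : 0 < c / 2 by rewrite divr_gt0.
have [_ [x1 _ <-] x1S] := sup_adherent c20 hs.
have US y : U m y <= sup (range (U m)) by apply: sup_upper_bound => //; exists y.
have st : forall y, U m y <= A + c * penalty x1 y + C * (m%:R * h) `^ alpha.
  apply: barrier_step => //.
  - by rewrite (le_trans _ r6)// ger_pMr// ge_min lexx orbT.
  - by move=> y _; have := US y; lra.
  - move=> k y km; rewrite addrAC (le_trans (IH k km y))// lerDl.
    by rewrite mulr_ge0 ?penalty_ge0// ltW.
have := st x1; rewrite penalty0 mulr0 addr0 => h1.
have := US x; have : c <= e by rewrite ge_min lexx.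
lra.
Qed.

(** Here the centre is prescribed and [c] is large: the oscillation of [U m] is at most 2 B < c/2,
    as [barrier_step] asks. The horizon [t1] enters because the bound [B] is local in time. *)
Lemma barrier_penalty A a c B t1 : 6 * c <= r -> 0 < c -> 4 * B < c ->
  (forall m x, m%:R * h <= t1 -> `|U m x| <= B) ->
  (forall x, U 0 x <= A + c * penalty a x) ->
  forall m x, m%:R * h <= t1 -> U m x <= A + c * penalty a x + C * (m%:R * h) `^ alpha.
Proof.
move=> cr c0 Bc HB U0; elim/ltn_ind => m IH; have [->|m0] := posnP m.
  by move=> x _; rewrite (le_trans (U0 x))// lerDl mulr_ge0// powR_ge0.
move=> x mt; move: x; apply: barrier_step => //.
- move=> x _; have := HB m x mt; have := HB m a mt.
  by rewrite !ler_norml => /andP[h1 h2] /andP[h3 h4]; lra.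
- move=> k x km; apply: IH => //; rewrite (le_trans _ mt)// ler_pM2r// ler_nat.
  exact: ltnW.
Qed.

End step.
End Barrier.

(** * The relaxed limit is a subsolution *)

Lemma bump_gt0 {R : realType} (s : R) : 0 < s -> 0 < bump_fun s.
Proof.
by move=> s0; rewrite subr_gt0 invf_lt1 ?ltrDl ?exprn_gt0// ltr_pwDl// sqr_ge0.
Qed.

Lemma bump_le_sqr {R : realType} (s : R) : bump_fun s <= s ^+ 2.
Proof.
rewrite /bump_fun; have h := sqr_ge0 s; set q := s ^+ 2 in h *.
have q1 : 0 < 1 + q by rewrite ltr_pwDl.
have -> : 1 - (1 + q)^-1 = q / (1 + q) by field; rewrite gt_eqF.
by rewrite ler_pdivrMr// ler_peMr// lerDl.
Qed.

Lemma scheme_interp_grid {R : realType} {n : nat} (h : R) (U : nat -> 'rV[R]_n -> R) x k :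
  0 < h -> scheme_interp h U (x, k%:R * h) = U k x.
Proof.
by move=> h0; rewrite /scheme_interp/= mulfK ?gt_eqF// natrK.
Qed.

Lemma truncn_grid {R : realType} (h t : R) : 0 < h -> 0 <= t ->
  (Num.truncn (t / h))%:R * h <= t < (Num.truncn (t / h))%:R * h + h.
Proof.
move=> h0 t0; have th0 : 0 <= t / h by rewrite divr_ge0// ltW.
have /andP[h1 h2] := truncn_itv th0.
rewrite -ler_pdivlMr// h1/=.
by move: h2; rewrite ltr_pdivrMr// -natr1 mulrDl mul1r.
Qed.

Lemma grid_max {R : realType} {V : topologicalType} (K : set V) (w : nat -> V -> R) (N : nat) :
  K !=set0 -> compact K -> (forall k, (k <= N)%N -> {within K, continuous (w k)}) ->
  exists k x, [/\ (k <= N)%N, K x & forall j y, (j <= N)%N -> K y -> w j y <= w k x].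
Proof.
move=> K0 cK cw.
have /choice[xs xsP] : forall k : 'I_N.+1, exists x, K x /\ forall y, K y -> w k y <= w k x.
  move=> k; have [|x xK xmax] := compact_EVT_max K0 cK (cw k _); first by rewrite -ltnS.
  exists x; split; first by rewrite inE in xK.
  by move=> y Ky; apply: xmax; rewrite inE.
have [k _ kmax] := @arg_maxP _ _ 'I_N.+1 ord0 xpredT (fun k => w k (xs k)) isT.
exists k, (xs k); split; [by rewrite -ltnS|by have [] := xsP k|].
move=> j y jN Ky; have j1 : (j < N.+1)%N by rewrite ltnS.
have [_ /(_ y Ky) h1] := xsP (Ordinal j1).
exact: le_trans h1 (kmax (Ordinal j1) isT).
Qed.

Lemma near_box {R : realType} {V : normedModType R} (z : V * R) (d : R) : 0 < d ->
  \forall z' \near z, `|z'.1 - z.1| < d /\ `|z'.2 - z.2| < d.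
Proof.
move=> d0; apply/nbhs_normP; exists d => // z' /=.
by rewrite /ball_/= prod_normE/= gt_max => /andP[h1 h2]; split; rewrite distrC.
Qed.

Lemma near_box_center {R : realType} {V : normedModType R} (x0 : V) (t0 d : R) (z : V * R) :
  `|z.1 - x0| < d -> `|z.2 - t0| < d ->
  \forall z' \near z, `|z'.1 - x0| < d /\ `|z'.2 - t0| < d.
Proof.
move=> z1 z2; pose e := Num.min (d - `|z.1 - x0|) (d - `|z.2 - t0|).
have e0 : 0 < e by rewrite lt_min !subr_gt0 z1.
apply: filterS (near_box z e0) => z'; rewrite /e !lt_min => -[/andP[h1 _] /andP[_ h2]].
split.
- by rewrite (le_lt_trans (ler_distD z.1 _ _))// -ltrBrDr.
- by rewrite (le_lt_trans (ler_distD z.2 _ _))// -ltrBrDr.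
Qed.

Lemma near_norm_lt {R : realType} {V : normedModType R} (x x0 : V) (d : R) :
  `|x - x0| < d -> \forall y \near x, `|y - x0| < d.
Proof.
rewrite -subr_gt0 => e0; apply/nbhs_normP; exists (d - `|x - x0|) => // y /=.
rewrite /ball_/= => xy; rewrite (le_lt_trans (ler_distD x _ _))// -ltrBrDr.
by rewrite distrC.
Qed.

Lemma within_continuousB {R : realType} {T : topologicalType} (A : set T) (f g : T -> R) :
  {within A, continuous f} -> {within A, continuous g} ->
  {within A, continuous (fun x => f x - g x)}.
Proof. by move=> cf cg x; apply: cvgB; [exact: cf|exact: cg]. Qed.

Lemma within_continuousD {R : realType} {T : topologicalType} (A : set T) (f g : T -> R) :
  {within A, continuous f} -> {within A, continuous g} ->
  {within A, continuous (fun x => f x + g x)}.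
Proof. by move=> cf cg x; apply: cvgD; [exact: cf|exact: cg]. Qed.

Section Subsolution.
Context {R : realType} {n : nat}.
Variables (alpha : R) (F : 'rV[R]_n -> R -> 'rV[R]_n -> 'M[R]_n -> R).
Variables (U : R -> nat -> 'rV[R]_n -> R).
Hypothesis a01 : 0 < alpha < 1.
Hypothesis subU : forall h, 0 < h -> subscheme alpha F h (U h).

Let u h : 'rV[R]_n * R -> R := scheme_interp h (U h).
Local Notation ev := (at_right (0 : R)).
Hypothesis bu : eventually_locally_bounded ev spacetime u.
Let ubar := relaxed_limit ev spacetime u.

Let G0 : 0 < Gamma (2 - alpha).
Proof. by apply: Gamma_gt0; case/andP: a01 => ? ?; apply/andP; split; lra. Qed.

Section test.
Variables (T t0 r : R) (x0 : 'rV[R]_n) (phi : 'rV[R]_n * R -> R).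
Hypotheses (t0T : 0 < t0 < T) (r0 : 0 < r) (cphi : C2_on (strip T) phi).
Hypothesis phimax : forall x t, `|x - x0| < r -> 0 <= t < T -> t < t0 + r ->
  ubar (x, t) - phi (x, t) <= ubar (x0, t0) - phi (x0, t0).

Let pen (z : 'rV[R]_n * R) : R := penalty x0 z.1 + (z.2 - t0) ^+ 2.

Let pen0 : pen (x0, t0) = 0.
Proof. by rewrite /pen/= penalty0 subrr expr0n addr0. Qed.

Let continuous_pen : continuous pen.
Proof.
move=> z; apply: cvgD.
  by apply: (@continuous_comp _ _ _ fst (penalty x0)); [exact: cvg_fst|exact: continuous_penalty].
apply: (@continuous_comp _ _ _ (fun z : 'rV[R]_n * R => z.2 - t0) (fun s : R => s ^+ 2)).
  by apply: cvgB; [exact: cvg_snd|exact: cvg_cst].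
exact: exprn_continuous.
Qed.

(** Since s^2/(1 + s^2) <= s^2, one threshold serves for leaving the box in space and in time. *)
Let pen_ge eta z : 0 < eta -> ~ (`|z.1 - x0| < eta /\ `|z.2 - t0| < eta) ->
  bump_fun eta <= pen z.
Proof.
move=> e0 nz; have p0 := penalty_ge0 x0 z.1; have s0 := sqr_ge0 (z.2 - t0).
have [xe|xe] := ltP `|z.1 - x0| eta; last first.
  by have := penalty_ge e0 xe; rewrite /pen; lra.
have te : eta <= `|z.2 - t0| by rewrite leNgt; apply/negP => te; apply: nz.
have : bump_fun eta <= (z.2 - t0) ^+ 2.
  apply: le_trans (bump_le_sqr eta) _; rewrite -[(z.2 - t0) ^+ 2]real_normK ?num_real//.
  by rewrite lerXn2r ?nnegrE ?normr_ge0// ltW.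
by rewrite /pen; lra.
Qed.

(** At fixed [x] only (t - t0)^2 varies, with increments at most 2 T h; [scheme_op_lip] and h =
    h^alpha h^(1 - alpha) give a bound free of [m] and [h]. *)
Let pen_lip (m : nat) h x : 0 < h -> (0 < m)%N -> m%:R * h <= T ->
  `|(Gamma (2 - alpha) * h `^ alpha)^-1 * (pen (x, m%:R * h) -
      \sum_(0 <= k < m) scheme_C alpha m k * pen (x, k%:R * h))|
  <= (Gamma (2 - alpha))^-1 * (2 * T) * T `^ (1 - alpha).
Proof.
move=> h0 m0 mT; have /andP[a0 a1] := a01; have /andP[t00 t0T'] := t0T.
have T0 : 0 < T by exact: lt_trans t0T'.
have ha0 : 0 < h `^ alpha by rewrite powR_gt0.
have lip k : (k < m)%N -> `|pen (x, k.+1%:R * h) - pen (x, k%:R * h)| <= 2 * T * h.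
  move=> km; have -> : pen (x, k.+1%:R * h) - pen (x, k%:R * h)
      = (2 * (k%:R * h) + h - 2 * t0) * h by rewrite /pen/= -natr1; ring.
  rewrite normrM (gtr0_norm h0) ler_wpM2r ?(ltW h0)//.
  have k0 : 0 <= k%:R * h by rewrite mulr_ge0 ?(ltW h0).
  have k1 : k%:R * h + h <= m%:R * h.
    by rewrite -{2}(mul1r h) -mulrDl natr1 ler_pM2r// ler_nat.
  by rewrite ler_norml; apply/andP; split; lra.
have := @scheme_op_lip R alpha (2 * T * h) m (fun k => pen (x, k%:R * h)) a01 m0 lip; move=> le1; rewrite normrM.
have gh0 : 0 < Gamma (2 - alpha) * h `^ alpha by rewrite mulr_gt0.
rewrite (gtr0_norm (x := _^-1)) ?invr_gt0// ler_pdivrMl//.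
apply: (le_trans le1).
have -> : Gamma (2 - alpha) * h `^ alpha * ((Gamma (2 - alpha))^-1 * (2 * T) * T `^ (1 - alpha))
   = 2 * T * (h `^ alpha * T `^ (1 - alpha)).
  by field; rewrite gt_eqF.
rewrite -mulrA ler_wpM2l ?mulr_ge0 ?(ltW T0)//.
have -> : h * m%:R `^ (1 - alpha) = h `^ alpha * (m%:R * h) `^ (1 - alpha).
  have hE : h = h `^ alpha * h `^ (1 - alpha).
    by rewrite -powRD ?(gt_eqF h0) ?implybT// addrC subrK powRr1// ltW.
  by rewrite powRM ?ler0n ?(ltW h0)// {1}hE; ring.
rewrite ler_wpM2l ?(ltW ha0)//; apply: ge0_ler_powR => //.
- by rewrite subr_ge0 ltW.
- by rewrite nnegrE mulr_ge0 ?(ltW h0).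
- by rewrite nnegrE ltW.
Qed.

(** The penalised test function [psi] turns the maximum at (x0, t0) into a strict one with a gap
    outside the eta-box. The gap survives for small h on the compact set [K], which contains the
    whole past, so a maximum over the grid falls into the box. It is used twice: in space at fixed
    time as an elliptic test, and in time at fixed point for [scheme_op_le]. *)
Lemma grid_test d : 0 < d -> exists h m x,
  [/\ 0 < h < d, (0 < m)%N, `|x - x0| < d /\ `|m%:R * h - t0| < d, m%:R * h < T &
   (Gamma (2 - alpha) * h `^ alpha)^-1 * (phi (x, m%:R * h) -
      \sum_(0 <= k < m) scheme_C alpha m k * phi (x, k%:R * h)) +
   F x (m%:R * h) (grad (fun y => phi (y, m%:R * h)) x + d *: grad (penalty x0) x)
     (hess (fun y => phi (y, m%:R * h)) x + d *: hess (penalty x0) x)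
   <= d * ((Gamma (2 - alpha))^-1 * (2 * T) * T `^ (1 - alpha))].
Proof.
move=> d0; have /andP[t00 t0T'] := t0T.
pose rho := Num.min r (T - t0) / 2.
have rT0 : 0 < Num.min r (T - t0) by rewrite lt_min r0 subr_gt0.
have rho0 : 0 < rho by rewrite divr_gt0.
have rho_min : rho < Num.min r (T - t0) by rewrite /rho ltr_pdivrMr// ltr_pMr// ltr1n.
have /andP[rho_r rho_T] : (rho < r) && (rho < T - t0) by rewrite -lt_min.
(* [eta <= t0] excludes the initial time from the box, so [m] is positive; [eta <= rho] makes the
   maximum interior in space, hence local on R^n. *)
pose eta := Num.min d (Num.min rho t0).
have eta0 : 0 < eta by rewrite !lt_min d0 rho0 t00.
have eta_d : eta <= d by rewrite ge_min lexx.
have eta_rho : eta <= rho by rewrite !ge_min lexx orbT.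
have eta_t0 : eta <= t0 by rewrite !ge_min lexx !orbT.
pose psi z := phi z + d * pen z.
pose M0 := ubar (x0, t0) - phi (x0, t0).
pose k0 := d * bump_fun eta.
have k00 : 0 < k0 by rewrite mulr_gt0// bump_gt0.
(* Off the box u^h - psi stays below M0 - k0 + 2 e, while the best grid value exceeds M0 - 2 e; the
   level M0 - k0/2 separates the two. *)
pose e := k0 / 8; have e0 : 0 < e by rewrite divr_gt0.
pose K := [set z : 'rV[R]_n * R | `|z.1 - x0| <= rho /\ 0 <= z.2 <= t0 + rho].
have KT : K `<=` strip T.
  by move=> z [_ /andP[z0 z1]]; rewrite /strip/= z0/= (le_lt_trans z1)// -ltrBrDl.
have KS : K `<=` spacetime by move=> z [_ /andP[]].
have S0 : @spacetime R n (x0, t0) by rewrite /spacetime/= ltW.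
have cpsi : {within strip T, continuous psi}.
  apply: within_continuousD; first by case: cphi.
  apply: continuous_subspaceT; apply: continuousMr_fun; exact: continuous_pen.
have Hi : \forall h \near ev, K `<=` [set z |
    (`|z.1 - x0| < eta /\ `|z.2 - t0| < eta) \/ u h z - psi z < M0 - k0 / 2].
  have cK := @compact_rV_time _ _ x0 rho 0 (t0 + rho).
  move/compact_near_coveringP/near_covering_withinP : cK; apply => z Kz.
  have [[z1 z2]|nB] := pselect (`|z.1 - x0| < eta /\ `|z.2 - t0| < eta).
    exists ([set z' | `|z'.1 - x0| < eta /\ `|z'.2 - t0| < eta], setT).
      by split=> /=; [exact: near_box_center|exact: filterT].
    by move=> [z' h] /= [Bz' _] _; left.
  have [[/= P Q] [FP wQ] PQ] := relaxed_limit_near bu (KS _ Kz) e0.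
  have cz := (subspace_continuousP _ _).1 cpsi z (KT _ Kz).
  have /cvgrPdist_lt/(_ e e0) cz' := cz.
  exists ([set z' | (spacetime z' -> Q z') /\ (strip T z' -> `|psi z - psi z'| < e)], P).
    by split => //=; apply: filterI.
  move=> [z' h] /= [[q1 q2] ph] Kz'; right.
  have /= h1 := PQ (h, z') (conj ph (q1 (KS _ Kz'))).
  have := q2 (KT _ Kz'); rewrite ltr_norml => /andP[h2 h3].
  have h4 : ubar z - phi z <= M0.
    have [Kz1 /andP[Kz2 Kz3]] := Kz; rewrite [z]surjective_pairing; apply: phimax.
    - exact: le_lt_trans rho_r.
    - by case: (KT _ Kz) => /andP[-> ->].
    - by rewrite (le_lt_trans Kz3)// ltrD2l.
  have h5 : k0 <= d * pen z by rewrite ler_wpM2l ?(ltW d0)//; exact: pen_ge.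
  move: h1 h2 h3 h5; rewrite -/ubar /psi /e; lra.
have cz0 := (subspace_continuousP _ _).1 cpsi (x0, t0).
have /cz0/cvgrPdist_lt/(_ e e0) /nbhs_normP[d2 /= d20 Hd2] : strip T (x0, t0).
  by rewrite /strip/= t0T' ltW.
(* Halved because (y, s) is later moved back to the grid time below [s], a further shift of at most
   h < d1. *)
pose d1 := Num.min d2 eta / 2.
have de0 : 0 < Num.min d2 eta by rewrite lt_min d20.
have d10 : 0 < d1 by rewrite divr_gt0.
have d1d2 : d1 + d1 <= d2 by rewrite /d1 -splitr ge_min lexx.
have d1eta : d1 + d1 <= eta by rewrite /d1 -splitr ge_min lexx orbT.
have HP : \forall p \near locally_eventually ev spacetime (x0, t0),
    [/\ 0 < p.1 < d1, K `<=` [set z |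
    (`|z.1 - x0| < eta /\ `|z.2 - t0| < eta) \/ u p.1 z - psi z < M0 - k0 / 2],
    spacetime p.2 & `|p.2.1 - x0| < d1 /\ `|p.2.2 - t0| < d1].
  exists ([set h | 0 < h < d1 /\ K `<=` [set z |
    (`|z.1 - x0| < eta /\ `|z.2 - t0| < eta) \/ u h z - psi z < M0 - k0 / 2]],
    [set z | spacetime z /\ (`|z.1 - x0| < d1 /\ `|z.2 - t0| < d1)]).
    split => /=.
      apply: filterI => //; near=> h; apply/andP; split; near: h.
        exact: nbhs_right_gt.
      exact: nbhs_right_lt.
    by apply: filterS (near_box (x0, t0) d10) => z h1 h2; split.
  by move=> p [[h1 h2] [h3 h4]]; split.
have [[h [y s]] [/= [/andP[h0 hd1] Hh s0 [y1 s1]] hu]] := relaxed_limit_freq bu S0 e0 HP.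
have {}s0 : 0 <= s := s0.
have hd : h < d by apply: lt_le_trans eta_d; lra.
pose N := Num.truncn ((t0 + rho) / h).
have tr0 : 0 <= t0 + rho by rewrite addr_ge0// ltW.
have /andP[N1 N2] := truncn_grid h0 tr0; rewrite -/N in N1 N2.
have jN j : (j <= N)%N -> j%:R * h <= t0 + rho.
  by move=> jN; rewrite (le_trans _ N1)// ler_pM2r// ler_nat.
have jT j : (j <= N)%N -> j%:R * h < T.
  by move=> /jN h1; rewrite (le_lt_trans h1)// -ltrBrDl.
have jh0 j : 0 <= j%:R * h by rewrite mulr_ge0// ltW.
pose Kx := [set x : 'rV[R]_n | `|x - x0| <= rho].
have [|||m [x [mN Kxx xmax]]] := @grid_max R 'rV[R]_n Kx
    (fun k x => U h k x - psi (x, k%:R * h)) N.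
- by exists x0; rewrite /Kx/= subrr normr0 ltW.
- exact: closed_ball_rV_compact.
- move=> k kN; apply: within_continuousB.
    by apply: continuous_subspaceT; case: (subU h0 k).
  apply: (within_continuous_preim (g := fun x => (x, k%:R * h)) cpsi).
    exact: continuous_pairl.
  by move=> x _; rewrite /strip/= jh0 jT.
pose k1 := Num.truncn (s / h).
have /andP[k1s sk1] := truncn_grid h0 s0; rewrite -/k1 in k1s sk1.
move: (y1) (s1); rewrite !ltr_norml => _ /andP[s11 s12].
have k1N : (k1 <= N)%N.
  rewrite -ltnS -(ltr_nat R) -(ltr_pM2r h0) -[N.+1%:R]natr1 mulrDl mul1r.
  by rewrite (le_lt_trans k1s)// (lt_trans _ N2)//; lra.
have h1 := xmax k1 y k1N (ltW (lt_le_trans y1 _)).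
have {}h1 : U h k1 y - psi (y, k1%:R * h) <= U h m x - psi (x, m%:R * h).
  by apply: h1; lra.
have h2 : `|psi (x0, t0) - psi (y, k1%:R * h)| < e.
  apply: Hd2; last by rewrite /strip/= jh0 jT.
  rewrite /ball_/= prod_normE/= gt_max distrC (lt_le_trans y1); last by lra.
  by rewrite /= ltr_norml; apply/andP; split; lra.
have psi0 : psi (x0, t0) = phi (x0, t0) by rewrite /psi pen0 mulr0 addr0.
have hu' : ubar (x0, t0) - e < U h k1 y := hu.
have KK : K (x, m%:R * h) by split => //=; rewrite jh0 jN.
have [x1 m1] : `|x - x0| < eta /\ `|m%:R * h - t0| < eta.
  have [//|] := Hh _ KK; rewrite /u scheme_interp_grid// => h3.
  move: h2; rewrite psi0 ltr_norml => /andP[h4 h5].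
  by exfalso; move: h1 h3 h4 h5 hu'; rewrite /M0 /e; lra.
have m0 : (0 < m)%N.
  rewrite lt0n; apply/eqP => mE; move: m1; rewrite mE mul0r sub0r normrN.
  by rewrite ger0_norm ?(ltW t00)// ltNge eta_t0.
have mT := jT m mN.
have mT0 : 0 < m%:R * h < T by rewrite mT mulr_gt0// ltr0n.
exists h, m, x; split => //.
- by rewrite h0.
- by split; exact: lt_le_trans eta_d.
have C2p := C2_slice cphi mT0.
have [_ /(_ m0)[_ sU]] := subU h0 m.
have := sU _ x (C2_lin d C2p (C2_penalty x0)).
rewrite (grad_lin d C2p (C2_penalty x0)) (hess_lin d C2p (C2_penalty x0)).
set p := (grad _ _ + _); set X := (hess _ _ + _).
have loc : \forall y \near x,
    U h m y - (phi (y, m%:R * h) + d * penalty x0 y) <=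
    U h m x - (phi (x, m%:R * h) + d * penalty x0 x).
  have xrho : `|x - x0| < rho by exact: lt_le_trans eta_rho.
  apply: filterS (near_norm_lt xrho) => y' /ltW y'K.
  have := xmax m y' mN y'K; rewrite /psi /pen/=; lra.
move=> /(_ loc); rewrite /scheme_eqn.
have := @scheme_op_le R alpha m (fun k => psi (x, k%:R * h)) (fun k => U h k x) a01 m0.
have inc k : (k < m)%N ->
    psi (x, m%:R * h) - psi (x, k%:R * h) <= U h m x - U h k x.
  move=> km; have := xmax k x (leq_trans (ltnW km) mN) Kxx; lra.
move=> /(_ inc) opl.
have lam0 : 0 < (Gamma (2 - alpha) * h `^ alpha)^-1.
  by rewrite invr_gt0 mulr_gt0// powR_gt0.
have opE : psi (x, m%:R * h) - \sum_(0 <= k < m) scheme_C alpha m k * psi (x, k%:R * h)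
   = (phi (x, m%:R * h) - \sum_(0 <= k < m) scheme_C alpha m k * phi (x, k%:R * h))
   + d * (pen (x, m%:R * h) - \sum_(0 <= k < m) scheme_C alpha m k * pen (x, k%:R * h)).
  rewrite {1 2}/psi.
  under eq_bigr do rewrite mulrDr (mulrCA _ d).
  by rewrite big_split/= -mulr_sumr; ring.
move: opl; rewrite opE -(ler_pM2l lam0) => opl.
have := pen_lip x h0 m0 (ltW mT); rewrite ler_norml => /andP[pl _] eqn.
set Cst := (Gamma (2 - alpha))^-1 * (2 * T) * T `^ (1 - alpha) in pl *.
have {}pl := ler_wpM2l (ltW d0) pl.
set opphi := phi _ - _ in opl *.
set oppen := pen _ - _ in opl pl.
set opU := U h m x - _ in opl eqn.
set lam := (_ * _)^-1 in opl pl eqn *.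
have E1 : lam * (opphi + d * oppen) = lam * opphi + d * (lam * oppen) by ring.
rewrite E1 in opl; rewrite mulrN in pl; lra.
Unshelve. all: by end_near. Qed.

End test.
End Subsolution.

Lemma within_continuous_seq {R : realType} {T : topologicalType} (A : set T) (f : T -> R)
    (zs : nat -> T) (z : T) : {within A, continuous f} -> A z -> (forall k, A (zs k)) ->
  zs k @[k --> \oo] --> z -> f (zs k) @[k --> \oo] --> f z.
Proof.
move=> /subspace_continuousP cf Az Azs zsz P /(cf z Az); rewrite /fmap/= => h.
have h' : \forall k \near \oo, A (zs k) -> P (f (zs k)) by exact: (zsz _ h).
by apply: filterS h' => k; apply; exact: Azs.
Qed.

Lemma cvgD_seq {R : realType} {V : normedModType R} (f g : nat -> V) (a b : V) :
  f k @[k --> \oo] --> a -> g k @[k --> \oo] --> b -> (f k + g k) @[k --> \oo] --> a + b.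
Proof. exact: cvgD. Qed.

Lemma cvg_scaled_bounded {R : realType} {V : normedModType R} (d : nat -> R) (f : nat -> V) (M : R) :
  d k @[k --> \oo] --> 0 -> (forall k, `|f k| <= M) -> (d k *: f k) @[k --> \oo] --> (0 : V).
Proof.
move=> d0 fM; have M0 : 0 <= M by apply: le_trans (fM 0%N).
apply/cvgr0Pnorm_lt => e e0; have eM : 0 < e / (1 + M) by rewrite divr_gt0// ltr_pwDl.
near=> k; rewrite normrZ.
have dk : `|d k| < e / (1 + M) by near: k; exact: (cvgr0_norm_lt _ d0 _ eM).
apply: (@le_lt_trans _ _ (`|d k| * (1 + M))); last by rewrite -ltr_pdivlMr// ltr_pwDl.
by rewrite ler_wpM2l// (le_trans (fM k))// lerDr.
Unshelve. all: by end_near. Qed.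

Section SubsolutionLimit.
Context {R : realType} {n : nat}.
Variables (alpha : R) (F : 'rV[R]_n -> R -> 'rV[R]_n -> 'M[R]_n -> R).
Variables (U : R -> nat -> 'rV[R]_n -> R).
Hypotheses (a01 : 0 < alpha < 1) (Fc : F_continuous F).
Hypothesis subU : forall h, 0 < h -> subscheme alpha F h (U h).
Hypothesis bu : eventually_locally_bounded (at_right (0 : R)) spacetime
  (fun h : R => scheme_interp h (U h)).

(** [grid_test] is applied with parameters [dk k] tending to 0; the step, the grid point and the
    penalty terms converge simultaneously, and the right-hand side is a fixed constant times
    [dk k]. *)
Lemma relaxed_subsolution : subsolution alpha F
  (relaxed_limit (at_right (0 : R)) spacetime (fun h : R => scheme_interp h (U h))).
Proof.
move=> T T0; split.
  apply: (@usc_on_subset _ _ spacetime); last exact: relaxed_limit_usc bu.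
  by move=> z /andP[].
move=> phi x0 t0 cphi t0T [r r0 Hr]; have /andP[t00 t0T'] := t0T.
pose t1 := (t0 + T) / 2.
have t01 : t0 < t1 by rewrite /t1; lra.
have t1T : t1 < T by rewrite /t1; lra.
(* Keeps every grid point within distance 1 of [x0] and before [t1], the region in which
   [scheme_op_cvg] bounds the time derivative. *)
pose d := Num.min 1 (t1 - t0).
have d0 : 0 < d by rewrite lt_min ltr01 subr_gt0.
pose dk (k : nat) : R := d * k.+1%:R^-1.
have dk0 k : 0 < dk k by rewrite mulr_gt0// invr_gt0.
have dkd k : dk k <= d by rewrite ger_pMr// invf_le1// ler1n.
have d1 : d <= 1 by rewrite ge_min lexx.
have dt : d <= t1 - t0 by rewrite ge_min lexx orbT.
have dkc : dk k @[k --> \oo] --> (0 : R).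
  by rewrite -(mulr0 d); apply: cvgMr; exact: cvg_harmonic.
have /choice[q qP] : forall k, exists q : R * nat * 'rV[R]_n,
  [/\ 0 < q.1.1 < dk k, (0 < q.1.2)%N,
    `|q.2 - x0| < dk k /\ `|q.1.2%:R * q.1.1 - t0| < dk k, q.1.2%:R * q.1.1 < T &
   (Gamma (2 - alpha) * q.1.1 `^ alpha)^-1 * (phi (q.2, q.1.2%:R * q.1.1) -
      \sum_(0 <= j < q.1.2) scheme_C alpha q.1.2 j * phi (q.2, j%:R * q.1.1)) +
   F q.2 (q.1.2%:R * q.1.1) (grad (fun y => phi (y, q.1.2%:R * q.1.1)) q.2 + dk k *: grad (penalty x0) q.2)
     (hess (fun y => phi (y, q.1.2%:R * q.1.1)) q.2 + dk k *: hess (penalty x0) q.2)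
   <= dk k * ((Gamma (2 - alpha))^-1 * (2 * T) * T `^ (1 - alpha))].
  move=> k; have [h [m [x H]]] := grid_test a01 subU bu t0T r0 cphi Hr (dk0 k).
  by exists (h, m, x).
pose hs k := (q k).1.1; pose ms k := (q k).1.2; pose xs k := (q k).2.
pose ts k := (ms k)%:R * hs k.
have hs0 k : 0 < hs k by have [/andP[]] := qP k.
have ms0 k : (0 < ms k)%N by have [] := qP k.
have hsc : hs k @[k --> \oo] --> (0 : R).
  apply: (squeeze_cvgr _ (cvg_cst 0) dkc); near=> k.
  by have [/andP[h1 h2] _ _ _ _] := qP k; apply/andP; split; exact: ltW.
have xsc : xs k @[k --> \oo] --> x0.
  apply/cvgrPdist_lt => e e0; near=> k.
  have [_ _ [h1 _] _ _] := qP k; rewrite distrC (lt_trans h1)//.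
  rewrite -[dk k]gtr0_norm//; near: k; exact: (cvgr0_norm_lt _ dkc _ e0).
have tsc : ts k @[k --> \oo] --> t0.
  apply/cvgrPdist_lt => e e0; near=> k.
  have [_ _ [_ h1] _ _] := qP k; rewrite distrC (lt_trans h1)//.
  rewrite -[dk k]gtr0_norm//; near: k; exact: (cvgr0_norm_lt _ dkc _ e0).
have xs1 k : `|xs k - x0| <= 1.
  by have [_ _ [h1 _] _ _] := qP k; rewrite (le_trans (ltW h1))// (le_trans (dkd k)).
have tst1 k : ts k <= t1.
  have [_ _ [_ h1] _ _] := qP k; move: h1; rewrite ltr_norml => /andP[_ h1].
  have := dkd k; rewrite /ts /ms /hs; lra.
have tsT k : 0 < ts k < T by rewrite mulr_gt0 ?ltr0n//= (le_lt_trans (tst1 k)).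
have c1 := scheme_op_cvg a01 t00 t01 t1T cphi hs0 ms0 hsc xsc tsc xs1 tst1.
pose ps k := grad (fun y => phi (y, ts k)) (xs k) + dk k *: grad (penalty x0) (xs k).
pose Xs k := hess (fun y => phi (y, ts k)) (xs k) + dk k *: hess (penalty x0) (xs k).
have psc : ps k @[k --> \oo] --> grad (fun y => phi (y, t0)) x0.
  rewrite -[X in _ --> X]addr0; apply: cvgD_seq; first exact: (cvg_grad cphi t0T xsc tsc).
  by apply: (cvg_scaled_bounded (M := 6) dkc) => k; exact: grad_penalty_bound.
have Xsc : Xs k @[k --> \oo] --> hess (fun y => phi (y, t0)) x0.
  rewrite -[X in _ --> X]addr0; apply: cvgD_seq; first exact: (cvg_hess cphi t0T xsc tsc).
  by apply: (cvg_scaled_bounded (M := 6) dkc) => k; exact: hess_penalty_bound.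
have c2 : F (xs k) (ts k) (ps k) (Xs k) @[k --> \oo] -->
    F x0 t0 (grad (fun y => phi (y, t0)) x0) (hess (fun y => phi (y, t0)) x0).
  apply: (within_continuous_seq (zs := fun k => (xs k, ts k, ps k, Xs k))
    (z := (x0, t0, grad (fun y => phi (y, t0)) x0, hess (fun y => phi (y, t0)) x0)) Fc).
  - by split => /=; [exact: ltW|exact: (hess_sym x0 (C2_slice cphi t0T))].
  - move=> k; split => /=; first by case/andP: (tsT k) => /ltW.
    apply: symmetricD; first exact: (hess_sym (xs k) (C2_slice cphi (tsT k))).
    by apply: symmetricZ; exact: hess_penalty_sym.
  - by do 3 apply: cvg_pair_seq => //.
have c3 : (dk k * ((Gamma (2 - alpha))^-1 * (2 * T) * T `^ (1 - alpha))) @[k --> \oo] --> (0 : R).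
  by rewrite -[X in _ --> X](mul0r ((Gamma (2 - alpha))^-1 * (2 * T) * T `^ (1 - alpha))); apply: cvgMl.
apply: (ler_cvg_to (cvgD_seq c1 c2) c3).
by near=> k; have [] := qP k.
Unshelve. all: by end_near. Qed.

End SubsolutionLimit.

(** * Change of sign *)

Lemma continuousN_fun {R : realType} {V : topologicalType} (f : V -> R) :
  continuous f -> continuous (fun x => - f x).
Proof. by move=> fc x; apply: cvgN; exact: fc. Qed.

Lemma continuous_pair_fun {S U W : topologicalType} (f : S -> U) (g : S -> W) :
  continuous f -> continuous g -> continuous (fun s => (f s, g s)).
Proof. by move=> cf cg s; apply: cvg_pair => /=; [exact: cf|exact: cg]. Qed.

Lemma continuous_opp_arguments {R : realType} {X : topologicalType} {V W : normedModType R} :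
  continuous (fun z : X * R * V * W => (z.1.1.1, z.1.1.2, - z.1.2, - z.2)).
Proof.
have c1 : continuous (fun z : X * R * V * W => z.1) by move=> z; exact: cvg_fst.
have c11 : continuous (fun z : X * R * V * W => z.1.1).
  by move=> z; apply: (@continuous_comp _ _ _ (fun z => z.1) fst); [exact: c1|exact: cvg_fst].
have c2 : continuous (fun z : X * R * V * W => z.2) by move=> z; exact: cvg_snd.
have c12 : continuous (fun z : X * R * V * W => z.1.2).
  by move=> z; apply: (@continuous_comp _ _ _ (fun z => z.1) snd); [exact: c1|exact: cvg_snd].
have c111 : continuous (fun z : X * R * V * W => z.1.1.1).
  by move=> z; apply: (@continuous_comp _ _ _ (fun z => z.1.1) fst); [exact: c11|exact: cvg_fst].
have c112 : continuous (fun z : X * R * V * W => z.1.1.2).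
  by move=> z; apply: (@continuous_comp _ _ _ (fun z => z.1.1) snd); [exact: c11|exact: cvg_snd].
have c12N : continuous (fun z : X * R * V * W => - z.1.2).
  by move=> z; apply: cvgN; exact: c12.
have c2N : continuous (fun z : X * R * V * W => - z.2).
  by move=> z; apply: cvgN; exact: c2.
exact: (continuous_pair_fun (continuous_pair_fun (continuous_pair_fun c111 c112) c12N) c2N).
Qed.

Lemma cvg_cst_seq {T : topologicalType} (x : T) : x @[k --> \oo] --> x.
Proof. exact: cvg_cst. Qed.

Lemma unif_continuous_continuous {R : realType} {V : normedModType R} (f : V -> R) :
  unif_continuous f -> continuous f.
Proof.
move=> /unif_continuousP fc x; apply/cvg_ballP => e e0; have [d d0 H] := fc e e0.
near=> y; apply: (H (x, y)); near: y; exact: nbhsx_ballx.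
Unshelve. all: by end_near. Qed.

Lemma bounded_on_exists {T : Type} {R : realType} (A : set T) (f : T -> R) :
  [bounded f x | x in A] -> exists2 B, 0 < B & forall x, A x -> `|f x| <= B.
Proof. by move=> /pinfty_ex_gt0[B B0 HB]; exists B. Qed.

Lemma bounded_on_le {T : Type} {R : realType} (A : set T) (f : T -> R) B :
  (forall x, A x -> `|f x| <= B) -> [bounded f x | x in A].
Proof.
move=> HB; rewrite /bounded_near; near=> M => x Ax /=; rewrite (le_trans (HB x Ax))//.
Unshelve. all: by end_near. Qed.

Section Opposite.
Context {R : realType}.

(** The opposite is written [0 + -1 * f], so that its slices are instances of [grad_lin] and
    [hess_lin]. The second derivative uses that the first ones are opposite on a whole
    neighbourhood, which interior points provide. *)
Lemma C2_onN {V : normedModType R} (A : set V) (f : V -> R) :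
  C2_on A f -> C2_on A (fun z => 0 + -1 * f z).
Proof.
move=> [f0 f1 f2].
have fE : (fun z => 0 + -1 * f z) = - f by apply/funext => z; rewrite add0r mulN1r.
rewrite fE.
have ext (g g' : V -> R) : (forall z, A° z -> g' z = - g z) ->
    continuously_extends A g -> continuously_extends A g'.
  move=> gg' [k ck gk]; exists (fun z => - k z).
    by move=> z; apply: cvgN; exact: ck.
  by move=> z Az; rewrite gg'// gk.
have D1 v z : A° z -> 'D_v (- f) z = - 'D_v f z.
  by move=> Az; have [df _] := f1 v; rewrite deriveN//; exact: df.
have near1 v z : A° z -> \forall y \near z, (- 'D_v f) y = 'D_v (- f) y.
  move=> Az; have : nbhs z A° by exact: nbhs_interior.
  by apply: filterS => y Ay; rewrite D1.
have D2 v w z : A° z -> 'D_w ('D_v (- f)) z = - 'D_w ('D_v f) z.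
  move=> Az; rewrite -(near_eq_derive _ (near1 v z Az)).
  by have [df _] := f2 v w; rewrite deriveN//; exact: df.
split.
- by move=> z; apply: cvgN; exact: f0.
- move=> v; have [df ef] := f1 v; split; last exact: ext (D1 v) ef.
  by move=> z Az; apply: derivableN; exact: df.
- move=> v w; have [df ef] := f2 v w; split; last exact: ext (D2 v w) ef.
  move=> z Az; apply: (near_eq_derivable (near1 v z Az)).
  by apply: derivableN; exact: df.
Qed.

Context {n : nat}.
Implicit Types (F : 'rV[R]_n -> R -> 'rV[R]_n -> 'M[R]_n -> R).

(** The nonlinearity of the equation satisfied by -u when u solves the one with F. *)
Definition oppF F : 'rV[R]_n -> R -> 'rV[R]_n -> 'M[R]_n -> R :=
  fun x t p X => - F x t (- p) (- X).

Lemma symmetricN (X : 'M[R]_n) : Defs.symmetric X -> Defs.symmetric (- X).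
Proof. by rewrite /Defs.symmetric linearN /= => ->. Qed.

Lemma F_continuousN F : F_continuous F -> F_continuous (oppF F).
Proof.
move=> Fc.
pose g (z : 'rV[R]_n * R * 'rV[R]_n * 'M[R]_n) := (z.1.1.1, z.1.1.2, - z.1.2, - z.2).
have cg : continuous g.
  exact: continuous_opp_arguments.
have := within_continuous_preim (B := [set z : 'rV[R]_n * R * 'rV[R]_n * 'M[R]_n |
             0 <= z.1.1.2 /\ Defs.symmetric z.2]) Fc cg.
move=> H z; apply: cvgN; apply: H => y [y1 y2]; split => //=.
exact: symmetricN.
Qed.

Lemma F_locally_boundedN F : F_locally_bounded F -> F_locally_bounded (oppF F).
Proof.
move=> FB r r0; have [M HM] := FB r r0; exists M => y [x [t [p [X [t0 sX pr Xr ->]]]]].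
rewrite /oppF normrN; apply: HM; exists x, t, (- p), (- X).
by split => //; rewrite ?normrN//; exact: symmetricN.
Qed.

(** By [scheme_op_cvg] both sides are limits of discrete derivatives, for which linearity is plain
    algebra; uniqueness of limits concludes, with no integrability argument for Caputo's
    integrand. *)
Lemma caputoN alpha T (phi : 'rV[R]_n * R -> R) x0 t0 : 0 < alpha < 1 ->
  0 < t0 < T -> C2_on (strip T) phi ->
  caputo alpha (fun z => 0 + -1 * phi z) x0 t0 = - caputo alpha phi x0 t0.
Proof.
move=> a01 /andP[t00 t0T] cphi.
pose t1 := (t0 + T) / 2.
have t01 : t0 < t1 by rewrite /t1; lra.
have t1T : t1 < T by rewrite /t1; lra.
(* The grid with k + 1 steps of this length ends exactly at [t0]. *)
pose hs (k : nat) : R := t0 * k.+1%:R^-1.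
have hs0 k : 0 < hs k by rewrite mulr_gt0// invr_gt0.
have hsc : hs k @[k --> \oo] --> (0 : R).
  by rewrite -(mulr0 t0); apply: cvgMr; exact: cvg_harmonic.
have ms k : k.+1%:R * hs k = t0 by rewrite /hs mulrCA mulfV ?mulr1// pnatr_eq0.
have msc : k.+1%:R * hs k @[k --> \oo] --> t0.
  by under eq_fun do rewrite ms; exact: cvg_cst.
have xsc := @cvg_cst_seq _ x0.
have xs1 (k : nat) : `|x0 - x0| <= 1 by rewrite subrr normr0.
have mst1 k : k.+1%:R * hs k <= t1 by rewrite ms ltW.
have c1 := scheme_op_cvg a01 t00 t01 t1T cphi hs0 (fun k => ltn0Sn k) hsc xsc msc xs1 mst1.
have c2 := scheme_op_cvg a01 t00 t01 t1T (C2_onN cphi) hs0 (fun k => ltn0Sn k) hsc xsc msc xs1 mst1.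
pose D (f : 'rV[R]_n * R -> R) k := (Gamma (2 - alpha) * hs k `^ alpha)^-1 *
  (f (x0, k.+1%:R * hs k) -
    \sum_(0 <= j < k.+1) scheme_C alpha k.+1 j * f (x0, j%:R * hs k)).
have DN : D (fun z => 0 + -1 * phi z) = (fun k => - D phi k).
  apply/funext => k; rewrite /D !add0r !mulN1r.
  under eq_bigr do rewrite add0r mulN1r mulrN.
  by rewrite sumrN; ring.
have {}c2 : D (fun z => 0 + -1 * phi z) @ \oo --> caputo alpha (fun z => 0 + -1 * phi z) x0 t0 := c2.
rewrite DN in c2; have {}c1 : D phi @ \oo --> caputo alpha phi x0 t0 := c1.
exact: (cvg_unique _ c2 (cvgN c1)).
Qed.

Lemma supersolutionN alpha F (w : 'rV[R]_n * R -> R) : 0 < alpha < 1 ->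
  subsolution alpha (oppF F) w -> supersolution alpha F (fun z => - w z).
Proof.
move=> a01 sw T T0; have [uw dw] := sw T T0; split; first exact: uw.
move=> phi x0 t0 cphi t0T [r r0 Hr].
have := dw (fun z => 0 + -1 * phi z) x0 t0 (C2_onN cphi) t0T.
have C0 : C2_on setT (fun _ : 'rV[R]_n => 0 : R) by exact: C2_cst.
have Cs := C2_slice cphi t0T.
rewrite (caputoN x0 a01 t0T cphi) (grad_lin (-1) C0 Cs) (hess_lin (-1) C0 Cs).
rewrite grad_cst hess_cst !add0r !scaleN1r /oppF !opprK -opprD oppr_le0; apply.
exists r => // x t xr tT tr; have := Hr x t xr tT tr; lra.
Qed.

Lemma ell_subsolutionN (G G' : 'rV[R]_n -> R -> 'rV[R]_n -> 'M[R]_n -> R) w :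
  (forall x s p X, G' x (- s) (- p) (- X) = - G x s p X) ->
  ell_supersolution G w -> ell_subsolution G' (fun x => - w x).
Proof.
move=> GG' [lw sw]; split.
  by rewrite /usc_on; under eq_fun do rewrite opprK.
move=> phi x0 cphi Hn.
have C0 : C2_on setT (fun _ : 'rV[R]_n => 0 : R) by exact: C2_cst.
have := sw (fun x => 0 + -1 * phi x) x0 (C2_lin (-1) C0 cphi).
rewrite (grad_lin (-1) C0 cphi) (hess_lin (-1) C0 cphi).
rewrite grad_cst hess_cst !add0r !scaleN1r => H.
rewrite -[grad phi x0]opprK -[hess phi x0]opprK GG' oppr_le0; apply: H.
by apply: filterS Hn => x; lra.
Qed.

Lemma subscheme_of alpha F h u0h U : BUC u0h -> is_scheme alpha F h u0h U ->
  subscheme alpha F h U /\ subscheme alpha (oppF F) h (fun m x => - U m x).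
Proof.
move=> [_ u0c] [U0 HU].
have cU m : continuous (U m).
  case: m => [|m]; first by rewrite U0; exact: unif_continuous_continuous.
  by have [[_ uc] _] := HU m.+1 isT; exact: unif_continuous_continuous.
split => m.
  by split=> [|/HU[_ [_ []]]].
split; first exact: continuousN_fun.
move=> /HU[_ [_ [_ su]]]; apply: ell_subsolutionN su => x s p X.
rewrite /scheme_eqn /oppF !opprK.
under eq_bigr do rewrite mulrN.
by rewrite sumrN; ring.
Qed.

End Opposite.

(** * Bounds and initial values *)

Section SchemeBounds.
Context {R : realType} {n : nat}.
Variables (alpha : R) (F : 'rV[R]_n -> R -> 'rV[R]_n -> 'M[R]_n -> R).
Variables (U : R -> nat -> 'rV[R]_n -> R).
Hypotheses (a01 : 0 < alpha < 1) (FB : F_locally_bounded F).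
Hypothesis subU : forall h, 0 < h -> subscheme alpha F h (U h).
Hypothesis bU : forall h, 0 < h -> forall m, exists B, forall x, `|U h m x| <= B.

Let barrier_constant r : 0 < r -> exists M C,
  [/\ F_bound F r M, 0 <= C & Gamma (2 - alpha) * M <= C * (1 - alpha)].
Proof.
move=> r0; have [M M0 FM] := F_boundP FB r0; have /andP[a0 a1] := a01.
have a10 : 0 < 1 - alpha by rewrite subr_gt0.
have G0 : 0 < Gamma (2 - alpha) by apply: Gamma_gt0; apply/andP; split; lra.
exists M, (Gamma (2 - alpha) * M / (1 - alpha)); split => //.
  by rewrite divr_ge0 ?mulr_ge0// ltW.
by rewrite divfK ?gt_eqF.
Qed.

Lemma scheme_upper_bound A : (\forall h \near 0^'+, forall x, U h 0 x <= A) ->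
  exists2 C, 0 <= C & \forall h \near 0^'+, forall m x,
    U h m x <= A + C * (m%:R * h) `^ alpha.
Proof.
move=> U0; have [|M [C [FM C0 MC]]] := @barrier_constant 6; first by [].
exists C => //; near=> h => m x.
have h0 : 0 < h by near: h; exact: nbhs_right_gt.
apply: (barrier_cst a01 h0 FM (subU h0) C0 MC (bU h0)) => //.
by near: h.
Unshelve. all: by end_near. Qed.

(** A barrier centred at [x0] dominates the initial datum and hence u^h. The four quarters of e pay
    for the oscillation of [u0] near [x0], the error of the discrete datum, the penalty near [x0],
    and the growth C t^alpha. *)
Lemma scheme_initial_upper (u0 : 'rV[R]_n -> R) x0 B0 B e :
  (forall x, `|u0 x| <= B0) -> {for x0, continuous u0} ->
  (forall e, 0 < e -> \forall h \near 0^'+, forall x, U h 0 x <= u0 x + e) ->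
  (\forall h \near 0^'+, forall m x, m%:R * h <= 1 -> `|U h m x| <= B) -> 0 < e ->
  \forall p \near locally_eventually 0^'+ spacetime (x0, 0),
    scheme_interp p.1 (U p.1) p.2 <= u0 x0 + e.
Proof.
move=> u0B cu0 U0 UB e0; have /andP[a0 a1] := a01.
have e40 : 0 < e / 4 by rewrite divr_gt0.
have /cvgrPdist_lt/(_ _ e40)/nbhs_normP[eta /= eta0 Heta] := cu0.
have B00 : 0 <= B0 by apply: le_trans (u0B x0).
have be0 := bump_gt0 eta0.
(* The first term lets the penalty exceed the oscillation 2 B0 of [u0] outside the eta-ball; the
   second is the condition of [barrier_penalty]; the third gives strictness. *)
pose c := 2 * B0 / bump_fun eta + 4 * `|B| + 1.
have cB0 : 0 <= 2 * B0 / bump_fun eta by rewrite divr_ge0 ?mulr_ge0// ltW.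
have B_ge := normr_ge0 B.
have c0 : 0 < c by rewrite /c; lra.
have Bc : 4 * `|B| < c by rewrite /c; lra.
have r0 : 0 < 6 * c by rewrite mulr_gt0.
have [M [C [FM C0 MC]]] := barrier_constant r0.
have u0c x : u0 x <= u0 x0 + e / 4 + c * penalty x0 x.
  have p0 : 0 <= c * penalty x0 x by rewrite mulr_ge0 ?penalty_ge0// ltW.
  have [xe|xe] := ltP `|x - x0| eta.
    have : `|u0 x0 - u0 x| < e / 4 by apply: Heta; rewrite /= distrC.
    by rewrite ltr_norml => /andP[h1 h2]; lra.
  have h1 : 2 * B0 <= c * penalty x0 x.
    apply: (@le_trans _ _ (c * bump_fun eta)).
      rewrite -ler_pdivrMr// /c; lra.
    by rewrite ler_wpM2l ?(ltW c0)// penalty_ge.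
  have := u0B x; have := u0B x0; rewrite !ler_norml => /andP[h2 h3] /andP[h4 h5]; lra.
(* [C] depends on [c], and so on e; the time horizon [s1] is therefore chosen after it. *)
have [s1 [[s10 s11] Cs1]] : exists s : R, (0 < s /\ s <= 1) /\ C * s `^ alpha < e / 4.
  have : C * s `^ alpha @[s --> 0^'+] --> (0 : R).
    by rewrite -[X in _ --> X](mulr0 C); apply: cvgMr; exact: powR_cvg0.
  move=> /cvgr0Pnorm_lt/(_ _ e40) H.
  have [s [h1 h2 h3]] : exists s : R, [/\ 0 < s, s <= 1 & `|C * s `^ alpha| < e / 4].
    apply: (@filter_ex _ (0^'+ : set_system R)); near=> s; split; near: s => //.
    - exact: nbhs_right_gt.
    - exact: nbhs_right_le.
  by exists s; split => //; rewrite (le_lt_trans (ler_norm _)).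
have : \forall x \near x0, `|c * penalty x0 x| < e / 4.
  have : {for x0, continuous (fun x => c * penalty x0 x)}.
    by apply: continuousMr_fun; exact: continuous_penalty.
  move=> /cvgrPdist_lt/(_ _ e40); apply: filterS => x.
  by rewrite penalty0 mulr0 sub0r normrN.
move=> /nbhs_normP[d /= d0 Hd].
have H : \forall h \near 0^'+, forall m x, m%:R * h <= 1 ->
    U h m x <= u0 x0 + e / 4 + e / 4 + c * penalty x0 x + C * (m%:R * h) `^ alpha.
  near=> h => m x mh.
  have h0 : 0 < h by near: h; exact: nbhs_right_gt.
  have UB' : forall m x, m%:R * h <= 1 -> `|U h m x| <= `|B|.
    move=> m' x' m'h; apply: le_trans (ler_norm B); move: m' x' m'h; near: h; exact: UB.
  have U0' : forall x, U h 0 x <= u0 x0 + e / 4 + e / 4 + c * penalty x0 x.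
    move=> y; have /le_trans : U h 0 y <= u0 y + e / 4 by move: y; near: h; exact: U0.
    by apply; have := u0c y; lra.
  exact: (barrier_penalty a01 h0 FM (subU h0) C0 MC (lexx _) c0 Bc UB' U0').
exists ([set h | 0 < h /\ forall m x, m%:R * h <= 1 ->
    U h m x <= u0 x0 + e / 4 + e / 4 + c * penalty x0 x + C * (m%:R * h) `^ alpha],
  [set z | spacetime z /\ (`|z.1 - x0| < Num.min d s1 /\ `|z.2 - 0| < Num.min d s1)]).
  split => /=.
    by apply: filterI => //; exact: nbhs_right_gt.
  have m0 : 0 < Num.min d s1 by rewrite lt_min d0.
  by apply: filterS (near_box (x0, 0) m0) => z h1 h2; split.
move=> [h [y s]] /= [[h0 Hh] [s0 [yd sd]]].
have {}s0 : 0 <= s := s0.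
move: yd sd; rewrite subr0 !lt_min (ger0_norm s0) => /andP[yd _] /andP[_ ss1].
rewrite /scheme_interp/=; have /andP[ms _] := truncn_grid h0 s0.
set m := Num.truncn _ in ms *.
have mh0 : 0 <= m%:R * h by rewrite mulr_ge0// ltW.
have := Hh m y (le_trans ms (le_trans (ltW ss1) s11)).
have : C * (m%:R * h) `^ alpha <= C * s1 `^ alpha.
  rewrite ler_wpM2l//; apply: ge0_ler_powR; rewrite ?nnegrE ?(ltW a0) ?(ltW s10)//.
  by rewrite (le_trans ms)// ltW.
have : `|c * penalty x0 y| < e / 4 by apply: Hd; rewrite /= distrC.
rewrite ltr_norml => /andP[_]; lra.
Unshelve. all: by end_near. Qed.

End SchemeBounds.

(** * Convergence *)

(** The two relaxed limits are identified for t >= 0 only, so the supersolution property has to pass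
    between functions that may differ at negative times. *)
Lemma supersolution_eq {R : realType} {n : nat} (alpha : R)
    (F : 'rV[R]_n -> R -> 'rV[R]_n -> 'M[R]_n -> R) (f g : 'rV[R]_n * R -> R) :
  (forall z, spacetime z -> g z = f z) -> supersolution alpha F f -> supersolution alpha F g.
Proof.
move=> fg sf T T0; have [lf df] := sf T T0.
have fgT z : strip T z -> g z = f z by move=> /andP[z0 _]; exact: fg.
split.
  apply/lsc_onP => z Sz e e0; have := (lsc_onP _ _).1 lf z Sz e e0.
  rewrite !near_withinE; apply: filterS => z' H Sz'.
  by rewrite !fgT//; exact: H.
move=> phi x0 t0 cphi t0T [r r0 Hr]; apply: df => //; exists r => // x t xr tT tr.
have t0T' : strip T (x0, t0) by case/andP: t0T => /ltW t00 t0T; apply/andP.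
by rewrite -!fgT//; exact: Hr.
Qed.

(** The real [sup] dominates its set only if this set is bounded above; boundedness of both
    functions supplies that. *)
Lemma near_BUC_dist {R : realType} {V : normedModType R} (f : R -> V -> R) (g : V -> R) :
  BUC g -> (forall h, 0 < h -> BUC (f h)) ->
  sup [set `|f h x - g x| | x in [set: V]] @[h --> 0^'+] --> 0 ->
  forall e, 0 < e -> \forall h \near 0^'+, forall x, `|f h x - g x| <= e.
Proof.
move=> [/bounded_on_exists[B1 _ gB] _] hf fg e e0.
near=> h => x.
have h0 : 0 < h by near: h; exact: nbhs_right_gt.
have [/bounded_on_exists[B2 _ fB] _] := hf h h0.
have hs : has_sup [set `|f h x - g x| | x in [set: V]].
  split; first by exists `|f h 0 - g 0|; exists 0.
  exists (B2 + B1) => _ [y _ <-]; rewrite (le_trans (ler_normB _ _))// lerD//.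
    exact: fB.
  exact: gB.
apply: (@le_trans _ _ (sup [set `|f h x - g x| | x in [set: V]])).
  by apply: sup_upper_bound => //; exists x.
rewrite (le_trans (ler_norm _))// ltW//.
by near: h; exact: (cvgr0_norm_lt _ fg _ e0).
Unshelve. all: by end_near. Qed.

Lemma uniform_cvg_real {R : realType} {I : Type} {F : set_system I} {FF : Filter F}
    {T : topologicalType} (K : set T) (f : I -> T -> R) (g : T -> R) :
  (forall e, 0 < e -> \forall i \near F, forall z, K z -> `|f i z - g z| < e) ->
  {uniform K, f i @[i --> F] --> g}.
Proof.
move=> fg P /uniform_nbhs[E [entE EP]].
move: entE; rewrite -entourage_ballE => -[e /= e0 eE].
apply: filterS (fg e e0) => i Hi; apply: EP => z Kz; apply: eE => /=.
by rewrite -ball_normE /ball_/= distrC; exact: Hi.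
Qed.

Theorem theorem1p1 (R : realType) (n : nat) (hn : (1 <= n)%N)
    (alpha : R) (halpha : 0 < alpha < 1)
    (u0 : 'rV[R]_n -> R) (hu0 : BUC u0)
    (F : 'rV[R]_n -> R -> 'rV[R]_n -> 'M[R]_n -> R)
    (hFcont : F_continuous F)
    (hFell : degenerate_elliptic F)
    (hFbnd : F_locally_bounded F)
    (H1 : elliptic_wellposed F)
    (H2 : parabolic_comparison alpha F)
    (u0h : R -> 'rV[R]_n -> R)
    (hu0h : forall h : R, 0 < h -> BUC (u0h h))
    (hu0h_cvg :
      sup [set `|u0h h x - u0 x| | x in [set: 'rV[R]_n]] @[h --> 0^'+] --> 0)
    (U : R -> nat -> 'rV[R]_n -> R)
    (hU : forall h : R, 0 < h -> is_scheme alpha F h (u0h h) (U h)) :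
  exists u : 'rV[R]_n * R -> R,
    [/\ cauchy_solution alpha F u0 u,
        bounded_on_strips u,
        forall v : 'rV[R]_n * R -> R,
          cauchy_solution alpha F u0 v -> bounded_on_strips v ->
          forall (x : 'rV[R]_n) (t : R), 0 <= t -> v (x, t) = u (x, t)
      & forall K : set ('rV[R]_n * R), compact K -> K `<=` spacetime ->
          {uniform K, scheme_interp h (U h) @[h --> 0^'+] --> u}].
Proof.
have [/bounded_on_exists[B0 B00 u0B] u0c] := hu0.
have cu0 := unif_continuous_continuous u0c.
pose V h m x : R := - U h m x.
have subU h : 0 < h -> subscheme alpha F h (U h).
  by move=> h0; have [] := subscheme_of (hu0h h h0) (hU h h0).
have subV h : 0 < h -> subscheme alpha (oppF F) h (V h).
  by move=> h0; have [] := subscheme_of (hu0h h h0) (hU h h0).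
have bU h : 0 < h -> forall m, exists B, forall x, `|U h m x| <= B.
  move=> h0 m; have [U0 Um] := hU h h0.
  have [/bounded_on_exists[B _ HB] _] : BUC (U h m).
    by case: m => [|m]; [rewrite U0; exact: hu0h|have [] := Um m.+1 isT].
  by exists B => x; exact: HB.
have bV h : 0 < h -> forall m, exists B, forall x, `|V h m x| <= B.
  by move=> h0 m; have [B HB] := bU h h0 m; exists B => x; rewrite normrN.
have hFN := F_locally_boundedN hFbnd.
have initU e : 0 < e -> \forall h \near 0^'+, forall x, `|U h 0 x - u0 x| <= e.
  move=> e0; near=> h => x; have h0 : 0 < h by near: h; exact: nbhs_right_gt.
  have [-> _] := hU h h0; move: x; near: h.
  exact: near_BUC_dist.
have initU1 e : 0 < e -> \forall h \near 0^'+, forall x, U h 0 x <= u0 x + e.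
  move=> e0; apply: filterS (initU e e0) => h H x.
  by have := H x; rewrite ler_norml => /andP[_]; lra.
have initV1 e : 0 < e -> \forall h \near 0^'+, forall x, V h 0 x <= - u0 x + e.
  move=> e0; apply: filterS (initU e e0) => h H x.
  by have := H x; rewrite ler_norml /V => /andP[]; lra.
have u0le x : `|u0 x| <= B0 by exact: u0B.
have [C1 C10 ub1] : exists2 C, 0 <= C & \forall h \near 0^'+, forall m x,
    U h m x <= (B0 + 1) + C * (m%:R * h) `^ alpha.
  apply: (scheme_upper_bound halpha hFbnd subU bU).
  apply: filterS (initU1 1 ltr01) => h H x; have := H x; have := u0le x.
  by rewrite ler_norml => /andP[_]; lra.
have [C2 C20 ub2] : exists2 C, 0 <= C & \forall h \near 0^'+, forall m x,
    V h m x <= (B0 + 1) + C * (m%:R * h) `^ alpha.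
  apply: (scheme_upper_bound halpha hFN subV bV).
  apply: filterS (initV1 1 ltr01) => h H x; have := H x; have := u0le x.
  by rewrite ler_norml => /andP[+ _]; lra.
(* [C1] comes from the barrier for u^h and [C2] from the one for -u^h; the summand 1 leaves room for
   the error of the discrete initial datum. *)
pose bd (s : R) := B0 + 1 + (C1 + C2) * s `^ alpha.
have ub : \forall h \near 0^'+, forall m x s, m%:R * h <= s -> `|U h m x| <= bd s.
  near=> h => m x s ms.
  have h0 : 0 < h by near: h; exact: nbhs_right_gt.
  have h1 : U h m x <= (B0 + 1) + C1 * (m%:R * h) `^ alpha.
    by move: m x {ms}; near: h.
  have h2 : V h m x <= (B0 + 1) + C2 * (m%:R * h) `^ alpha.
    by move: m x {ms h1}; near: h.
  have mh : 0 <= m%:R * h by rewrite mulr_ge0// ltW.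
  have h3 : (m%:R * h) `^ alpha <= s `^ alpha.
    apply: ge0_ler_powR; rewrite ?nnegrE//; first by case/andP: halpha => /ltW.
    exact: le_trans ms.
  have h4 : C1 * (m%:R * h) `^ alpha <= C1 * s `^ alpha by rewrite ler_wpM2l.
  have h5 : C2 * (m%:R * h) `^ alpha <= C2 * s `^ alpha by rewrite ler_wpM2l.
  have h6 : 0 <= C1 * s `^ alpha by rewrite mulr_ge0// powR_ge0.
  have h7 : 0 <= C2 * s `^ alpha by rewrite mulr_ge0// powR_ge0.
  rewrite /bd mulrDl ler_norml; apply/andP; split; last by lra.
  by move: h2; rewrite /V; lra.
pose w (h : R) := scheme_interp h (U h).
pose wN (h : R) := scheme_interp h (V h).
have bw_near (z : 'rV[R]_n * R) d : spacetime z -> 0 < d ->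
    \forall p \near locally_eventually (at_right (0 : R)) spacetime z, `|w p.1 p.2| <= bd (z.2 + d).
  move=> Sz d0.
  exists ([set h | 0 < h /\ forall m x s, m%:R * h <= s -> `|U h m x| <= bd s],
    [set z' | spacetime z' /\ (`|z'.1 - z.1| < d /\ `|z'.2 - z.2| < d)]).
    split => /=; first by apply: filterI => //; exact: nbhs_right_gt.
    by apply: filterS (near_box z d0) => z' h1 h2; split.
  move=> [h z'] /= [[h0 Hh] [Sz' [_ zz']]]; rewrite /w /scheme_interp/=; apply: Hh.
  have /andP[ms _] := truncn_grid h0 Sz'.
  by rewrite (le_trans ms)//; move: zz'; rewrite ltr_norml => /andP[_]; lra.
have bw : eventually_locally_bounded (at_right (0 : R)) spacetime w.
  by move=> z Sz; exists (bd (z.2 + 1)); exact: bw_near.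
have bwN : eventually_locally_bounded (at_right (0 : R)) spacetime wN.
  exact: (eventually_locally_boundedN bw).
pose ubar := relaxed_limit (at_right (0 : R)) spacetime w.
pose ulowN := relaxed_limit (at_right (0 : R)) spacetime wN.
have sub_ubar : subsolution alpha F ubar by exact: relaxed_subsolution.
have super_ulow : supersolution alpha F (fun z => - ulowN z).
  apply: supersolutionN => //.
  by apply: relaxed_subsolution => //; exact: F_continuousN.
have usc_ubar : usc_on spacetime ubar by exact: relaxed_limit_usc.
have lsc_ulow : lsc_on spacetime (fun z => - ulowN z) by exact: relaxed_limit_usc.
have bd_mono s t : 0 <= s -> s <= t -> bd s <= bd t.
  move=> s0 st; rewrite /bd lerD2l ler_wpM2l ?addr_ge0//; apply: ge0_ler_powR => //.
  - by case/andP: halpha => /ltW.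
  - by rewrite nnegrE (le_trans s0).
have bubar T z : strip T z -> `|ubar z| <= bd (T + 1).
  move=> /andP[z0 zT]; apply: relaxed_limit_abs_le => //.
  apply: locally_eventuallyS (bw_near z 1 z0 ltr01) => p /le_trans; apply; apply: bd_mono.
    by rewrite addr_ge0.
  by rewrite lerD2r ltW.
have bulow T z : strip T z -> `|- ulowN z| <= bd (T + 1).
  move=> /andP[z0 zT]; rewrite normrN; apply: relaxed_limit_abs_le => //.
  apply: locally_eventuallyS (bw_near z 1 z0 ltr01) => p; rewrite normrN => /le_trans; apply; apply: bd_mono.
    by rewrite addr_ge0.
  by rewrite lerD2r ltW.
have bs_ubar : bounded_on_strips ubar.
  by move=> T T0; apply: (@bounded_on_le _ _ _ _ (bd (T + 1))) => z; exact: bubar.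
have bs_ulow : bounded_on_strips (fun z => - ulowN z).
  by move=> T T0; apply: (@bounded_on_le _ _ _ _ (bd (T + 1))) => z; exact: bulow.
have S0 x : @spacetime R n (x, 0) by rewrite /spacetime/=.
have ub_init x : ubar (x, 0) <= u0 x.
  apply/ler_addgt0Pr => e e0; apply: relaxed_limit_le => //.
  apply: (scheme_initial_upper halpha hFbnd subU (B0 := B0) (B := bd 1)) => //.
    exact: cu0.
  by apply: filterS ub => h H m y; exact: H.
have ulow_init x : u0 x <= - ulowN (x, 0).
  rewrite lerNr; apply/ler_addgt0Pr => e e0; apply: relaxed_limit_le => //.
  apply: (scheme_initial_upper halpha hFN subV (u0 := fun x => - u0 x) (B0 := B0) (B := bd 1)) => //.
  - by move=> y; rewrite normrN.
  - exact: (continuousN_fun cu0).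
  - by apply: filterS ub => h H m y mh; rewrite normrN; exact: H.
have ubar_le z : spacetime z -> ubar z <= - ulowN z.
  case: z => x t t0; apply: (H2 _ _ usc_ubar lsc_ulow sub_ubar super_ulow bs_ubar bs_ulow) => //.
  by move=> y; exact: le_trans (ub_init y) (ulow_init y).
have ulow_le z : spacetime z -> - ulowN z <= ubar z by exact: relaxed_limit_lower_le.
have ubarE z : spacetime z -> ubar z = - ulowN z.
  by move=> Sz; apply/eqP; rewrite eq_le ubar_le// ulow_le.
have lsc_ubar : lsc_on spacetime ubar.
  apply/lsc_onP => z Sz e e0; have := (lsc_onP _ _).1 lsc_ulow z Sz e e0.
  rewrite !near_withinE; apply: filterS => z' H Sz'.
  by rewrite !ubarE//; exact: H.
exists ubar; split => //.
- split => //.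
  + exact: continuous_usc_lsc.
  + by apply: (supersolution_eq _ super_ulow) => z Sz; rewrite ubarE.
  + move=> x; apply/eqP; rewrite eq_le ub_init/= (le_trans (ulow_init x))//.
    exact: ulow_le.
(* A competitor is squeezed by (H2): as a subsolution it lies below the lower relaxed limit, as a
   supersolution above the upper one. *)
- move=> v [cv subv superv v0] bv x t t0; apply/eqP; rewrite eq_le; apply/andP; split.
    rewrite (@ubarE (x, t) t0).
    apply: (H2 v (fun z => - ulowN z)) => //; first exact: continuous_usc.
    by move=> y; rewrite v0.
  apply: (H2 ubar v) => //; first exact: continuous_lsc.
  by move=> y; rewrite v0.
- move=> K cK KS; apply: uniform_cvg_real => e e0.
  exact: (relaxed_limit_uniform bw cK KS ubar_le).
Unshelve. all: by end_near. Qed.
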